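(* Let $T\subset\mathbb R^3$ be a connected self-affine lattice tile such that $T+\mathbb Z^3$ is a tiling of $\mathbb R^3$, and suppose $T$ has a symmetry center $c$ (i.e. $2c-T=T$) which is not an interior point of $T$. Then the interior of $T$ is not simply connected. In particular, the interiors of the twindragons $\mathcal D=T_{0,1}$ and $\mathcal E=T_{2,-2}$ are not simply connected, and $\mathcal D$ and $\mathcal E$ are not homeomorphic to a closed ball.
   Context: A self-affine lattice tile: $M$ an integer $3\times3$ matrix with all eigenvalues of modulus $>1$, $m=|\det M|$, $k_1,\dots,k_m\in\mathbb R^3$ with $k_j-k_1\in\mathbb Z^3$ forming a complete set of residues of $\mathbb Z^3$ modulo $M\mathbb Z^3$, $f_j(x)=M^{-1}(x+k_j)$, $T=\bigcup_j f_j(T)$ compact nonempty. Twindragons: for integers $a,b$ let $M_{a,b}=\begin{pmatrix}0&0&2\\1&0&b\\0&1&a\end{pmatrix}$ (characteristic polynomial $-\lambda^3+a\lambda^2+b\lambda+2$), $e_1=(1,0,0)'$, $f_1(x)=M_{a,b}^{-1}(x-\tfrac12 e_1)$, $f_2(x)=M_{a,b}^{-1}(x+\tfrac12 e_1)$, and $T_{a,b}$ the compact set with $T_{a,b}=f_1(T_{a,b})\cup f_2(T_{a,b})$. For $(a,b)=(0,1)$ and $(2,-2)$ all eigenvalues of $M_{a,b}$ have modulus $>1$, $T_{a,b}$ is connected, $T_{a,b}+\mathbb Z^3$ is a tiling, and $T_{a,b}=-T_{a,b}$ (center $0$). *)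

(* Defs.v *)
From Stdlib Require Import Reals ZArith List.
Open Scope R_scope.

Definition R3 : Type := (R * R * R)%type.
Definition R2 : Type := (R * R)%type.

Definition vadd (p q : R3) : R3 :=
  let '(x1, y1, z1) := p in let '(x2, y2, z2) := q in (x1 + x2, y1 + y2, z1 + z2).
Definition vsub (p q : R3) : R3 :=
  let '(x1, y1, z1) := p in let '(x2, y2, z2) := q in (x1 - x2, y1 - y2, z1 - z2).
Definition vscale (r : R) (p : R3) : R3 :=
  let '(x, y, z) := p in (r * x, r * y, r * z).

Definition dist1 (a b : R) : R := Rabs (a - b).
Definition dist2 (p q : R2) : R :=
  let '(x1, y1) := p in let '(x2, y2) := q in
  sqrt ((x1 - x2) ^ 2 + (y1 - y2) ^ 2).
Definition dist3 (p q : R3) : R :=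
  let '(x1, y1, z1) := p in let '(x2, y2, z2) := q in
  sqrt ((x1 - x2) ^ 2 + (y1 - y2) ^ 2 + (z1 - z2) ^ 2).

Definition int3 (p : R3) : Prop :=
  exists a b c : Z, p = (IZR a, IZR b, IZR c).

Record mat3 : Type := Mat3 {
  m11 : Z; m12 : Z; m13 : Z;
  m21 : Z; m22 : Z; m23 : Z;
  m31 : Z; m32 : Z; m33 : Z }.

Definition mv (M : mat3) (p : R3) : R3 :=
  let '(x, y, z) := p in
  (IZR (m11 M) * x + IZR (m12 M) * y + IZR (m13 M) * z,
   IZR (m21 M) * x + IZR (m22 M) * y + IZR (m23 M) * z,
   IZR (m31 M) * x + IZR (m32 M) * y + IZR (m33 M) * z).

Definition det3 {A : Type} (add sub mul : A -> A -> A)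
  (a b c d e f g h i : A) : A :=
  sub (add (mul a (sub (mul e i) (mul f h))) (mul c (sub (mul d h) (mul e g))))
      (mul b (sub (mul d i) (mul f g))).

Definition detZ (M : mat3) : Z :=
  det3 Z.add Z.sub Z.mul (m11 M) (m12 M) (m13 M) (m21 M) (m22 M) (m23 M)
       (m31 M) (m32 M) (m33 M).

Definition Cx : Type := (R * R)%type.
Definition Cadd (u v : Cx) : Cx := (fst u + fst v, snd u + snd v).
Definition Csub (u v : Cx) : Cx := (fst u - fst v, snd u - snd v).
Definition Cmul (u v : Cx) : Cx :=
  (fst u * fst v - snd u * snd v, fst u * snd v + snd u * fst v).
Definition Cz (z : Z) : Cx := (IZR z, 0).
Definition Cmod (u : Cx) : R := sqrt (fst u ^ 2 + snd u ^ 2).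

Definition eigenvalue (M : mat3) (lam : Cx) : Prop :=
  det3 Cadd Csub Cmul
    (Csub lam (Cz (m11 M))) (Csub (0,0) (Cz (m12 M))) (Csub (0,0) (Cz (m13 M)))
    (Csub (0,0) (Cz (m21 M))) (Csub lam (Cz (m22 M))) (Csub (0,0) (Cz (m23 M)))
    (Csub (0,0) (Cz (m31 M))) (Csub (0,0) (Cz (m32 M))) (Csub lam (Cz (m33 M)))
  = (0, 0).

Definition expanding (M : mat3) : Prop :=
  forall lam : Cx, eigenvalue M lam -> 1 < Cmod lam.

Definition in_MZ3 (M : mat3) (p : R3) : Prop :=
  exists w : R3, int3 w /\ p = mv M w.

(* k_0, ..., k_{m-1} (indices shifted to start at 0), m = |det M|:
   k_j - k_0 in Z^3, and they form a complete residue system of Z^3 mod M Z^3 *)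
Definition digit_system (M : mat3) (k : nat -> R3) : Prop :=
  let m := Z.to_nat (Z.abs (detZ M)) in
  (forall j, (j < m)%nat -> int3 (vsub (k j) (k 0%nat))) /\
  (forall i j, (i < m)%nat -> (j < m)%nat ->
      in_MZ3 M (vsub (k i) (k j)) -> i = j) /\
  (forall z, int3 z -> exists j, (j < m)%nat /\
      in_MZ3 M (vsub z (vsub (k j) (k 0%nat)))).

Definition open3 (U : R3 -> Prop) : Prop :=
  forall x, U x -> exists e, 0 < e /\ forall y, dist3 x y < e -> U y.

Definition interior3 (T : R3 -> Prop) (x : R3) : Prop :=
  exists e, 0 < e /\ forall y, dist3 x y < e -> T y.

Definition nonempty (T : R3 -> Prop) : Prop := exists x, T x.

Definition compact3 (T : R3 -> Prop) : Prop :=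
  forall (I : Type) (U : I -> R3 -> Prop),
    (forall i, open3 (U i)) ->
    (forall x, T x -> exists i, U i x) ->
    exists l : list I, forall x, T x -> exists i, In i l /\ U i x.

Definition connected3 (T : R3 -> Prop) : Prop :=
  ~ exists U V : R3 -> Prop,
      open3 U /\ open3 V /\
      (forall x, T x -> U x \/ V x) /\
      (exists x, T x /\ U x) /\ (exists x, T x /\ V x) /\
      (forall x, T x -> U x -> V x -> False).

Definition cont_on {X : Type} (d : X -> X -> R) (A : X -> Prop) (f : X -> R3)
  : Prop :=
  forall x, A x -> forall eps, 0 < eps -> exists delta, 0 < delta /\
    forall y, A y -> d x y < delta -> dist3 (f x) (f y) < eps.

Definition I01 (t : R) : Prop := 0 <= t <= 1.
Definition square01 (p : R2) : Prop := I01 (fst p) /\ I01 (snd p).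

Definition path_in (O : R3 -> Prop) (g : R -> R3) : Prop :=
  cont_on dist1 I01 g /\ forall t, I01 t -> O (g t).

Definition path_connected (O : R3 -> Prop) : Prop :=
  forall x y, O x -> O y -> exists g, path_in O g /\ g 0 = x /\ g 1 = y.

Definition simply_connected (O : R3 -> Prop) : Prop :=
  nonempty O /\ path_connected O /\
  forall g : R -> R3, path_in O g -> g 0 = g 1 ->
    exists H : R2 -> R3,
      cont_on dist2 square01 H /\
      (forall p, square01 p -> O (H p)) /\
      (forall t, I01 t -> H (0, t) = g t) /\
      (forall t, I01 t -> H (1, t) = H (1, 0)) /\
      (forall s, I01 s -> H (s, 0) = H (s, 1)).

Definition homeomorphic (A B : R3 -> Prop) : Prop :=
  exists f g : R3 -> R3,
    (forall x, A x -> B (f x)) /\ (forall y, B y -> A (g y)) /\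
    (forall x, A x -> g (f x) = x) /\ (forall y, B y -> f (g y) = y) /\
    cont_on dist3 A f /\ cont_on dist3 B g.

Definition closed_ball (x : R3) : Prop := dist3 x (0, 0, 0) <= 1.

(* T = U_j f_j(T) with f_j(x) = M^{-1}(x + k_j); y is in f_j(T) iff M y - k_j in T *)
Definition self_affine_lattice_tile (T : R3 -> Prop) : Prop :=
  exists (M : mat3) (k : nat -> R3),
    expanding M /\ digit_system M k /\ compact3 T /\ nonempty T /\
    forall y, T y <->
      exists j, (j < Z.to_nat (Z.abs (detZ M)))%nat /\ T (vsub (mv M y) (k j)).

Definition translate (T : R3 -> Prop) (z : R3) : R3 -> Prop :=
  fun x => T (vsub x z).

Definition lattice_tiling (T : R3 -> Prop) : Prop :=
  (forall x, exists z, int3 z /\ T (vsub x z)) /\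
  (forall z z', int3 z -> int3 z' -> z <> z' ->
     forall x, interior3 (translate T z) x -> interior3 (translate T z') x -> False).

Definition M_ab (a b : Z) : mat3 := Mat3 0 0 2 1 0 b 0 1 a.
Definition half_e1 : R3 := (/ 2, 0, 0).

(* T = f_1(T) U f_2(T), f_1(x) = M^{-1}(x - e1/2), f_2(x) = M^{-1}(x + e1/2) *)
Definition twindragon_eq (a b : Z) (T : R3 -> Prop) : Prop :=
  forall y, T y <->
    T (vadd (mv (M_ab a b) y) half_e1) \/ T (vsub (mv (M_ab a b) y) half_e1).

(* Main.v *)
From Stdlib Require Import Reals ZArith List Lia Lra Bool Btauto Ring Relations.
From Stdlib Require Import Classical ClassicalEpsilon.
From Coquelicot Require Import Coquelicot.
Require Import Defs.
Open Scope R_scope.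

(** If the interior [O] of [T] were simply connected, a path in [O] from [x] to [2c - x]
    followed by its reflection would bound a disc in [O]; the disc and its reflection form
    a sphere in [O] that is odd about [c]. By Borsuk's theorem, proved here with Fan's
    combinatorial parity count, such a sphere separates [c] from infinity. But the
    complement of [O] is the union of the translates [T + z] with [z <> 0]; [c] lies in one
    of them, and the connected sets [T + z], [T + z + n], [T + z + 2n], ... lead from [c]
    to infinity when [n] is a neighbour direction of the right sign.

    For a twindragon homeomorphic to a ball, invariance of domain (again by Borsuk's
    theorem) lets the same argument run inside the ball. That a twindragon satisfies the
    hypotheses is reduced to finite computations: half-integer points of [T] are exhibited
    by finite sets stable under the expansion, and a point lying in no other translate is
    given by a finite digit word that expels every nonzero integer difference from a box
    containing [T - T]. *)

(** * Fan's parity count on boxes *)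

(** A homotopy to a constant in R^3 minus the origin is a map of the cone over the sphere. On a fine
    grid of the cone each vertex is labelled by its dominant signed coordinate; continuity forbids
    complementary neighbours, while oddness on the base forces an odd count.

    Connectedness enters through e-chains. A sphere inside an open set keeps a positive distance
    from the complement, so moving the centre of projection by shorter steps never makes the
    difference vanish. Chains also suit self-affine sets: the contractions refine them.

    The delicate point is disjointness. A tiling separates interiors of tiles, whereas the argument
    wants the interior of [T] to miss every other closed translate. Magnification by [M^n] reduces
    this to a single point lying in no other translate. For general tiles such a point comes from
    shrinking balls. For twindragons the covering comes from radix sums, and the chains from a point
    common to both pieces. *)

Inductive lab : Type := P1 | N1 | P2 | N2 | P3 | N3.

Definition lneg (a : lab) : lab :=
  match a with P1 => N1 | N1 => P1 | P2 => N2 | N2 => P2 | P3 => N3 | N3 => P3 end.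

(* [fan1], [fan2], [fan3] recognise label sets that are alternating in sign when
   ordered by absolute value, the least one being positive. *)
Definition fan1 (a : lab) : bool :=
  match a with P1 | P2 | P3 => true | _ => false end.

Definition fan2 (a b : lab) : bool :=
  match a, b with
  | P1, N2 | N2, P1 | P1, N3 | N3, P1 | P2, N3 | N3, P2 => true
  | _, _ => false
  end.

Definition fan3 (a b c : lab) : bool :=
  match a, b, c with
  | P1, N2, P3 | P1, P3, N2 | N2, P1, P3 | N2, P3, P1 | P3, P1, N2 | P3, N2, P1 => true
  | _, _, _ => false
  end.

Lemma fan1_neg (a : lab) : fan1 (lneg a) = negb (fan1 a).
Proof. destruct a; reflexivity. Qed.

Lemma lneg_invol (a : lab) : lneg (lneg a) = a.
Proof. destruct a; reflexivity. Qed.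

Lemma fan2_diag (a : lab) : fan2 a a = false.
Proof. destruct a; reflexivity. Qed.

Lemma fan3_diag12 (a b : lab) : fan3 a a b = false.
Proof. destruct a, b; reflexivity. Qed.

Lemma fan3_diag23 (a b : lab) : fan3 a b b = false.
Proof. destruct a, b; reflexivity. Qed.

(** Labels of opposite sign that are not complementary differ in absolute value, so they alternate,
    with a positive least label either as they stand or after negation. Labels of equal sign never
    alternate. *)
Lemma fan_cobound1 (a b : lab) : a <> lneg b ->
  xorb (fan2 a b) (fan2 (lneg a) (lneg b)) = xorb (fan1 a) (fan1 b).
Proof. destruct a, b; simpl; intros H; try reflexivity; exfalso; apply H; reflexivity. Qed.

(** Fan's identity one dimension up: the edges counted by [fan2] are odd in number exactly when the
    triangle alternates, with either leading sign. *)
Lemma fan_cobound2 (a b c : lab) : a <> lneg b -> a <> lneg c -> b <> lneg c ->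
  xorb (fan3 a b c) (fan3 (lneg a) (lneg b) (lneg c)) =
  xorb (fan2 a b) (xorb (fan2 b c) (fan2 a c)).
Proof.
  destruct a, b; simpl; intros H1; (destruct c; simpl; intros H2 H3;
  first [reflexivity | exfalso; now apply H1 | exfalso; now apply H2 | exfalso; now apply H3]).
Qed.

(** Only three absolute values exist, so four labels cannot alternate; the count over the faces of a
    tetrahedron is therefore even. *)
Lemma fan_cobound3 (a b c d : lab) :
  a <> lneg b -> a <> lneg c -> a <> lneg d -> b <> lneg c -> b <> lneg d -> c <> lneg d ->
  xorb (xorb (fan3 b c d) (fan3 a c d)) (xorb (fan3 a b d) (fan3 a b c)) = false.
Proof.
  destruct a, b; simpl; intros H1; try (exfalso; now apply H1);
  (destruct c; simpl; intros H2 H3 H4; try (exfalso; now apply H2);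
    try (exfalso; now apply H4);
   (destruct d; simpl; intros H5 H6;
    first [reflexivity | exfalso; now apply H3 | exfalso; now apply H5 | exfalso; now apply H6])).
Qed.

Fixpoint xsum (n : nat) (f : nat -> bool) : bool :=
  match n with O => false | S m => xorb (xsum m f) (f m) end.

Lemma xsum_ext (n : nat) (f g : nat -> bool) :
  (forall i, (i < n)%nat -> f i = g i) -> xsum n f = xsum n g.
Proof.
  induction n as [|n IH]; intros H; simpl; [reflexivity|].
  rewrite IH, H by (intros; try apply H; lia). reflexivity.
Qed.

Lemma xsum_false (n : nat) (f : nat -> bool) :
  (forall i, (i < n)%nat -> f i = false) -> xsum n f = false.
Proof.
  induction n as [|n IH]; intros H; simpl; [reflexivity|].
  rewrite IH, H by (intros; try apply H; lia). reflexivity.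
Qed.

Lemma xsum_xorb (n : nat) (f g : nat -> bool) :
  xsum n (fun i => xorb (f i) (g i)) = xorb (xsum n f) (xsum n g).
Proof. induction n as [|n IH]; simpl; [reflexivity|]. rewrite IH. btauto. Qed.

Lemma xsum_telescope (n : nat) (f : nat -> bool) :
  xsum n (fun i => xorb (f i) (f (S i))) = xorb (f O) (f n).
Proof. induction n as [|n IH]; simpl; [btauto|]. rewrite IH. btauto. Qed.

Lemma xsum_swap (n m : nat) (f : nat -> nat -> bool) :
  xsum n (fun i => xsum m (f i)) = xsum m (fun j => xsum n (fun i => f i j)).
Proof.
  induction n as [|n IH]; simpl.
  - symmetry. apply xsum_false. reflexivity.
  - rewrite IH, <- xsum_xorb. reflexivity.
Qed.

Lemma xsum_add (n m : nat) (f : nat -> bool) :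
  xsum (n + m) f = xorb (xsum n f) (xsum m (fun i => f (n + i)%nat)).
Proof.
  induction m as [|m IH]; simpl.
  - rewrite Nat.add_0_r. btauto.
  - rewrite Nat.add_succ_r. simpl. rewrite IH. btauto.
Qed.

(* The unit square with corners [a] (least) and [d] (greatest), cut along [ad]. *)
Definition sq (a b c d : lab) : bool := xorb (fan3 a b d) (fan3 a c d).

(** The cube is filled by six tetrahedra, one for each monotone edge path from the least to the
    greatest corner. Each inner triangle lies in two of them and cancels; on the outer faces they
    induce the cuts used in [sq]. *)
Lemma cube_cobound (l : bool -> bool -> bool -> lab) :
  (forall a b c a' b' c', l a b c <> lneg (l a' b' c')) ->
  let q1 x := sq (l x false false) (l x true false) (l x false true) (l x true true) in
  let q2 y := sq (l false y false) (l true y false) (l false y true) (l true y true) in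
  let q3 z := sq (l false false z) (l true false z) (l false true z) (l true true z) in
  xorb (xorb (q1 false) (q1 true))
    (xorb (xorb (q2 false) (q2 true)) (xorb (q3 false) (q3 true))) = false.
Proof.
  intros H q1 q2 q3. unfold q1, q2, q3, sq.
  assert (T : forall a1 a2 a3 b1 b2 b3, xorb
    (xorb (fan3 (l a1 a2 a3) (l b1 b2 b3) (l true true true))
          (fan3 (l false false false) (l b1 b2 b3) (l true true true)))
    (xorb (fan3 (l false false false) (l a1 a2 a3) (l true true true))
          (fan3 (l false false false) (l a1 a2 a3) (l b1 b2 b3))) = false).
  { intros. apply fan_cobound3; apply H. }
  generalize (T true false false true true false) (T true false false true false true)
    (T false true false true true false) (T false true false false true true)
    (T false false true true false true) (T false false true false true true).
  intros T1 T2 T3 T4 T5 T6.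
  match type of T1 with ?t1 = _ => match type of T2 with ?t2 = _ =>
  match type of T3 with ?t3 = _ => match type of T4 with ?t4 = _ =>
  match type of T5 with ?t5 = _ => match type of T6 with ?t6 = _ =>
    transitivity (xorb t1 (xorb t2 (xorb t3 (xorb t4 (xorb t5 t6)))))
  end end end end end end.
  - clear.
    repeat match goal with |- context [fan3 ?a ?b ?c] => generalize (fan3 a b c); intro end.
    btauto.
  - rewrite T1, T2, T3, T4, T5, T6. reflexivity.
Qed.

Definition xsum2 (n : nat) (f : nat -> nat -> bool) : bool :=
  xsum n (fun i => xsum n (f i)).

Lemma xsum2_xorb (n : nat) (f g : nat -> nat -> bool) :
  xsum2 n (fun i j => xorb (f i j) (g i j)) = xorb (xsum2 n f) (xsum2 n g).
Proof.
  unfold xsum2. rewrite <- xsum_xorb. apply xsum_ext. intros i _. apply xsum_xorb.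
Qed.

Lemma xsum2_telescope1 (n : nat) (f : nat -> nat -> bool) :
  xsum2 n (fun i j => xorb (f i j) (f (S i) j)) =
  xorb (xsum n (f O)) (xsum n (f n)).
Proof.
  unfold xsum2. rewrite xsum_swap, <- xsum_xorb. apply xsum_ext. intros j _.
  apply (xsum_telescope n (fun i => f i j)).
Qed.

Lemma xsum2_telescope2 (n : nat) (f : nat -> nat -> bool) :
  xsum2 n (fun i j => xorb (f i j) (f i (S j))) =
  xorb (xsum n (fun i => f i O)) (xsum n (fun i => f i n)).
Proof.
  unfold xsum2. rewrite <- xsum_xorb. apply xsum_ext. intros i _. apply xsum_telescope.
Qed.

Lemma xsum2_ext (n : nat) (f g : nat -> nat -> bool) :
  (forall i j, (i < n)%nat -> (j < n)%nat -> f i j = g i j) -> xsum2 n f = xsum2 n g.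
Proof. intros H. apply xsum_ext. intros i Hi. apply xsum_ext. auto. Qed.

Lemma xsum2_false (n : nat) (f : nat -> nat -> bool) :
  (forall i j, (i < n)%nat -> (j < n)%nat -> f i j = false) -> xsum2 n f = false.
Proof. intros H. apply xsum_false. intros i Hi. apply xsum_false. auto. Qed.

Definition sqsum (n : nat) (l : nat -> nat -> lab) : bool :=
  xsum2 n (fun i j => sq (l i j) (l (S i) j) (l i (S j)) (l (S i) (S j))).

Definition adj (i j : nat) : Prop := (i <= S j /\ j <= S i)%nat.

(** Summing [cube_cobound] over all cells, the two contributions of every inner face cancel and the
    six sides of the box remain. *)
Lemma box_parity (n : nat) (l : nat -> nat -> nat -> lab) :
  (forall i j k i' j' k',
    (i <= n)%nat -> (j <= n)%nat -> (k <= n)%nat ->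
    (i' <= n)%nat -> (j' <= n)%nat -> (k' <= n)%nat ->
    adj i i' -> adj j j' -> adj k k' -> l i j k <> lneg (l i' j' k')) ->
  xorb (xorb (sqsum n (fun j k => l O j k)) (sqsum n (fun j k => l n j k)))
    (xorb (xorb (sqsum n (fun i k => l i O k)) (sqsum n (fun i k => l i n k)))
          (xorb (sqsum n (fun i j => l i j O)) (sqsum n (fun i j => l i j n)))) = false.
Proof.
  intros nc.
  set (F1 := fun i j k => sq (l i j k) (l i (S j) k) (l i j (S k)) (l i (S j) (S k))).
  set (F2 := fun i j k => sq (l i j k) (l (S i) j k) (l i j (S k)) (l (S i) j (S k))).
  set (F3 := fun i j k => sq (l i j k) (l (S i) j k) (l i (S j) k) (l (S i) (S j) k)).
  assert (loc : forall i j k, (i < n)%nat -> (j < n)%nat -> (k < n)%nat ->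
    xorb (xorb (F1 i j k) (F1 (S i) j k))
      (xorb (xorb (F2 i j k) (F2 i (S j) k)) (xorb (F3 i j k) (F3 i j (S k)))) = false).
  { intros i j k Hi Hj Hk.
    set (sh := fun (b : bool) m => if b then S m else m).
    apply (cube_cobound (fun a b c => l (sh a i) (sh b j) (sh c k))).
    intros a b c a' b' c'. unfold sh.
    apply nc; destruct a, b, c, a', b', c'; unfold adj; lia. }
  assert (tot : xsum n (fun i => xsum2 n (fun j k =>
    xorb (xorb (F1 i j k) (F1 (S i) j k))
      (xorb (xorb (F2 i j k) (F2 i (S j) k)) (xorb (F3 i j k) (F3 i j (S k)))))) = false).
  { apply xsum_false. intros i Hi. apply xsum2_false. intros; apply loc; assumption. }
  rewrite <- tot. clear tot loc.
  transitivity (xsum n (fun i => xorb (xorb (xsum2 n (F1 i)) (xsum2 n (F1 (S i))))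
    (xorb (xorb (xsum n (F2 i O)) (xsum n (F2 i n)))
          (xorb (xsum n (fun j => F3 i j O)) (xsum n (fun j => F3 i j n)))))).
  - rewrite !xsum_xorb.
    rewrite <- (xsum_xorb n (fun i => xsum2 n (F1 i)) (fun i => xsum2 n (F1 (S i)))).
    rewrite (xsum_telescope n (fun i => xsum2 n (F1 i))). reflexivity.
  - apply xsum_ext. intros i _. rewrite !xsum2_xorb.
    rewrite <- (xsum2_xorb n (F2 i) (fun j k => F2 i (S j) k)), xsum2_telescope1.
    rewrite <- (xsum2_xorb n (F3 i) (fun j k => F3 i j (S k))), xsum2_telescope2.
    reflexivity.
Qed.

(** [fan_cobound2] is summed over both triangles of each cell; diagonals and inner edges occur
    twice, which leaves the boundary. *)
Lemma square_parity (n : nat) (l : nat -> nat -> lab) :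
  (forall i j i' j',
    (i <= n)%nat -> (j <= n)%nat -> (i' <= n)%nat -> (j' <= n)%nat ->
    adj i i' -> adj j j' -> l i j <> lneg (l i' j')) ->
  xorb (sqsum n l) (sqsum n (fun i j => lneg (l i j))) =
  xorb (xorb (xsum n (fun j => fan2 (l O j) (l O (S j))))
             (xsum n (fun j => fan2 (l n j) (l n (S j)))))
       (xorb (xsum n (fun i => fan2 (l i O) (l (S i) O)))
             (xsum n (fun i => fan2 (l i n) (l (S i) n)))).
Proof.
  intros nc. unfold sqsum. rewrite <- xsum2_xorb.
  rewrite <- (xsum2_telescope1 n (fun i j => fan2 (l i j) (l i (S j)))).
  rewrite <- (xsum2_telescope2 n (fun i j => fan2 (l i j) (l (S i) j))).
  rewrite <- xsum2_xorb. apply xsum2_ext. intros i j Hi Hj.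
  pose proof (fan_cobound2 (l i j) (l (S i) j) (l (S i) (S j))) as E1.
  pose proof (fan_cobound2 (l i j) (l i (S j)) (l (S i) (S j))) as E2.
  unfold sq.
  transitivity (xorb
    (xorb (fan3 (l i j) (l (S i) j) (l (S i) (S j)))
       (fan3 (lneg (l i j)) (lneg (l (S i) j)) (lneg (l (S i) (S j)))))
    (xorb (fan3 (l i j) (l i (S j)) (l (S i) (S j)))
       (fan3 (lneg (l i j)) (lneg (l i (S j))) (lneg (l (S i) (S j)))))); [ring|].
  rewrite E1, E2 by (apply nc; unfold adj; lia). ring.
Qed.

(** The second half of the circle carries the negated labels. Pairing opposite edges turns
    [fan_cobound1] into a telescoping sum of sign changes from [l 0] to its negative, hence an odd
    number. *)
Lemma circle_parity (N : nat) (l : nat -> lab) :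
  (forall j, (j < N)%nat -> l j <> lneg (l (S j))) ->
  (forall j, (j <= N)%nat -> l (N + j)%nat = lneg (l j)) ->
  xsum (N + N) (fun j => fan2 (l j) (l (S j))) = true.
Proof.
  intros nc od. rewrite xsum_add.
  transitivity (xsum N (fun j => xorb (fan1 (l j)) (fan1 (l (S j))))).
  - rewrite <- xsum_xorb. apply xsum_ext. intros j Hj.
    rewrite <- fan_cobound1 by auto.
    rewrite <- Nat.add_succ_r, !od by lia. reflexivity.
  - rewrite (xsum_telescope N (fun j => fan1 (l j))).
    replace (l N) with (lneg (l O)) by (rewrite <- od by lia; f_equal; lia).
    rewrite fan1_neg. destruct (fan1 (l O)); reflexivity.
Qed.

(* The two values of [b] are the hemispheres, glued along [i = 0]
   and each collapsed to a pole along [i = n]; [j] is the periodic longitude and [k]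
   the radial coordinate. *)
Theorem no_antipodal_cone_labelling (N n : nat) (l : bool -> nat -> nat -> nat -> lab) :
  n = (N + N)%nat ->
  (forall b i j k i' j' k',
    (i <= n)%nat -> (j <= n)%nat -> (k <= n)%nat ->
    (i' <= n)%nat -> (j' <= n)%nat -> (k' <= n)%nat ->
    adj i i' -> adj j j' -> adj k k' -> l b i j k <> lneg (l b i' j' k')) ->
  (forall b i k, (i <= n)%nat -> (k <= n)%nat -> l b i n k = l b i O k) ->
  (forall j k, (j <= n)%nat -> (k <= n)%nat -> l true O j k = l false O j k) ->
  (forall b j k, (j <= n)%nat -> (k <= n)%nat -> l b n j k = l b n O k) ->
  (forall i j, (i <= n)%nat -> (j <= N)%nat -> l false i j O = lneg (l true i (N + j)%nat O)) ->
  (forall i j, (i <= n)%nat -> (j <= N)%nat -> l false i (N + j)%nat O = lneg (l true i j O)) ->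
  (forall b i j, (i <= n)%nat -> (j <= n)%nat -> l b i j n = l b O O n) ->
  False.
Proof.
  intros Hn nc per glue pole odd1 odd2 top.
  (* On each hemisphere the pole side and the side [k = n] are degenerate and the two longitude
     sides agree, so the base has the parity of the equatorial wall. *)
  assert (B : forall b, sqsum n (fun i j => l b i j O) = sqsum n (fun j k => l b O j k)).
  { intros b. pose proof (box_parity n (l b) (nc b)) as E.
    assert (E1 : sqsum n (fun j k => l b n j k) = false).
    { apply xsum2_false. intros j k Hj Hk. unfold sq.
      rewrite !(pole b j), !(pole b (S j)) by lia.
      rewrite fan3_diag12, fan3_diag23. reflexivity. }
    assert (E2 : sqsum n (fun i k => l b i n k) = sqsum n (fun i k => l b i O k)).
    { apply xsum2_ext. intros i k Hi Hk. rewrite !per by lia. reflexivity. }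
    assert (E3 : sqsum n (fun i j => l b i j n) = false).
    { apply xsum2_false. intros i j Hi Hj. unfold sq.
      rewrite !(top b i), !(top b (S i)) by lia. rewrite fan3_diag12. reflexivity. }
    rewrite E1, E2, E3 in E. revert E.
    destruct (sqsum n (fun j k => l b O j k)), (sqsum n (fun i k => l b i O k)),
      (sqsum n (fun i j => l b i j O)); simpl; congruence. }
  assert (G : sqsum n (fun j k => l true O j k) = sqsum n (fun j k => l false O j k)).
  { apply xsum2_ext. intros j k Hj Hk. rewrite !glue by lia. reflexivity. }
  assert (Z : sqsum n (fun i j => l true i j O) = sqsum n (fun i j => l false i j O))
    by (rewrite !B; exact G).
  (* The antipodal map swaps the hemispheres and the two halves of the longitude range, so the base
     of [false] counts the negated labels on the base of [true]. *)
  assert (sh : sqsum n (fun i j => l false i j O) = sqsum n (fun i j => lneg (l true i j O))).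
  { apply xsum_ext. intros i Hi. rewrite Hn, !xsum_add.
    rewrite (xorb_comm (xsum N (fun j => sq (lneg _) _ _ _))).
    f_equal; apply xsum_ext; intros j Hj; rewrite <- ?Nat.add_succ_r.
    - rewrite !odd1 by lia. reflexivity.
    - rewrite !odd2 by lia. reflexivity. }
  (* The two sums on the left now coincide, while on the right only the equator survives, and its
     parity is odd. *)
  pose proof (square_parity n (fun i j => l true i j O)) as Q.
  simpl in Q. rewrite <- sh, <- Z in Q.
  rewrite xorb_nilpotent in Q.
  assert (C : xsum n (fun j => fan2 (l true O j O) (l true O (S j) O)) = true).
  { rewrite Hn. apply circle_parity.
    - intros j Hj. apply nc; unfold adj; lia.
    - intros j Hj. rewrite glue by lia. apply odd2; lia. }
  assert (D : xsum n (fun j => fan2 (l true n j O) (l true n (S j) O)) = false).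
  { apply xsum_false. intros j Hj. rewrite (pole true j), (pole true (S j)) by lia.
    apply fan2_diag. }
  assert (E : xsum n (fun i => fan2 (l true i n O) (l true (S i) n O)) =
              xsum n (fun i => fan2 (l true i O O) (l true (S i) O O))).
  { apply xsum_ext. intros i Hi. rewrite !per by lia. reflexivity. }
  rewrite C, D, E, xorb_nilpotent in Q. simpl in Q.
  discriminate Q. intros. apply nc; unfold adj in *; lia.
Qed.

(** * The sup norm and continuity *)

Definition c1 (p : R3) : R := fst (fst p).
Definition c2 (p : R3) : R := snd (fst p).
Definition c3 (p : R3) : R := snd p.

(** The sup norm makes estimates linear in the coordinates, and it is attained at the coordinate
    that the labelling records. *)
Definition nrm (p : R3) : R := Rmax (Rabs (c1 p)) (Rmax (Rabs (c2 p)) (Rabs (c3 p))).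

Ltac vec_unfold :=
  repeat match goal with p : R3 |- _ => destruct p as [[? ?] ?] end;
  cbv [vadd vsub vscale mv c1 c2 c3 fst snd] in *.
Ltac vec :=
  repeat match goal with p : R3 |- context [?q] => constr_eq p q; destruct p as [[? ?] ?] end;
  cbv [vadd vsub vscale mv c1 c2 c3 fst snd];
  repeat match goal with |- (_, _) = (_, _) => apply f_equal2 end; try ring; try lra.

Lemma nrm_lt (p : R3) (e : R) :
  nrm p < e <-> Rabs (c1 p) < e /\ Rabs (c2 p) < e /\ Rabs (c3 p) < e.
Proof.
  unfold nrm. split.
  - intros H. repeat split; eapply Rle_lt_trans; try exact H;
      eauto using Rmax_l, Rmax_r, Rle_trans.
  - intros (H1 & H2 & H3). repeat apply Rmax_lub_lt; assumption.
Qed.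

Lemma nrm_le (p : R3) (e : R) :
  nrm p <= e <-> Rabs (c1 p) <= e /\ Rabs (c2 p) <= e /\ Rabs (c3 p) <= e.
Proof.
  unfold nrm. split.
  - intros H. repeat split; eapply Rle_trans; try exact H;
      eauto using Rmax_l, Rmax_r, Rle_trans.
  - intros (H1 & H2 & H3). repeat apply Rmax_lub; assumption.
Qed.

Lemma nrm_coord (p : R3) :
  Rabs (c1 p) <= nrm p /\ Rabs (c2 p) <= nrm p /\ Rabs (c3 p) <= nrm p.
Proof. apply nrm_le. lra. Qed.

Lemma nrm_pos (p : R3) : 0 <= nrm p.
Proof. pose proof (nrm_coord p). pose proof (Rabs_pos (c1 p)). lra. Qed.

Lemma nrm_add (p q : R3) : nrm (vadd p q) <= nrm p + nrm q.
Proof.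
  destruct (nrm_coord p) as (A1 & A2 & A3), (nrm_coord q) as (B1 & B2 & B3).
  apply nrm_le. vec_unfold. repeat split; (eapply Rle_trans; [apply Rabs_triang|lra]).
Qed.

Lemma nrm_scale (r : R) (p : R3) : nrm (vscale r p) = Rabs r * nrm p.
Proof.
  unfold nrm. vec_unfold. rewrite !Rabs_mult, !RmaxRmult by apply Rabs_pos. reflexivity.
Qed.

Lemma nrm_sub_sym (p q : R3) : nrm (vsub p q) = nrm (vsub q p).
Proof.
  replace (vsub p q) with (vscale (-1) (vsub q p)) by vec.
  rewrite nrm_scale, Rabs_left by lra. lra.
Qed.

Lemma nrm_sub_triang (p q r : R3) : nrm (vsub p r) <= nrm (vsub p q) + nrm (vsub q r).
Proof.
  replace (vsub p r) with (vadd (vsub p q) (vsub q r)) by vec. apply nrm_add.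
Qed.

Lemma nrm_sub (p q : R3) : nrm (vsub p q) <= nrm p + nrm q.
Proof.
  replace (vsub p q) with (vadd p (vscale (-1) q)) by vec.
  eapply Rle_trans; [apply nrm_add|]. rewrite nrm_scale, Rabs_left; lra.
Qed.

Lemma nrm_eq0 (p : R3) : nrm p <= 0 -> p = (0, 0, 0).
Proof.
  intros H. apply nrm_le in H. vec_unfold. destruct H as (H1 & H2 & H3).
  repeat apply f_equal2; apply Rabs_eq_0; pose proof (Rabs_pos r1);
    pose proof (Rabs_pos r0); pose proof (Rabs_pos r); lra.
Qed.

Lemma nrm_gt0 (p : R3) : p <> (0, 0, 0) -> 0 < nrm p.
Proof. intros H. apply Rnot_le_lt. intros H'. apply H, nrm_eq0, H'. Qed.

Lemma nrm_0 : nrm (0, 0, 0) = 0.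
Proof. apply Rle_antisym; [|apply nrm_pos]. apply nrm_le. cbv [c1 c2 c3 fst snd]. rewrite Rabs_R0. lra. Qed.

Lemma vsub_diag (p : R3) : vsub p p = (0, 0, 0).
Proof. vec. Qed.

Lemma nrm_self (p : R3) : nrm (vsub p p) = 0.
Proof. rewrite vsub_diag. apply nrm_0. Qed.

Lemma vsub_eq0 (p q : R3) : vsub p q = (0, 0, 0) -> p = q.
Proof. intros H. vec_unfold. injection H; intros. repeat apply f_equal2; lra. Qed.

Lemma nrm_le_dist3 (p q : R3) : nrm (vsub p q) <= dist3 p q.
Proof.
  apply nrm_le. vec_unfold. unfold dist3. rewrite <- !sqrt_Rsqr_abs. unfold Rsqr.
  pose proof (pow2_ge_0 (r3 - r0)). pose proof (pow2_ge_0 (r4 - r1)).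
  pose proof (pow2_ge_0 (r2 - r)).
  repeat split; apply sqrt_le_1_alt; nra.
Qed.

Lemma dist3_le_nrm (p q : R3) : dist3 p q <= 2 * nrm (vsub p q).
Proof.
  pose proof (nrm_pos (vsub p q)) as HN.
  destruct (nrm_coord (vsub p q)) as (A1 & A2 & A3).
  set (N := nrm (vsub p q)) in *.
  rewrite <- (sqrt_Rsqr (2 * N)) by lra.
  vec_unfold. unfold dist3, Rsqr.
  apply sqrt_le_1_alt.
  assert (S : forall x, Rabs x <= N -> x ^ 2 <= N * N).
  { intros x Hx. rewrite <- (pow2_abs x). simpl. rewrite Rmult_1_r.
    apply Rmult_le_compat; auto using Rabs_pos. }
  apply S in A1. apply S in A2. apply S in A3.
  pose proof (Rmult_le_pos N N HN HN). lra.
Qed.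

Lemma interior3_nrm (T : R3 -> Prop) (x : R3) :
  interior3 T x <-> exists e, 0 < e /\ forall y, nrm (vsub x y) < e -> T y.
Proof.
  split; intros (e & He & H).
  - exists (e / 2). split; [lra|]. intros y Hy. apply H.
    pose proof (dist3_le_nrm x y). lra.
  - exists e. split; [lra|]. intros y Hy. apply H.
    pose proof (nrm_le_dist3 x y). lra.
Qed.

Lemma open3_nrm (U : R3 -> Prop) :
  (forall x, U x -> exists e, 0 < e /\ forall y, nrm (vsub x y) < e -> U y) -> open3 U.
Proof. intros H x Hx. apply interior3_nrm, H, Hx. Qed.

Lemma interior3_sub (T : R3 -> Prop) (x : R3) : interior3 T x -> T x.
Proof.
  intros H. apply interior3_nrm in H. destruct H as (e & He & H). apply H.
  rewrite nrm_self. exact He.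
Qed.

Lemma interior3_open (T : R3 -> Prop) (x : R3) : interior3 T x ->
  exists e, 0 < e /\ forall y, nrm (vsub x y) < e -> interior3 T y.
Proof.
  intros H. apply interior3_nrm in H. destruct H as (e & He & H).
  exists (e / 2). split; [lra|]. intros y Hy. apply interior3_nrm.
  exists (e / 2). split; [lra|]. intros w Hw. apply H.
  pose proof (nrm_sub_triang x y w). lra.
Qed.

(** Allows real and planar targets as well; for target metric [dist3] it is convertible with
    [cont_on], so results pass between the two freely. *)
Definition cts {X Y : Type} (dX : X -> X -> R) (dY : Y -> Y -> R) (A : X -> Prop)
  (f : X -> Y) : Prop :=
  forall x, A x -> forall eps, 0 < eps -> exists delta, 0 < delta /\
    forall y, A y -> dX x y < delta -> dY (f x) (f y) < eps.

Section Continuity.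
Context {X : Type} (d : X -> X -> R) (A : X -> Prop).

Lemma cts_comp {Y Z : Type} (dY : Y -> Y -> R) (dZ : Z -> Z -> R) (B : Y -> Prop) f g :
  cts d dY A f -> cts dY dZ B g -> (forall x, A x -> B (f x)) ->
  cts d dZ A (fun x => g (f x)).
Proof.
  intros Hf Hg HB x Hx e He.
  destruct (Hg (f x) (HB x Hx) e He) as (e1 & He1 & H1).
  destruct (Hf x Hx e1 He1) as (e2 & He2 & H2).
  exists e2. split; [exact He2|]. intros y Hy Hd. apply H1; auto.
Qed.

Lemma cts_sub {Y : Type} (dY : Y -> Y -> R) (B : X -> Prop) f :
  (forall x, B x -> A x) -> cts d dY A f -> cts d dY B f.
Proof.
  intros HBA Hf x Hx e He. destruct (Hf x (HBA x Hx) e He) as (e' & He' & H).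
  exists e'. split; auto.
Qed.

Lemma cts_ext {Y : Type} (dY : Y -> Y -> R) f g :
  (forall x, A x -> f x = g x) -> cts d dY A f -> cts d dY A g.
Proof.
  intros E Hf x Hx e He. destruct (Hf x Hx e He) as (e' & He' & H).
  exists e'. split; auto. intros y Hy Hd. rewrite <- !E; auto.
Qed.

Lemma cts_const (r : R) : cts d dist1 A (fun _ => r).
Proof.
  intros x Hx e He. exists 1. split; [lra|]. intros. unfold dist1.
  rewrite Rminus_diag, Rabs_R0. exact He.
Qed.

Lemma cts_plus f g : cts d dist1 A f -> cts d dist1 A g ->
  cts d dist1 A (fun x => f x + g x).
Proof.
  intros Hf Hg x Hx e He.
  destruct (Hf x Hx (e / 2)) as (e1 & He1 & H1); [lra|].
  destruct (Hg x Hx (e / 2)) as (e2 & He2 & H2); [lra|].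
  exists (Rmin e1 e2). split; [apply Rmin_pos; assumption|].
  intros y Hy Hd. unfold dist1 in *.
  specialize (H1 y Hy (Rlt_le_trans _ _ _ Hd (Rmin_l _ _))).
  specialize (H2 y Hy (Rlt_le_trans _ _ _ Hd (Rmin_r _ _))).
  replace (f x + g x - (f y + g y)) with ((f x - f y) + (g x - g y)) by ring.
  eapply Rle_lt_trans; [apply Rabs_triang|]. lra.
Qed.

Lemma cts_mult f g : cts d dist1 A f -> cts d dist1 A g ->
  cts d dist1 A (fun x => f x * g x).
Proof.
  intros Hf Hg x Hx e He.
  pose proof (Rabs_pos (f x)) as Pf. pose proof (Rabs_pos (g x)) as Pg.
  set (e' := Rmin 1 (e / (2 * (Rabs (f x) + Rabs (g x) + 1)))).
  assert (He' : 0 < e') by (apply Rmin_pos; [lra|apply Rdiv_lt_0_compat; lra]).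
  assert (L1 : e' <= 1) by apply Rmin_l.
  assert (L2 : e' * (2 * (Rabs (f x) + Rabs (g x) + 1)) <= e).
  { apply Rle_trans with (e / (2 * (Rabs (f x) + Rabs (g x) + 1)) *
      (2 * (Rabs (f x) + Rabs (g x) + 1))).
    - apply Rmult_le_compat_r; [lra|apply Rmin_r].
    - right. field. lra. }
  destruct (Hf x Hx e' He') as (e1 & He1 & H1).
  destruct (Hg x Hx e' He') as (e2 & He2 & H2).
  exists (Rmin e1 e2). split; [apply Rmin_pos; assumption|].
  intros y Hy Hd. unfold dist1 in *.
  specialize (H1 y Hy (Rlt_le_trans _ _ _ Hd (Rmin_l _ _))).
  specialize (H2 y Hy (Rlt_le_trans _ _ _ Hd (Rmin_r _ _))).
  replace (f x * g x - f y * g y) with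
    ((f x - f y) * g x + (f x * (g x - g y) + - ((f x - f y) * (g x - g y)))) by ring.
  pose proof (Rabs_pos (f x - f y)). pose proof (Rabs_pos (g x - g y)).
  eapply Rle_lt_trans; [apply Rabs_triang|].
  eapply Rle_lt_trans; [apply Rplus_le_compat_l,  Rabs_triang|].
  rewrite Rabs_Ropp, !Rabs_mult.
  assert (Rabs (f x - f y) * Rabs (g x) <= e' * Rabs (g x))
    by (apply Rmult_le_compat_r; lra).
  assert (Rabs (f x) * Rabs (g x - g y) <= Rabs (f x) * e')
    by (apply Rmult_le_compat_l; lra).
  assert (Rabs (f x - f y) * Rabs (g x - g y) <= e' * 1)
    by (apply Rmult_le_compat; lra).
  lra.
Qed.

Lemma cts_coord (f : X -> R3) : cts d dist3 A f <->
  cts d dist1 A (fun x => c1 (f x)) /\ cts d dist1 A (fun x => c2 (f x)) /\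
  cts d dist1 A (fun x => c3 (f x)).
Proof.
  split.
  - intros Hf. repeat split; intros x Hx e He;
      destruct (Hf x Hx e He) as (e1 & He1 & H1); exists e1; (split; [exact He1|]);
      intros y Hy Hd; specialize (H1 y Hy Hd);
      pose proof (nrm_le_dist3 (f x) (f y)) as L;
      pose proof (nrm_coord (vsub (f x) (f y))) as (C1 & C2 & C3);
      destruct (f x) as [[? ?] ?], (f y) as [[? ?] ?]; cbv [vsub c1 c2 c3 fst snd dist1] in *; lra.
  - intros (H1 & H2 & H3) x Hx e He.
    destruct (H1 x Hx (e / 2)) as (e1 & He1 & D1); [lra|].
    destruct (H2 x Hx (e / 2)) as (e2 & He2 & D2); [lra|].
    destruct (H3 x Hx (e / 2)) as (e3 & He3 & D3); [lra|].
    exists (Rmin e1 (Rmin e2 e3)). split; [repeat apply Rmin_pos; assumption|].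
    intros y Hy Hd.
    pose proof (Rmin_l e1 (Rmin e2 e3)). pose proof (Rmin_r e1 (Rmin e2 e3)).
    pose proof (Rmin_l e2 e3). pose proof (Rmin_r e2 e3).
    specialize (D1 y Hy). specialize (D2 y Hy). specialize (D3 y Hy).
    eapply Rle_lt_trans; [apply dist3_le_nrm|].
    enough (nrm (vsub (f x) (f y)) < e / 2) by lra.
    apply nrm_lt.
    destruct (f x) as [[? ?] ?], (f y) as [[? ?] ?]; cbv [vsub c1 c2 c3 fst snd dist1] in *.
    repeat split; [apply D1|apply D2|apply D3]; lra.
Qed.

Lemma cts_pt (p : R3) : cts d dist3 A (fun _ => p).
Proof. apply cts_coord. repeat split; apply cts_const. Qed.

Lemma cts_vscale (a : X -> R) (f : X -> R3) : cts d dist1 A a -> cts d dist3 A f ->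
  cts d dist3 A (fun x => vscale (a x) (f x)).
Proof.
  intros Ha Hf. apply cts_coord in Hf. destruct Hf as (H1 & H2 & H3).
  apply cts_coord. repeat split;
    [generalize (cts_mult _ _ Ha H1) | generalize (cts_mult _ _ Ha H2)
    | generalize (cts_mult _ _ Ha H3)]; apply cts_ext; intros x _;
    destruct (f x) as [[? ?] ?]; reflexivity.
Qed.

Lemma cts_vadd (f g : X -> R3) : cts d dist3 A f -> cts d dist3 A g ->
  cts d dist3 A (fun x => vadd (f x) (g x)).
Proof.
  intros Hf Hg. apply cts_coord in Hf. destruct Hf as (H1 & H2 & H3).
  apply cts_coord in Hg. destruct Hg as (K1 & K2 & K3).
  apply cts_coord. repeat split;
    [generalize (cts_plus _ _ H1 K1) | generalize (cts_plus _ _ H2 K2)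
    | generalize (cts_plus _ _ H3 K3)]; apply cts_ext; intros x _;
    destruct (f x) as [[? ?] ?], (g x) as [[? ?] ?]; reflexivity.
Qed.

Lemma cts_vsub (f g : X -> R3) : cts d dist3 A f -> cts d dist3 A g ->
  cts d dist3 A (fun x => vsub (f x) (g x)).
Proof.
  intros Hf Hg. eapply cts_ext; [|apply cts_vadd; [exact Hf|apply cts_vscale;
    [apply (cts_const (-1))|exact Hg]]].
  intros x _. simpl. destruct (f x) as [[? ?] ?], (g x) as [[? ?] ?]. vec.
Qed.

Lemma cts_affine (a b : R) f : cts d dist1 A f -> cts d dist1 A (fun x => a * f x + b).
Proof. intros H. apply cts_plus; [apply cts_mult; [apply cts_const|exact H]|apply cts_const]. Qed.

Lemma cts_glue {Y : Type} (dY : Y -> Y -> R) (phi : X -> R) (m : R) (f g : X -> Y) :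
  cts d dist1 A phi ->
  cts d dY (fun x => A x /\ phi x <= m) f ->
  cts d dY (fun x => A x /\ m <= phi x) g ->
  (forall x, A x -> phi x = m -> f x = g x) ->
  cts d dY A (fun x => if Rle_dec (phi x) m then f x else g x).
Proof.
  intros Hphi Hf Hg E x Hx e He.
  assert (F : phi x <= m -> exists e1, 0 < e1 /\ forall y, A y -> d x y < e1 ->
    phi y <= m -> dY (f x) (f y) < e).
  { intros L. destruct (Hf x (conj Hx L) e He) as (e1 & He1 & H1).
    exists e1. split; auto. }
  assert (G : m <= phi x -> exists e1, 0 < e1 /\ forall y, A y -> d x y < e1 ->
    m <= phi y -> dY (g x) (g y) < e).
  { intros L. destruct (Hg x (conj Hx L) e He) as (e1 & He1 & H1).
    exists e1. split; auto. }
  destruct (total_order_T (phi x) m) as [[L|L]|L].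
  - destruct (F (Rlt_le _ _ L)) as (e1 & He1 & H1).
    destruct (Hphi x Hx (m - phi x)) as (e2 & He2 & H2); [lra|].
    exists (Rmin e1 e2). split; [apply Rmin_pos; assumption|]. intros y Hy Hd.
    pose proof (Rmin_l e1 e2). pose proof (Rmin_r e1 e2).
    assert (Q : dist1 (phi x) (phi y) < m - phi x) by (apply H2; [exact Hy|lra]).
    apply Rabs_def2 in Q.
    destruct (Rle_dec (phi x) m); [|lra]. destruct (Rle_dec (phi y) m); [|lra].
    apply H1; auto; lra.
  - destruct (F (Req_le _ _ L)) as (e1 & He1 & H1).
    destruct (G (Req_le_sym _ _ L)) as (e2 & He2 & H2).
    exists (Rmin e1 e2). split; [apply Rmin_pos; assumption|]. intros y Hy Hd.
    pose proof (Rmin_l e1 e2). pose proof (Rmin_r e1 e2).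
    destruct (Rle_dec (phi x) m); [|lra]. destruct (Rle_dec (phi y) m).
    + apply H1; auto; lra.
    + rewrite (E x Hx L). apply H2; auto; lra.
  - destruct (G (Rlt_le _ _ L)) as (e1 & He1 & H1).
    destruct (Hphi x Hx (phi x - m)) as (e2 & He2 & H2); [lra|].
    exists (Rmin e1 e2). split; [apply Rmin_pos; assumption|]. intros y Hy Hd.
    pose proof (Rmin_l e1 e2). pose proof (Rmin_r e1 e2).
    assert (Q : dist1 (phi x) (phi y) < phi x - m) by (apply H2; [exact Hy|lra]).
    apply Rabs_def2 in Q.
    destruct (Rle_dec (phi x) m); [lra|]. destruct (Rle_dec (phi y) m); [lra|].
    apply H1; auto; lra.
Qed.

End Continuity.

Lemma cts_id {X : Type} (d : X -> X -> R) (A : X -> Prop) : cts d d A (fun x => x).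
Proof. intros x Hx e He. exists e. auto. Qed.

Lemma cts_c1 (A : R3 -> Prop) : cts dist3 dist1 A c1.
Proof. apply (proj1 (cts_coord dist3 A (fun x => x))), cts_id. Qed.
Lemma cts_c2 (A : R3 -> Prop) : cts dist3 dist1 A c2.
Proof. apply (proj1 (cts_coord dist3 A (fun x => x))), cts_id. Qed.
Lemma cts_c3 (A : R3 -> Prop) : cts dist3 dist1 A c3.
Proof. apply (proj1 (cts_coord dist3 A (fun x => x))), cts_id. Qed.

Lemma cts_pair {X : Type} (d : X -> X -> R) (A : X -> Prop) (f g : X -> R) :
  cts d dist1 A f -> cts d dist1 A g -> cts d dist2 A (fun x => (f x, g x)).
Proof.
  intros Hf Hg x Hx e He.
  destruct (Hf x Hx (e / 2)) as (e1 & He1 & H1); [lra|].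
  destruct (Hg x Hx (e / 2)) as (e2 & He2 & H2); [lra|].
  exists (Rmin e1 e2). split; [apply Rmin_pos; assumption|]. intros y Hy Hd.
  specialize (H1 y Hy (Rlt_le_trans _ _ _ Hd (Rmin_l _ _))).
  specialize (H2 y Hy (Rlt_le_trans _ _ _ Hd (Rmin_r _ _))).
  unfold dist2, dist1 in *. rewrite <- (sqrt_Rsqr e) by lra.
  apply sqrt_lt_1_alt. apply Rabs_def2 in H1. apply Rabs_def2 in H2.
  assert (S : forall u, u < e / 2 /\ - (e / 2) < u -> u ^ 2 < (e / 2) ^ 2).
  { intros u [U1 U2]. assert (0 < (e / 2 - u) * (e / 2 + u)) by (apply Rmult_lt_0_compat; lra).
    lra. }
  apply S in H1. apply S in H2. pose proof (pow2_gt_0 e ltac:(lra)).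
  pose proof (pow2_ge_0 (f x - f y)). pose proof (pow2_ge_0 (g x - g y)). unfold Rsqr. lra.
Qed.

Definition cube (p : R3) : Prop := I01 (c1 p) /\ I01 (c2 p) /\ I01 (c3 p).

(** Lebesgue number in gauge form: every point of the cube lies in the ball of some tag, and the
    radii of the tags used are bounded below by one [d]. All uniform estimates over the parameter
    cube come from it. *)
Lemma cube_lebesgue (G : R3 -> R -> Prop) :
  (forall t, cube t -> exists e, 0 < e /\ G t e) ->
  exists d, 0 < d /\ forall x, cube x ->
    exists t e, cube t /\ G t e /\ nrm (vsub x t) < e /\ d <= e.
Proof.
  intros H.
  set (pt := fun t : Compactness.Tn 3 R => let '(x, (y, (z, _))) := t in (x, y, z) : R3).
  assert (H' : forall t, exists e : posreal, cube (pt t) -> G (pt t) e).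
  { intros t. destruct (classic (cube (pt t))) as [C|C].
    - destruct (H _ C) as (e & He & HG). exists (mkposreal e He). auto.
    (* The gauge must be total; the value 1 off the cube is arbitrary, since the tags obtained below
       lie in the cube. *)
    - exists (mkposreal 1 Rlt_0_1). tauto. }
  set (delta := fun t => proj1_sig (constructive_indefinite_description _ (H' t))).
  destruct (compactness_value 3 (0, (0, (0, tt))) (1, (1, (1, tt))) delta) as (d & Hd).
  exists d. split; [apply cond_pos|]. intros [[x y] z] (Hx & Hy & Hz).
  specialize (Hd (x, (y, (z, tt)))).
  unfold cube, I01, c1, c2, c3 in Hx, Hy, Hz; simpl in Hx, Hy, Hz.
  destruct (NNPP _ (Hd ltac:(simpl; tauto))) as ([x' [y' [z' u]]] & B & C & D).
  exists (x', y', z'), (delta (x', (y', (z', u)))).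
  simpl in B, C.
  assert (Ct : cube (x', y', z')) by (unfold cube, I01, c1, c2, c3; simpl; tauto).
  split; [exact Ct|]. split; [|split; [|exact D]].
  - unfold delta. destruct constructive_indefinite_description as (e & He). simpl.
    apply He. exact Ct.
  - apply nrm_lt. unfold c1, c2, c3; simpl. tauto.
Qed.

(** * Odd maps of the sphere are essential *)

(** Ties go to the smaller index, so [v] and its opposite select the same coordinate. The zero
    vector falls into [N1], which is why oddness of the labelling asks for [v] nonzero. *)
Definition label (v : R3) : lab :=
  if Rle_dec (Rmax (Rabs (c2 v)) (Rabs (c3 v))) (Rabs (c1 v)) then
    if Rlt_dec 0 (c1 v) then P1 else N1
  else if Rle_dec (Rabs (c3 v)) (Rabs (c2 v)) then
    if Rlt_dec 0 (c2 v) then P2 else N2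
  else if Rlt_dec 0 (c3 v) then P3 else N3.

Lemma label_spec (v : R3) :
  match label v with
  | P1 => c1 v = nrm v | N1 => c1 v = - nrm v
  | P2 => c2 v = nrm v | N2 => c2 v = - nrm v
  | P3 => c3 v = nrm v | N3 => c3 v = - nrm v
  end.
Proof.
  unfold label, nrm.
  destruct (Rle_dec (Rmax (Rabs (c2 v)) (Rabs (c3 v))) (Rabs (c1 v))) as [H|H].
  - rewrite Rmax_left by exact H. destruct (Rlt_dec 0 (c1 v)).
    + rewrite Rabs_right; lra.
    + rewrite Rabs_left1; lra.
  - rewrite Rmax_right by lra. destruct (Rle_dec (Rabs (c3 v)) (Rabs (c2 v))).
    + rewrite Rmax_left by lra. destruct (Rlt_dec 0 (c2 v)).
      * rewrite Rabs_right; lra.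
      * rewrite Rabs_left1; lra.
    + rewrite Rmax_right by lra. destruct (Rlt_dec 0 (c3 v)).
      * rewrite Rabs_right; lra.
      * rewrite Rabs_left1; lra.
Qed.

Lemma label_opp (v : R3) : v <> (0, 0, 0) -> label (vscale (-1) v) = lneg (label v).
Proof.
  intros Hv. apply nrm_gt0 in Hv. revert Hv. unfold label, nrm.
  destruct v as [[x y] z]. cbv [vscale c1 c2 c3 fst snd].
  replace (-1 * x) with (- x) by ring. replace (-1 * y) with (- y) by ring.
  replace (-1 * z) with (- z) by ring. rewrite !Rabs_Ropp. intros Hv.
  destruct (Rle_dec (Rmax (Rabs y) (Rabs z)) (Rabs x)) as [H|H].
  - rewrite Rmax_left in Hv by exact H.
    destruct (Rlt_dec 0 x), (Rlt_dec 0 (- x)); try reflexivity; try lra.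
    replace x with 0 in Hv by lra. rewrite Rabs_R0 in Hv. lra.
  - rewrite Rmax_right in Hv by lra. destruct (Rle_dec (Rabs z) (Rabs y)).
    + rewrite Rmax_left in Hv by lra.
      destruct (Rlt_dec 0 y), (Rlt_dec 0 (- y)); try reflexivity; try lra.
      replace y with 0 in Hv by lra. rewrite Rabs_R0 in Hv. lra.
    + rewrite Rmax_right in Hv by lra.
      destruct (Rlt_dec 0 z), (Rlt_dec 0 (- z)); try reflexivity; try lra.
      replace z with 0 in Hv by lra. rewrite Rabs_R0 in Hv. lra.
Qed.

(** The common dominant coordinate is [nrm u] in one vector and [- nrm v] in the other, up to a
    global sign, so the difference is at least the sum there. *)
Lemma label_complementary (u v : R3) : label u = lneg (label v) ->
  nrm u + nrm v <= nrm (vsub u v).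
Proof.
  intros E. pose proof (label_spec u) as Hu. pose proof (label_spec v) as Hv.
  destruct (nrm_coord (vsub u v)) as (C1 & C2 & C3).
  rewrite E in Hu.
  assert (L : forall x, x <= Rabs x /\ - x <= Rabs x)
    by (intros x; split; [apply Rle_abs|rewrite <- Rabs_Ropp; apply Rle_abs]).
  destruct u as [[u1 u2] u3], v as [[v1 v2] v3].
  remember (nrm (u1, u2, u3)) as nu. remember (nrm (v1, v2, v3)) as nv.
  cbv [vsub c1 c2 c3 fst snd] in *.
  pose proof (L (u1 - v1)). pose proof (L (u2 - v2)). pose proof (L (u3 - v3)).
  destruct (label (v1, v2, v3)); simpl in Hu; lra.
Qed.

(* A map from the sphere is a pair [h true], [h false] of maps of the square, one for
   each closed hemisphere: the first coordinate runs from the equator to the pole and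
   the second is the longitude. *)
Definition spherical (h : bool -> R -> R -> R3) : Prop :=
  (forall b s, I01 s -> h b s 1 = h b s 0) /\
  (forall t, I01 t -> h true 0 t = h false 0 t) /\
  (forall b t, I01 t -> h b 1 t = h b 1 0).

(** The antipode swaps hemispheres and adds half a turn. Restricting [t] to the first half keeps
    [t + / 2] in range, and the two equations together cover the whole sphere. *)
Definition odd_map (h : bool -> R -> R -> R3) : Prop :=
  forall s t, I01 s -> 0 <= t <= / 2 ->
    h false s t = vscale (-1) (h true s (t + / 2)) /\
    h true s t = vscale (-1) (h false s (t + / 2)).

(** The third cube coordinate is idle here and is the time of a homotopy in [hom]; one domain then
    serves both. *)
Definition sphere_cts (h : bool -> R -> R -> R3) : Prop :=
  forall b, cts dist3 dist3 cube (fun p => h b (c1 p) (c2 p)).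

Definition hom (h0 h1 : bool -> R -> R -> R3) : Prop :=
  exists Phi : bool -> R -> R -> R -> R3,
    (forall b, cts dist3 dist3 cube (fun p => Phi b (c1 p) (c2 p) (c3 p))) /\
    (forall b s t r, I01 s -> I01 t -> I01 r -> Phi b s t r <> (0, 0, 0)) /\
    (forall r, I01 r -> spherical (fun b s t => Phi b s t r)) /\
    (forall b s t, I01 s -> I01 t -> Phi b s t 0 = h0 b s t) /\
    (forall b s t, I01 s -> I01 t -> Phi b s t 1 = h1 b s t).

Lemma I01_0 : I01 0. Proof. unfold I01; lra. Qed.

(** The bound is the negation of the conclusion of [label_complementary]: points closer than [d]
    never receive complementary labels. *)
Lemma small_osc (f : R3 -> R3) :
  cts dist3 dist3 cube f -> (forall p, cube p -> f p <> (0, 0, 0)) ->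
  exists d, 0 < d /\ forall x y, cube x -> cube y -> nrm (vsub x y) < d ->
    nrm (vsub (f x) (f y)) < nrm (f x) + nrm (f y).
Proof.
  intros Hf Hnz.
  (* The factor 2 lets one tag serve both points, [x] being within [e] of it and [y] within [d <= e]
     of [x]. With variation below a quarter of [nrm (f t)], the difference stays below half of it,
     and the two norms add up to more than three halves of it. *)
  set (G := fun t e => forall x, cube x -> nrm (vsub x t) < 2 * e ->
     nrm (vsub (f x) (f t)) < nrm (f t) / 4).
  destruct (cube_lebesgue G) as (d & Hd & H).
  - intros t Ht. pose proof (nrm_gt0 _ (Hnz t Ht)) as P.
    destruct (Hf t Ht (nrm (f t) / 4)) as (e & He & H); [lra|].
    exists (e / 4). split; [lra|]. intros x Hx Hxt.
    rewrite nrm_sub_sym. eapply Rle_lt_trans; [apply nrm_le_dist3|].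
    apply H; [exact Hx|]. eapply Rle_lt_trans; [apply dist3_le_nrm|].
    rewrite nrm_sub_sym. lra.
  - exists d. split; [exact Hd|]. intros x y Hx Hy Hxy.
    destruct (H x Hx) as (t & e & Ht & HG & Hxt & Hde).
    pose proof (nrm_gt0 _ (Hnz t Ht)) as P.
    assert (A : nrm (vsub (f x) (f t)) < nrm (f t) / 4).
    { apply HG; [exact Hx|]. pose proof (nrm_pos (vsub x t)). lra. }
    assert (B : nrm (vsub (f y) (f t)) < nrm (f t) / 4).
    { apply HG; [exact Hy|]. pose proof (nrm_sub_triang y x t).
      rewrite (nrm_sub_sym y x) in *. lra. }
    pose proof (nrm_sub_triang (f x) (f t) (f y)) as D. rewrite (nrm_sub_sym (f t)) in D.
    assert (E : forall u v, nrm v <= nrm u + nrm (vsub u v)).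
    { intros u v. rewrite nrm_sub_sym. replace v with (vadd u (vsub v u)) at 1 by vec.
      apply nrm_add. }
    pose proof (E (f x) (f t)). pose proof (E (f y) (f t)). lra.
Qed.

(** The homotopy is sampled as a cone with the odd map as base and the constant [q] at the far end.
    A mesh finer than the oscillation bound makes the labelling one that
    [no_antipodal_cone_labelling] excludes. *)
Theorem odd_not_null (h : bool -> R -> R -> R3) (q : R3) :
  odd_map h -> ~ hom h (fun _ _ _ => q).
Proof.
  intros Hodd (Phi & Hc & Hnz & Hs & H0 & H1).
  set (F := fun b p => Phi b (c1 p) (c2 p) (c3 p)).
  assert (Osc : forall b, exists d, 0 < d /\ forall x y, cube x -> cube y ->
    nrm (vsub x y) < d -> nrm (vsub (F b x) (F b y)) < nrm (F b x) + nrm (F b y)).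
  { intros b. apply small_osc; [apply Hc|]. intros p (P1 & P2 & P3). apply Hnz; assumption. }
  destruct (Osc true) as (d1 & Hd1 & O1). destruct (Osc false) as (d2 & Hd2 & O2).
  destruct (archimed_cor1 (Rmin d1 d2)) as (N & HN & HN0); [apply Rmin_pos; assumption|].
  (* An even number of steps makes half a turn of longitude exactly [N] grid steps. *)
  set (n := (N + N)%nat).
  assert (Hn : 0 < INR n) by (apply lt_0_INR; unfold n; lia).
  assert (Hnd : / INR n < Rmin d1 d2).
  { apply Rle_lt_trans with (/ INR N); [|exact HN]. apply Rinv_le_contravar.
    - apply lt_0_INR. lia.
    - apply le_INR. unfold n. lia. }
  set (g := fun i : nat => INR i / INR n).
  assert (g0 : g O = 0) by (unfold g; simpl; field; lra).
  assert (gn : g n = 1) by (unfold g; field; lra).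
  assert (gI : forall i, (i <= n)%nat -> I01 (g i)).
  { intros i Hi. unfold g. apply le_INR in Hi. pose proof (pos_INR i). split.
    - apply Rcomplements.Rdiv_le_0_compat; lra.
    - apply Rcomplements.Rle_div_l; lra. }
  assert (gN : forall j, (j <= N)%nat -> g (N + j)%nat = g j + / 2 /\ 0 <= g j <= / 2).
  { intros j Hj. pose proof (gI j ltac:(unfold n; lia)) as [G1 G2].
    assert (EN : INR n = 2 * INR N) by (unfold n; rewrite plus_INR; ring).
    assert (0 < INR N) by lra.
    assert (E : g (N + j)%nat = g j + / 2)
      by (unfold g; rewrite plus_INR, EN; field; lra).
    split; [exact E|]. split; [exact G1|].
    pose proof (gI (N + j)%nat ltac:(unfold n; lia)) as [G3 G4]. lra. }
  assert (ga : forall i i', adj i i' -> Rabs (g i - g i') <= / INR n).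
  { intros i i' [A1 A2]. unfold g.
    replace (INR i / INR n - INR i' / INR n) with ((INR i - INR i') * / INR n) by (field; lra).
    rewrite Rabs_mult, (Rabs_right (/ INR n)).
    2: apply Rle_ge, Rlt_le, Rinv_0_lt_compat, Hn.
    rewrite <- (Rmult_1_l (/ INR n)) at 2. apply Rmult_le_compat_r.
    - apply Rlt_le, Rinv_0_lt_compat, Hn.
    - apply le_INR in A1, A2. rewrite S_INR in A1, A2. apply Rabs_le. lra. }
  apply (no_antipodal_cone_labelling N n (fun b i j k => label (Phi b (g i) (g j) (g k))) eq_refl).
  - intros b i j k i' j' k' Hi Hj Hk Hi' Hj' Hk' Ai Aj Ak E.
    apply label_complementary in E.
    set (x := (g i, g j, g k) : R3). set (y := (g i', g j', g k') : R3).
    assert (Cx : cube x) by (repeat split; apply gI; assumption).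
    assert (Cy : cube y) by (repeat split; apply gI; assumption).
    assert (Hxy : nrm (vsub x y) < Rmin d1 d2).
    { apply Rle_lt_trans with (/ INR n); [|exact Hnd]. apply nrm_le.
      unfold x, y. cbv [vsub c1 c2 c3 fst snd]. auto. }
    pose proof (Rmin_l d1 d2). pose proof (Rmin_r d1 d2).
    assert (L : nrm (vsub (F b x) (F b y)) < nrm (F b x) + nrm (F b y)).
    { destruct b; [apply O1|apply O2]; auto; lra. }
    change (F b x) with (Phi b (g i) (g j) (g k)) in L.
    change (F b y) with (Phi b (g i') (g j') (g k')) in L. lra.
  - intros b i k Hi Hk. rewrite gn, g0. f_equal. apply (Hs (g k)); auto.
  - intros j k Hj Hk. rewrite g0. f_equal. apply (Hs (g k)); auto.
  - intros b j k Hj Hk. rewrite gn, g0. f_equal. apply (Hs (g k)); auto.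
  - intros i j Hi Hj. destruct (gN j Hj) as [E1 E2]. rewrite E1, g0.
    assert (I01 (g j + / 2)) by (rewrite <- E1; apply gI; unfold n; lia).
    assert (I01 (g j)) by (apply gI; unfold n; lia).
    rewrite <- label_opp by (apply Hnz; auto using I01_0). f_equal.
    rewrite !H0 by auto. apply Hodd; auto.
  - intros i j Hi Hj. destruct (gN j Hj) as [E1 E2]. rewrite E1, g0.
    assert (I01 (g j + / 2)) by (rewrite <- E1; apply gI; unfold n; lia).
    assert (I01 (g j)) by (apply gI; unfold n; lia).
    rewrite <- (lneg_invol (label (Phi false _ _ _))).
    rewrite <- label_opp by (apply Hnz; auto using I01_0). do 2 f_equal.
    rewrite !H0 by auto. symmetry. apply Hodd; auto.
  - intros b i j Hi Hj. rewrite gn, g0. f_equal. rewrite !H1; auto using I01_0.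
Qed.

Lemma hom_trans (h0 h1 h2 : bool -> R -> R -> R3) : hom h0 h1 -> hom h1 h2 -> hom h0 h2.
Proof.
  intros (P & Pc & Pn & Ps & P0 & P1) (Q & Qc & Qn & Qs & Q0 & Q1).
  (* The redundant [+ 0] keeps both halves in the shape required by [cts_affine]. *)
  exists (fun b s t r => if Rle_dec r (/ 2) then P b s t (2 * r + 0) else Q b s t (2 * r + -1)).
  assert (I1 : forall r, I01 r -> r <= / 2 -> I01 (2 * r + 0)) by (unfold I01; intros; lra).
  assert (I2 : forall r, I01 r -> / 2 <= r -> I01 (2 * r + -1)) by (unfold I01; intros; lra).
  repeat split.
  - intros b.
    apply (cts_glue dist3 cube dist3 c3 (/ 2)
      (fun p => P b (c1 p) (c2 p) (2 * c3 p + 0)) (fun p => Q b (c1 p) (c2 p) (2 * c3 p + -1))).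
    + apply cts_c3.
    + apply (cts_comp dist3 _ dist3 dist3 cube (fun p => (c1 p, c2 p, 2 * c3 p + 0))
        (fun p => P b (c1 p) (c2 p) (c3 p))).
      * apply cts_coord. split; [apply cts_c1|split; [apply cts_c2|]].
        apply cts_affine, cts_c3.
      * apply Pc.
      * intros x ((X1 & X2 & X3) & X4). repeat split; try apply X1; try apply X2;
          apply I1; assumption.
    + apply (cts_comp dist3 _ dist3 dist3 cube (fun p => (c1 p, c2 p, 2 * c3 p + -1))
        (fun p => Q b (c1 p) (c2 p) (c3 p))).
      * apply cts_coord. split; [apply cts_c1|split; [apply cts_c2|]].
        apply cts_affine, cts_c3.
      * apply Qc.
      * intros x ((X1 & X2 & X3) & X4). repeat split; try apply X1; try apply X2;
          apply I2; assumption.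
    + intros x (X1 & X2 & X3) E. rewrite E.
      replace (2 * / 2 + 0) with 1 by field. replace (2 * / 2 + -1) with 0 by field.
      rewrite P1, Q0; auto.
  - intros b s t r Is It Ir. destruct (Rle_dec r (/ 2)); [apply Pn|apply Qn]; auto;
      apply I2; auto; lra.
  - intros b s Is. destruct (Rle_dec r (/ 2)); [apply (Ps (2 * r + 0))|apply (Qs (2 * r + -1))];
      auto; apply I2; auto; lra.
  - intros t It. destruct (Rle_dec r (/ 2)); [apply (Ps (2 * r + 0))|apply (Qs (2 * r + -1))];
      auto; apply I2; auto; lra.
  - intros b t It. destruct (Rle_dec r (/ 2)); [apply (Ps (2 * r + 0))|apply (Qs (2 * r + -1))];
      auto; apply I2; auto; lra.
  - intros b s t Is It. destruct (Rle_dec 0 (/ 2)); [|lra].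
    replace (2 * 0 + 0) with 0 by ring. auto.
  - intros b s t Is It. destruct (Rle_dec 1 (/ 2)); [lra|].
    replace (2 * 1 + -1) with 1 by ring. auto.
Qed.

Lemma hom_straight (h0 h1 : bool -> R -> R -> R3) :
  sphere_cts h0 -> sphere_cts h1 -> spherical h0 -> spherical h1 ->
  (forall b s t r, I01 s -> I01 t -> I01 r ->
     vadd (vscale (1 - r) (h0 b s t)) (vscale r (h1 b s t)) <> (0, 0, 0)) ->
  hom h0 h1.
Proof.
  intros C0 C1 (S1 & S2 & S3) (R1 & R2 & R3') Hnz.
  exists (fun b s t r => vadd (vscale (1 - r) (h0 b s t)) (vscale r (h1 b s t))).
  repeat split.
  - intros b. apply cts_vadd; apply cts_vscale; auto using cts_c3.
    eapply cts_ext; [|apply (cts_affine dist3 cube (-1) 1), cts_c3]. intros; simpl; ring.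
  - exact Hnz.
  - intros. rewrite S1, R1; auto.
  - intros. rewrite S2, R2; auto.
  - intros. rewrite S3, R3'; auto.
  - intros. vec_unfold. destruct (h0 b s t) as [[? ?] ?], (h1 b s t) as [[? ?] ?]. vec.
  - intros. vec_unfold. destruct (h0 b s t) as [[? ?] ?], (h1 b s t) as [[? ?] ?]. vec.
Qed.

(** * Separation by odd spheres *)

Definition hstep (eps : R) (Q : R3 -> Prop) (u v : R3) : Prop :=
  Q u /\ Q v /\ nrm (vsub u v) < eps.

(** The closure appends steps at the far end, so an induction moves the end point while the start
    stays fixed. *)
Definition chain (eps : R) (Q : R3 -> Prop) : R3 -> R3 -> Prop :=
  clos_refl_trans_n1 R3 (hstep eps Q).

Definition hsub (h : bool -> R -> R -> R3) (p : R3) (b : bool) (s t : R) : R3 :=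
  vsub (h b s t) p.

Lemma spherical_hsub h p : spherical h -> spherical (hsub h p).
Proof.
  intros (S1 & S2 & S3). unfold hsub. repeat split; intros.
  - rewrite S1; auto.
  - rewrite S2; auto.
  - rewrite S3; auto.
Qed.

Lemma sphere_cts_hsub h p : sphere_cts h -> sphere_cts (hsub h p).
Proof. intros H b. apply cts_vsub; [apply H|apply cts_pt]. Qed.

Lemma spherical_const p : spherical (fun _ _ _ => p).
Proof. repeat split. Qed.

Lemma sphere_cts_const p : sphere_cts (fun _ _ _ => p).
Proof. intros b. apply cts_pt. Qed.

(** Along a chain the maps [h - u] and [h - v] at the two ends of a step are joined by a straight
    homotopy: a zero would put a point of the sphere on the segment from [u] to [v], too close to
    [Q]. At the far end [q] has larger norm than the sphere, so [h - q] shrinks to the constant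
    [- q]. The odd map [h - c] would be null-homotopic. *)
Theorem odd_sphere_separates (h : bool -> R -> R -> R3) (c : R3) (K : R) (Q : R3 -> Prop) :
  sphere_cts h -> spherical h -> odd_map (hsub h c) ->
  (forall b s t, I01 s -> I01 t -> nrm (h b s t) <= K) ->
  (forall b s t, I01 s -> I01 t ->
     exists e, 0 < e /\ forall y, nrm (vsub (h b s t) y) < e -> ~ Q y) ->
  Q c ->
  (forall e, 0 < e -> exists q, K < nrm q /\ chain e Q c q) -> False.
Proof.
  intros Hc Hs Hodd HK Hav Qc Hch.
  (* The pointwise distance from the sphere to [Q] is made uniform before the mesh of the chain is
     chosen. *)
  assert (Sep : forall b, exists e, 0 < e /\ forall s t, I01 s -> I01 t ->
    forall y, nrm (vsub (h b s t) y) < e -> ~ Q y).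
  { intros b.
    destruct (cube_lebesgue (fun t e => forall x, cube x -> nrm (vsub x t) < e ->
      forall y, nrm (vsub (h b (c1 x) (c2 x)) y) < e -> ~ Q y)) as (d & Hd & H).
    - intros t (T1 & T2 & T3). destruct (Hav b (c1 t) (c2 t) T1 T2) as (e & He & H).
      destruct (Hc b t (conj T1 (conj T2 T3)) (e / 2)) as (e' & He' & H'); [lra|].
      exists (Rmin (e / 2) (e' / 2)). split; [apply Rmin_pos; lra|].
      pose proof (Rmin_l (e / 2) (e' / 2)). pose proof (Rmin_r (e / 2) (e' / 2)).
      intros x Hx Hxt y Hy. apply H.
      pose proof (nrm_sub_triang (h b (c1 t) (c2 t)) (h b (c1 x) (c2 x)) y).
      assert (dist3 (h b (c1 t) (c2 t)) (h b (c1 x) (c2 x)) < e / 2).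
      { apply H'; [exact Hx|]. eapply Rle_lt_trans; [apply dist3_le_nrm|].
        rewrite nrm_sub_sym. lra. }
      pose proof (nrm_le_dist3 (h b (c1 t) (c2 t)) (h b (c1 x) (c2 x))). lra.
    - exists d. split; [exact Hd|]. intros s t Is It y Hy.
      destruct (H (s, t, 0)) as (t' & e & _ & G & Hn & Hde);
        [repeat split; apply Is || apply It || (simpl; lra)|].
      apply (G (s, t, 0)); [repeat split; apply Is || apply It || (simpl; lra)|exact Hn|].
      unfold c1, c2; simpl. lra. }
  destruct (Sep true) as (e1 & He1 & S1). destruct (Sep false) as (e2 & He2 & S2).
  destruct (Hch (Rmin e1 e2)) as (q & Hq & Hcq); [apply Rmin_pos; assumption|].
  assert (S : forall b s t, I01 s -> I01 t ->
    forall y, nrm (vsub (h b s t) y) < Rmin e1 e2 -> ~ Q y).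
  { pose proof (Rmin_l e1 e2). pose proof (Rmin_r e1 e2).
    intros [|] s t Is It y Hy; [apply (S1 s t Is It)|apply (S2 s t Is It)]; lra. }
  assert (M : hom (hsub h c) (hsub h q)).
  { assert (P : forall u v, Q u -> nrm (vsub u v) < Rmin e1 e2 -> hom (hsub h u) (hsub h v)).
    { intros u v Qu Huv. apply hom_straight; auto using spherical_hsub, sphere_cts_hsub.
      intros b s t r Is It Ir E. apply (S b s t Is It u); [|exact Qu].
      unfold hsub in E.
      replace (vsub (h b s t) u) with (vscale (- r) (vsub u v)).
      - rewrite nrm_scale, Rabs_Ropp, Rabs_right by (unfold I01 in Ir; lra).
        pose proof (nrm_pos (vsub u v)). unfold I01 in Ir. nra.
      - revert E. generalize (h b s t). intros w E. clear - E. vec_unfold.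
        injection E; intros. repeat apply f_equal2; lra. }
    clear Hq.
    induction Hcq as [|y z Hyz Hcy IH].
    - apply P; [exact Qc|]. rewrite nrm_self. apply Rmin_pos; assumption.
    - apply hom_trans with (hsub h y); [exact IH|apply P; apply Hyz]. }
  apply (odd_not_null (hsub h c) (vscale (-1) q) Hodd).
  apply hom_trans with (hsub h q); [exact M|].
  apply hom_straight; auto using spherical_hsub, sphere_cts_hsub, spherical_const, sphere_cts_const.
  intros b s t r Is It Ir E. unfold hsub in E.
  assert (E' : q = vscale (1 - r) (h b s t)).
  { revert E. generalize (h b s t). intros w E. vec_unfold. injection E; intros.
    repeat apply f_equal2; lra. }
  rewrite E', nrm_scale, Rabs_right in Hq by (unfold I01 in Ir; lra).
  pose proof (HK b s t Is It). pose proof (nrm_pos (h b s t)). unfold I01 in Ir. nra.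
Qed.

(** * Discs bounded by antipodal loops *)

Definition refl (c x : R3) : R3 := vsub (vscale 2 c) x.

Lemma refl_refl (c x : R3) : refl c (refl c x) = x.
Proof. unfold refl. vec. Qed.

Lemma refl_sub (c w : R3) : vsub (refl c w) c = vscale (-1) (vsub w c).
Proof. unfold refl. vec. Qed.

Lemma sub_refl (c w : R3) : vsub w c = vscale (-1) (vsub (refl c w) c).
Proof. unfold refl. vec. Qed.

Lemma cts_refl {X : Type} (d : X -> X -> R) (A : X -> Prop) (c : R3) (f : X -> R3) :
  cts d dist3 A f -> cts d dist3 A (fun x => refl c (f x)).
Proof. intros H. apply cts_vsub; [apply cts_pt|exact H]. Qed.

(** Every mesh [e] is required, because the mesh needed depends on the sphere that is to be
    crossed. *)
Definition far_chain (O : R3 -> Prop) (c : R3) (K : R) : Prop :=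
  forall e, 0 < e -> exists q, K < nrm q /\ chain e (fun y => ~ O y) c q.

Section AntipodalDisc.
Variables (O : R3 -> Prop) (c : R3) (K : R).
Hypothesis O_open : forall x, O x -> exists e, 0 < e /\ forall y, nrm (vsub x y) < e -> O y.
Hypothesis O_refl : forall x, O x -> O (refl c x).
Hypothesis O_bound : forall x, O x -> nrm x <= K.
Hypothesis O_c : ~ O c.
Hypothesis O_chain : far_chain O c K.

(** The contraction [H] of an antipodal loop is read as a hemisphere with equator [s = 0] and pole
    [s = 1]. Its reflection, turned by half a revolution, is the other hemisphere; the loop
    condition makes them agree on the equator. *)
Lemma no_antipodal_disc (H : R2 -> R3) :
  cont_on dist2 square01 H ->
  (forall p, square01 p -> O (H p)) ->
  (forall t, 0 <= t <= / 2 -> H (0, t + / 2) = refl c (H (0, t))) ->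
  (forall t, I01 t -> H (1, t) = H (1, 0)) ->
  (forall s, I01 s -> H (s, 0) = H (s, 1)) -> False.
Proof.
  intros Hc HO Ha H1 Hp.
  (* The two branches are [t + 1/2] modulo 1; they fit at [t = 1/2] because [H] has period 1 in its
     second argument. *)
  set (h := fun (b : bool) s t => if b then H (s, t) else
    if Rle_dec t (/ 2) then refl c (H (s, 1 * t + / 2)) else refl c (H (s, 1 * t + - / 2))).
  assert (hO : forall b s t, I01 s -> I01 t -> O (h b s t)).
  { intros [|] s t Is It; simpl.
    - apply HO. split; assumption.
    - destruct (Rle_dec t (/ 2)); apply O_refl, HO; split; simpl; unfold I01 in *; lra. }
  assert (Hcube : forall a, cts dist3 dist3
    (fun p => I01 (c1 p) /\ I01 (1 * c2 p + a)) (fun p => H (c1 p, 1 * c2 p + a))).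
  { intros a. apply (cts_comp dist3 _ dist2 dist3 square01 (fun p => (c1 p, 1 * c2 p + a)) H).
    - apply cts_pair; [apply cts_c1|apply cts_affine, cts_c2].
    - exact Hc.
    - intros x Hx. exact Hx. }
  apply (odd_sphere_separates h c K (fun y => ~ O y)).
  - intros [|]; unfold h.
    + eapply cts_ext; [|eapply cts_sub; [|apply (Hcube 0)]].
      * intros p _. simpl. replace (1 * c2 p + 0) with (c2 p) by ring. reflexivity.
      * intros p (P1 & P2 & P3). split; [exact P1|]. unfold I01 in *. lra.
    + apply (cts_glue dist3 cube dist3 c2 (/ 2) (fun p => refl c (H (c1 p, 1 * c2 p + / 2)))
        (fun p => refl c (H (c1 p, 1 * c2 p + - / 2)))).
      * apply cts_c2.
      * apply cts_refl. eapply cts_sub; [|apply (Hcube (/ 2))].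
        intros p ((P1 & P2 & P3) & P4). split; [exact P1|]. unfold I01 in *. lra.
      * apply cts_refl. eapply cts_sub; [|apply (Hcube (- / 2))].
        intros p ((P1 & P2 & P3) & P4). split; [exact P1|]. unfold I01 in *. lra.
      * intros p (P1 & P2 & P3) E. rewrite E.
        replace (1 * / 2 + / 2) with 1 by field. replace (1 * / 2 + - / 2) with 0 by field.
        rewrite Hp by exact P1. reflexivity.
  - unfold h. repeat split.
    + intros [|] s Is; [symmetry; apply Hp, Is|].
      destruct (Rle_dec 1 (/ 2)); [lra|]. destruct (Rle_dec 0 (/ 2)); [|lra].
      do 3 f_equal. lra.
    + intros t It. unfold I01 in It. destruct (Rle_dec t (/ 2)).
      * rewrite Rmult_1_l, Ha by lra. symmetry. apply refl_refl.
      * rewrite <- Ha by lra. do 2 f_equal. lra.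
    + intros [|] t It; [apply H1, It|]. unfold I01 in It.
      destruct (Rle_dec 0 (/ 2)); [|lra].
      destruct (Rle_dec t (/ 2)); rewrite H1, (H1 (1 * 0 + / 2)) by (unfold I01; lra);
        reflexivity.
  - intros s t Is It. unfold hsub, h. split.
    + destruct (Rle_dec t (/ 2)); [|lra]. rewrite Rmult_1_l.
      apply refl_sub.
    + assert (E : (if Rle_dec (t + / 2) (/ 2) then refl c (H (s, 1 * (t + / 2) + / 2))
        else refl c (H (s, 1 * (t + / 2) + - / 2))) = refl c (H (s, t))).
      { destruct (Rle_dec (t + / 2) (/ 2)).
        - replace t with 0 by lra. rewrite Hp by exact Is. do 3 f_equal. lra.
        - do 3 f_equal. lra. }
      rewrite E. apply sub_refl.
  - intros b s t Is It. apply O_bound, hO; assumption.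
  - intros b s t Is It. destruct (O_open _ (hO b s t Is It)) as (e & He & He').
    exists e. split; [exact He|]. intros y Hy N. apply N, He', Hy.
  - exact O_c.
  - exact O_chain.
Qed.

Definition double_path (g : R -> R3) (t : R) : R3 :=
  if Rle_dec t (/ 2) then g (2 * t + 0) else refl c (g (2 * t + -1)).

Lemma double_path_cts (g : R -> R3) :
  cts dist1 dist3 I01 g -> g 1 = refl c (g 0) -> cts dist1 dist3 I01 (double_path g).
Proof.
  intros Hg E.
  apply (cts_glue dist1 I01 dist3 (fun t => t) (/ 2) (fun t => g (2 * t + 0))
    (fun t => refl c (g (2 * t + -1)))).
  - apply cts_id.
  - apply (cts_comp dist1 _ dist1 dist3 I01 (fun t => 2 * t + 0) g).
    + apply cts_affine, cts_id.
    + exact Hg.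
    + unfold I01. intros x [X1 X2]. lra.
  - apply cts_refl. apply (cts_comp dist1 _ dist1 dist3 I01 (fun t => 2 * t + -1) g).
    + apply cts_affine, cts_id.
    + exact Hg.
    + unfold I01. intros x [X1 X2]. lra.
  - intros t _ Et. rewrite Et. replace (2 * / 2 + 0) with 1 by field.
    replace (2 * / 2 + -1) with 0 by field. exact E.
Qed.

Lemma double_path_antipodal (g : R -> R3) (t : R) :
  g 1 = refl c (g 0) -> 0 <= t <= / 2 ->
  double_path g (t + / 2) = refl c (double_path g t).
Proof.
  intros E Ht. unfold double_path. destruct (Rle_dec t (/ 2)); [|lra].
  (* Only [t = 0] lands in the first branch; there the end point condition on [g] closes the gap. *)
  destruct (Rle_dec (t + / 2) (/ 2)).
  - replace t with 0 by lra. replace (2 * (0 + / 2) + 0) with 1 by field.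
    rewrite E. do 3 f_equal. lra.
  - do 2 f_equal. lra.
Qed.

Lemma double_path_closed (g : R -> R3) :
  g 1 = refl c (g 0) -> double_path g 0 = double_path g 1.
Proof.
  intros E.
  assert (A : double_path g 1 = refl c (double_path g (/ 2)))
    by (rewrite <- double_path_antipodal; [f_equal; lra|exact E|lra]).
  assert (B : double_path g (/ 2) = refl c (double_path g 0))
    by (rewrite <- double_path_antipodal; [f_equal; lra|exact E|lra]).
  rewrite A, B, refl_refl. reflexivity.
Qed.

Lemma double_path_in (g : R -> R3) (P : R3 -> Prop) (t : R) :
  (forall u, I01 u -> P (g u)) -> (forall x, P x -> P (refl c x)) -> I01 t ->
  P (double_path g t).
Proof.
  intros Hg HP It. unfold double_path, I01 in *. destruct (Rle_dec t (/ 2)).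
  - apply Hg. lra.
  - apply HP, Hg. lra.
Qed.

Theorem not_simply_connected : ~ simply_connected O.
Proof.
  intros ((x & Hx) & Hpc & Hsc).
  destruct (Hpc x (refl c x) Hx (O_refl x Hx)) as (g & (gc & gO) & g0 & g1).
  assert (E : g 1 = refl c (g 0)) by (rewrite g0, g1; reflexivity).
  destruct (Hsc (double_path g)) as (H & Hc & HO & H0 & H1 & Hp).
  - split; [apply double_path_cts; assumption|].
    intros t It. apply double_path_in; assumption.
  - apply double_path_closed, E.
  - apply (no_antipodal_disc H Hc HO); auto.
    intros t It. rewrite !H0 by (unfold I01; lra). apply double_path_antipodal; assumption.
Qed.

End AntipodalDisc.

(** * Invariance of domain *)

Lemma cts_lower_bound (f : R3 -> R3) :
  cts dist3 dist3 cube f -> (forall p, cube p -> f p <> (0, 0, 0)) ->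
  exists m, 0 < m /\ forall p, cube p -> m <= nrm (f p).
Proof.
  intros Hf Hnz.
  destruct (cube_lebesgue (fun t e => forall x, cube x -> nrm (vsub x t) < e -> e <= nrm (f x)))
    as (d & Hd & H).
  - intros t Ht. pose proof (nrm_gt0 _ (Hnz t Ht)) as P.
    destruct (Hf t Ht (nrm (f t) / 2)) as (e & He & H); [lra|].
    exists (Rmin (e / 2) (nrm (f t) / 2)). split; [apply Rmin_pos; lra|].
    pose proof (Rmin_l (e / 2) (nrm (f t) / 2)). pose proof (Rmin_r (e / 2) (nrm (f t) / 2)).
    intros x Hx Hxt.
    assert (D : dist3 (f t) (f x) < nrm (f t) / 2).
    { apply H; [exact Hx|]. eapply Rle_lt_trans; [apply dist3_le_nrm|].
      rewrite nrm_sub_sym. lra. }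
    pose proof (nrm_le_dist3 (f t) (f x)).
    assert (nrm (f t) <= nrm (f x) + nrm (vsub (f t) (f x))).
    { replace (f t) with (vadd (f x) (vsub (f t) (f x))) at 1
        by (generalize (f t) (f x); intros; vec). apply nrm_add. }
    lra.
  - exists d. split; [exact Hd|]. intros p Hp.
    destruct (H p Hp) as (t & e & _ & G & L & De). specialize (G p Hp L). lra.
Qed.

Lemma cts_continuous (A : R -> Prop) (f : R -> R) : continuity f -> cts dist1 dist1 A f.
Proof.
  intros Hf x _ e He. pose proof (Hf x) as Hx. apply continuity_pt_locally with (eps := mkposreal e He) in Hx.
  destruct Hx as (d & Hd). exists d. split; [apply cond_pos|]. intros y _ Hxy.
  unfold dist1 in *. rewrite Rabs_minus_sym. apply Hd.
  unfold ball; simpl; unfold AbsRing_ball, abs, minus, plus, opp; simpl.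
  rewrite Rabs_minus_sym in Hxy. exact Hxy.
Qed.

(* A suspension of the unit circle, used as model of the unit sphere. *)
Definition sph (b : bool) (s t : R) : R3 :=
  ((1 - s) * cos (2 * PI * t), (1 - s) * sin (2 * PI * t), if b then s else - s).

Lemma sph_spherical : spherical sph.
Proof.
  unfold sph. repeat split.
  - intros b s _. rewrite Rmult_1_r, Rmult_0_r, cos_2PI, sin_2PI, cos_0, sin_0. reflexivity.
  - intros t _. rewrite Ropp_0. reflexivity.
  - intros b t _. replace (1 - 1) with 0 by ring. rewrite !Rmult_0_l. reflexivity.
Qed.

Lemma sph_half (s t : R) :
  sph false s t = vscale (-1) (sph true s (t + / 2)) /\
  sph true s t = vscale (-1) (sph false s (t + / 2)).
Proof.
  unfold sph. replace (2 * PI * (t + / 2)) with (2 * PI * t + PI) by field.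
  rewrite neg_cos, neg_sin. split; vec.
Qed.

Lemma sph_nrm (b : bool) (s t : R) : I01 s -> nrm (sph b s t) <= 1.
Proof.
  intros [S1 S2]. apply nrm_le. unfold sph. cbv [c1 c2 c3 fst snd].
  rewrite !Rabs_mult, (Rabs_right (1 - s)) by lra.
  assert (C : Rabs (cos (2 * PI * t)) <= 1) by (apply Rabs_le, COS_bound).
  assert (S : Rabs (sin (2 * PI * t)) <= 1) by (apply Rabs_le, SIN_bound).
  pose proof (Rabs_pos (cos (2 * PI * t))). pose proof (Rabs_pos (sin (2 * PI * t))).
  split; [nra|split; [nra|]]. apply Rabs_le. destruct b; lra.
Qed.

Lemma sph_nz (b : bool) (s t : R) : sph b s t <> (0, 0, 0).
Proof.
  unfold sph. intros E. injection E; intros E3 E2 E1.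
  assert (s = 0) by (destruct b; lra). subst s.
  pose proof (sin2_cos2 (2 * PI * t)) as Q. unfold Rsqr in Q.
  replace (sin (2 * PI * t)) with 0 in Q by lra.
  replace (cos (2 * PI * t)) with 0 in Q by lra. lra.
Qed.

Lemma sph_cts : sphere_cts sph.
Proof.
  assert (A : cts dist3 dist1 cube (fun p => 1 - c1 p)).
  { eapply cts_ext; [|apply (cts_affine dist3 cube (-1) 1), cts_c1]. intros; simpl; ring. }
  assert (B : cts dist3 dist1 cube (fun p => 2 * PI * c2 p)).
  { eapply cts_ext; [|apply (cts_affine dist3 cube (2 * PI) 0), cts_c2]. intros; simpl; ring. }
  intros b. apply cts_coord. split; [|split].
  - apply cts_mult; [exact A|].
    apply (cts_comp dist3 cube dist1 dist1 (fun _ => True) _ cos); [exact B| |trivial].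
    apply cts_continuous, continuity_cos.
  - apply cts_mult; [exact A|].
    apply (cts_comp dist3 cube dist1 dist1 (fun _ => True) _ sin); [exact B| |trivial].
    apply cts_continuous, continuity_sin.
  - destruct b; [apply cts_c1|]. unfold c3; simpl.
    eapply cts_ext; [|apply (cts_affine dist3 cube (-1) 0), cts_c1]. intros; simpl; ring.
Qed.

Lemma closed_ball_sq (x y z : R) : closed_ball (x, y, z) <-> x * x + y * y + z * z <= 1.
Proof.
  unfold closed_ball, dist3. rewrite <- sqrt_1 at 1.
  replace ((x - 0) ^ 2 + (y - 0) ^ 2 + (z - 0) ^ 2) with (x * x + y * y + z * z) by ring.
  split; intros H.
  - apply sqrt_le_0 in H; try lra. pose proof (Rle_0_sqr x). pose proof (Rle_0_sqr y).
    pose proof (Rle_0_sqr z). unfold Rsqr in *. lra.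
  - apply sqrt_le_1_alt. exact H.
Qed.

Definition open_ball (p : R3) : Prop := c1 p * c1 p + c2 p * c2 p + c3 p * c3 p < 1.

Lemma open_ball_nbhd (p : R3) : open_ball p ->
  exists rho, 0 < rho /\ forall v, nrm v <= rho -> closed_ball (vadd p v).
Proof.
  destruct p as [[x y] z]. unfold open_ball. cbv [c1 c2 c3 fst snd]. intros H.
  (* For [|a| <= 1] and [|d| <= r <= 1] one has [(a + d)^2 <= a^2 + 3 r]; three coordinates use up
     [9 r], the whole gap to 1. *)
  set (r := (1 - (x * x + y * y + z * z)) / 9). exists r.
  assert (Sq : forall u, 0 <= u * u) by (intros u; apply (Rle_0_sqr u)).
  pose proof (Sq x). pose proof (Sq y). pose proof (Sq z).
  assert (r <= 1) by (unfold r; lra). assert (Hr : 0 < r) by (unfold r; lra).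
  split; [exact Hr|]. intros [[u v] w] Hv. apply nrm_le in Hv.
  cbv [c1 c2 c3 fst snd] in Hv. destruct Hv as (U & V & W). apply closed_ball_sq.
  assert (P : forall a d, a * a <= 1 -> Rabs d <= r -> (a + d) * (a + d) <= a * a + 3 * r).
  { intros a d Ha Hd. apply Rabs_le_between in Hd.
    assert (-1 <= a <= 1) by (split; nra). nra. }
  pose proof (P x u ltac:(lra) U). pose proof (P y v ltac:(lra) V).
  pose proof (P z w ltac:(lra) W).
  assert (9 * r = 1 - (x * x + y * y + z * z)) by (unfold r; field). lra.
Qed.

(** Injectivity deforms the sphere [g(p + rho x) - g(p)] into the odd map
    [g(p + rho x / 2) - g(p - rho x / 2)] without zeros, so it is essential. It stays essential
    after replacing [g(p)] by a nearby [y]. If [y] were not attained, shrinking the radius to 0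
    would contract [g(p + rho x) - y] to a constant. *)
Theorem invariance_of_domain (g : R3 -> R3) (p : R3) :
  cont_on dist3 closed_ball g ->
  (forall x y, closed_ball x -> closed_ball y -> g x = g y -> x = y) ->
  open_ball p ->
  interior3 (fun y => exists x, closed_ball x /\ g x = y) (g p).
Proof.
  intros Hg Hinj Hp. destruct (open_ball_nbhd p Hp) as (rho & Hrho & Hball).
  set (pt := fun u b s t => vadd p (vscale (u * rho) (sph b s t))).
  assert (pB : forall u b s t, -1 <= u <= 1 -> I01 s -> closed_ball (pt u b s t)).
  { intros u b s t Hu Is. apply Hball. rewrite nrm_scale, Rabs_mult, (Rabs_right rho) by lra.
    assert (Rabs u <= 1) by (apply Rabs_le; lra). pose proof (Rabs_pos u).
    pose proof (sph_nrm b s t Is). pose proof (nrm_pos (sph b s t)).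
    assert (Rabs u * rho <= 1 * rho) by (apply Rmult_le_compat_r; lra).
    assert (0 <= Rabs u * rho) by (apply Rmult_le_pos; lra).
    assert (Rabs u * rho * nrm (sph b s t) <= 1 * rho * 1)
      by (apply Rmult_le_compat; lra). lra. }
  assert (pC : forall b (a : R3 -> R), cts dist3 dist1 cube a ->
    (forall q, cube q -> -1 <= a q <= 1) ->
    cts dist3 dist3 cube (fun q => g (pt (a q) b (c1 q) (c2 q)))).
  { intros b a Ha Hb.
    apply (cts_comp dist3 cube dist3 dist3 closed_ball (fun q => pt (a q) b (c1 q) (c2 q)) g).
    - apply cts_vadd; [apply cts_pt|]. apply cts_vscale; [|apply sph_cts].
      apply cts_mult; [exact Ha|apply cts_const].
    - exact Hg.
    - intros q Hq. apply pB; [apply Hb, Hq|apply Hq]. }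
  assert (pS : forall u, spherical (fun b s t => g (pt u b s t))).
  { intros u. destruct sph_spherical as (S1 & S2 & S3). unfold pt. repeat split; intros.
    - rewrite S1; auto.
    - rewrite S2; auto.
    - rewrite S3; auto. }
  assert (p0 : forall b s t, pt 0 b s t = p)
    by (intros; unfold pt; generalize (sph b s t); intros; vec).
  assert (Cp : closed_ball p) by (rewrite <- (p0 true 0 0); apply pB; [lra|apply I01_0]).
  set (h := fun b s t => g (pt 1 b s t)).
  assert (hC : sphere_cts h).
  { intros b. apply (pC b (fun _ => 1)); [apply cts_const|intros; lra]. }
  set (h0 := fun b s t => vsub (g (pt (/ 2) b s t)) (g (pt (- / 2) b s t))).
  assert (Odd : odd_map h0).
  { intros s t Is It. unfold h0, pt. destruct (sph_half s t) as [E1 E2].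
    rewrite E1, E2.
    replace (vscale (/ 2 * rho) (vscale (-1) (sph true s (t + / 2)))) with
      (vscale (- / 2 * rho) (sph true s (t + / 2))) by (generalize (sph true s (t + / 2)); intros; vec).
    replace (vscale (- / 2 * rho) (vscale (-1) (sph true s (t + / 2)))) with
      (vscale (/ 2 * rho) (sph true s (t + / 2))) by (generalize (sph true s (t + / 2)); intros; vec).
    replace (vscale (/ 2 * rho) (vscale (-1) (sph false s (t + / 2)))) with
      (vscale (- / 2 * rho) (sph false s (t + / 2))) by (generalize (sph false s (t + / 2)); intros; vec).
    replace (vscale (- / 2 * rho) (vscale (-1) (sph false s (t + / 2)))) with
      (vscale (/ 2 * rho) (sph false s (t + / 2))) by (generalize (sph false s (t + / 2)); intros; vec).
    split;
    [generalize (g (vadd p (vscale (- / 2 * rho) (sph true s (t + / 2)))))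
       (g (vadd p (vscale (/ 2 * rho) (sph true s (t + / 2)))))
    |generalize (g (vadd p (vscale (- / 2 * rho) (sph false s (t + / 2)))))
       (g (vadd p (vscale (/ 2 * rho) (sph false s (t + / 2)))))]; intros; vec. }
  assert (pI : forall u v b s t, -1 <= u <= 1 -> -1 <= v <= 1 -> u <> v -> I01 s ->
    vsub (g (pt u b s t)) (g (pt v b s t)) <> (0, 0, 0)).
  { intros u v b s t Hu Hv Huv Is E. apply vsub_eq0, Hinj in E; [|apply pB; assumption..].
    apply (sph_nz b s t). unfold pt in E. revert E. generalize (sph b s t). intros w E.
    assert (D : (u - v) * rho <> 0) by (apply Rmult_integral_contrapositive; split; lra).
    vec_unfold. injection E; intros E3 E2 E1.
    repeat apply f_equal2; apply (Rmult_eq_reg_l ((u - v) * rho)); lra. }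
  (* The two arguments slide from radii [1/2, -1/2] to [1, 0]. They always differ by 1, so
     injectivity excludes zeros. *)
  assert (M1 : hom h0 (hsub h (g p))).
  { exists (fun b s t r => vsub (g (pt (/ 2 * r + / 2) b s t)) (g (pt (/ 2 * r + - / 2) b s t))).
    repeat split.
    - intros b. apply cts_vsub; [apply (pC b (fun q => / 2 * c3 q + / 2))
        |apply (pC b (fun q => / 2 * c3 q + - / 2))]; try (apply cts_affine, cts_c3);
        intros q (_ & _ & Q1 & Q2); lra.
    - unfold I01. intros b s t r Is It Ir. apply pI; auto; lra.
    - intros b s Is.
      rewrite (proj1 (pS (/ 2 * r + / 2))), (proj1 (pS (/ 2 * r + - / 2))); auto.
    - intros t It. rewrite (proj1 (proj2 (pS (/ 2 * r + / 2)))),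
        (proj1 (proj2 (pS (/ 2 * r + - / 2)))); auto.
    - intros b t It. rewrite (proj2 (proj2 (pS (/ 2 * r + / 2)))),
        (proj2 (proj2 (pS (/ 2 * r + - / 2)))); auto.
    - intros. unfold h0. do 3 f_equal; lra.
    - intros. unfold hsub, h. rewrite <- (p0 b s t) at 1. do 3 f_equal; lra. }
  assert (LB : forall b, exists m, 0 < m /\ forall q, cube q ->
    m <= nrm (hsub h (g p) b (c1 q) (c2 q))).
  { intros b. apply (cts_lower_bound (fun q => hsub h (g p) b (c1 q) (c2 q))).
    - apply sphere_cts_hsub, hC.
    - intros q Hq. unfold hsub, h. rewrite <- (p0 b (c1 q) (c2 q)) at 1.
      apply pI; try lra. apply Hq. }
  destruct (LB true) as (m1 & Hm1 & L1). destruct (LB false) as (m2 & Hm2 & L2).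
  apply interior3_nrm. exists (Rmin m1 m2). split; [apply Rmin_pos; assumption|].
  intros y Hy. apply NNPP. intros Ny.
  assert (L : forall b s t, I01 s -> I01 t -> nrm (vsub (g p) y) < nrm (hsub h (g p) b s t)).
  { pose proof (Rmin_l m1 m2). pose proof (Rmin_r m1 m2).
    intros [|] s t Is It.
    - pose proof (L1 (s, t, 0) (conj Is (conj It I01_0))) as Q. unfold c1, c2 in Q; simpl in Q. lra.
    - pose proof (L2 (s, t, 0) (conj Is (conj It I01_0))) as Q. unfold c1, c2 in Q; simpl in Q. lra. }
  apply (odd_not_null h0 (vsub (g p) y) Odd).
  apply hom_trans with (hsub h (g p)); [exact M1|].
  apply hom_trans with (hsub h y).
  - apply hom_straight; auto using spherical_hsub, sphere_cts_hsub.
    + apply spherical_hsub, pS.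
    + apply spherical_hsub, pS.
    + intros b s t r Is It Ir E. specialize (L b s t Is It). unfold hsub in *.
      replace (vsub (h b s t) (g p)) with (vscale (- r) (vsub (g p) y)) in L.
      * rewrite nrm_scale, Rabs_Ropp, Rabs_right in L by (unfold I01 in Ir; lra).
        pose proof (nrm_pos (vsub (g p) y)). unfold I01 in Ir. nra.
      * revert E. generalize (h b s t) (g p). intros w w' E. clear - E. vec_unfold.
        injection E; intros. repeat apply f_equal2; lra.
  (* The radius factor runs from 1 down to 0; a zero on the way would exhibit [y] as a value of
     [g]. *)
  - exists (fun b s t r => vsub (g (pt (-1 * r + 1) b s t)) y). repeat split.
    + intros b. apply cts_vsub; [|apply cts_pt]. apply (pC b (fun q => -1 * c3 q + 1)).
      * apply cts_affine, cts_c3.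
      * intros q (_ & _ & Q1 & Q2). lra.
    + intros b s t r Is It Ir E. apply vsub_eq0 in E. apply Ny. eexists. split; [|exact E].
      apply pB; [unfold I01 in Ir; lra|exact Is].
    + intros. rewrite (proj1 (pS (-1 * r + 1))); auto.
    + intros. rewrite (proj1 (proj2 (pS (-1 * r + 1)))); auto.
    + intros. rewrite (proj2 (proj2 (pS (-1 * r + 1)))); auto.
    + intros. unfold hsub, h. do 3 f_equal. lra.
    + intros. replace (-1 * 1 + 1) with 0 by ring. rewrite p0. reflexivity.
Qed.

Lemma interior3_refl (T : R3 -> Prop) (c x : R3) :
  (forall x, T x -> T (refl c x)) -> interior3 T x -> interior3 T (refl c x).
Proof.
  intros HT H. apply interior3_nrm in H. destruct H as (e & He & H).
  apply interior3_nrm. exists e. split; [exact He|]. intros y Hy.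
  rewrite <- (refl_refl c y). apply HT, H.
  replace (vsub x (refl c y)) with (vsub y (refl c x)) by (unfold refl; vec).
  rewrite nrm_sub_sym. exact Hy.
Qed.

Lemma interior3_incl (A B : R3 -> Prop) (x : R3) :
  (forall y, A y -> B y) -> interior3 A x -> interior3 B x.
Proof. intros H (e & He & H'). exists e. auto. Qed.

Lemma closed_ball_scale (u : R) (p : R3) : 0 <= u <= 1 -> closed_ball p ->
  closed_ball (vscale u p) /\ (u < 1 -> open_ball (vscale u p)).
Proof.
  destruct p as [[x y] z]. intros Hu H. apply closed_ball_sq in H. unfold open_ball.
  cbv [vscale c1 c2 c3 fst snd].
  pose proof (Rle_0_sqr x). pose proof (Rle_0_sqr y). pose proof (Rle_0_sqr z).
  unfold Rsqr in *. set (S := x * x + y * y + z * z) in *.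
  assert (E : u * x * (u * x) + u * y * (u * y) + u * z * (u * z) = u * u * S)
    by (unfold S; ring).
  assert (0 <= S) by (unfold S; lra).
  assert (U : u * u <= u) by nra.
  assert (u * u * S <= u * u * 1) by (apply Rmult_le_compat_l; [apply Rle_0_sqr|lra]).
  split; [|intros]; [apply closed_ball_sq|]; rewrite E; lra.
Qed.

(** Loops are contracted radially in the ball. Invariance of domain puts the image of the open ball
    in the interior of [T], but says nothing about images of boundary points; these occur only where
    the image is an interior point for another reason. *)
Theorem not_homeomorphic_ball (T : R3 -> Prop) (c : R3) (K : R) :
  (forall x, T x -> T (refl c x)) -> (forall x, T x -> nrm x <= K) ->
  ~ interior3 T c -> far_chain (interior3 T) c K -> ~ homeomorphic T closed_ball.
Proof.
  intros Tr Tb Tc Tf (f & g & fB & gT & gf & fg & fc & gc).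
  assert (Dom : forall p, open_ball p -> interior3 T (g p)).
  { intros p Hp. eapply interior3_incl; [|apply (invariance_of_domain g p gc); [|exact Hp]].
    - intros y (x & Hx & <-). apply gT, Hx.
    - intros x y Hx Hy E. rewrite <- (fg x Hx), <- (fg y Hy), E. reflexivity. }
  assert (B0 : closed_ball (0, 0, 0)) by (apply closed_ball_sq; lra).
  assert (O0 : open_ball (0, 0, 0)) by (unfold open_ball, c1, c2, c3; simpl; lra).
  set (q := f (refl c (g (0, 0, 0)))).
  assert (Bq : closed_ball q) by apply fB, Tr, gT, B0.
  set (a := fun u => g (vscale u q)).
  assert (a0 : a 0 = g (0, 0, 0)) by (unfold a; f_equal; generalize q; intros; vec).
  assert (a1 : a 1 = refl c (a 0)).
  { rewrite a0. unfold a. replace (vscale 1 q) with q by (generalize q; intros; vec).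
    apply gf, Tr, gT, B0. }
  assert (ac : cts dist1 dist3 I01 a).
  { apply (cts_comp dist1 I01 dist3 dist3 closed_ball (fun u => vscale u q) g).
    - apply cts_vscale; [apply cts_id|apply cts_pt].
    - exact gc.
    - intros u Hu. apply closed_ball_scale; assumption. }
  assert (aO : forall u, I01 u -> interior3 T (a u)).
  { intros u [U0 U1]. destruct (Req_dec u 1) as [->|N].
    - rewrite a1, a0. apply interior3_refl; [exact Tr|]. apply Dom, O0.
    - apply Dom, closed_ball_scale; [split; assumption|exact Bq|lra]. }
  set (gam := double_path c a).
  assert (gamO : forall t, I01 t -> interior3 T (gam t)).
  { intros t It. apply double_path_in; auto. intros x. apply interior3_refl, Tr. }
  assert (gamT : forall t, I01 t -> T (gam t)) by (intros; apply interior3_sub, gamO; assumption).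
  assert (Bg : forall p, square01 p -> closed_ball (vscale (-1 * fst p + 1) (f (gam (snd p))))).
  { intros p [[P1 P2] P3]. apply closed_ball_scale; [lra|]. apply fB, gamT, P3. }
  set (H := fun p : R2 => g (vscale (-1 * fst p + 1) (f (gam (snd p))))).
  assert (H0 : forall t, I01 t -> H (0, t) = gam t).
  { intros t It. unfold H; simpl. rewrite <- (gf (gam t)) by (apply gamT, It). f_equal.
    rewrite gf by (apply gamT, It). generalize (f (gam t)); intros; vec. }
  assert (D2 : forall p q : R2, dist1 (fst p) (fst q) <= dist2 p q /\
    dist1 (snd p) (snd q) <= dist2 p q).
  { intros [x y] [x' y']. unfold dist1, dist2; simpl fst; simpl snd.
    rewrite <- !sqrt_Rsqr_abs. unfold Rsqr.
    pose proof (pow2_ge_0 (x - x')). pose proof (pow2_ge_0 (y - y')).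
    split; apply sqrt_le_1_alt; lra. }
  assert (Dp : cts dist2 dist1 square01 fst /\ cts dist2 dist1 square01 snd).
  { split; intros p _ e He; exists e; (split; [exact He|]); intros p' _ Hd;
      eapply Rle_lt_trans; [apply D2|exact Hd|apply D2|exact Hd]. }
  apply (no_antipodal_disc (interior3 T) c K) with (H := H).
  - apply interior3_open.
  - intros x. apply interior3_refl, Tr.
  - intros x Hx. apply Tb, interior3_sub, Hx.
  - exact Tc.
  - exact Tf.
  - apply (cts_comp dist2 square01 dist3 dist3 closed_ball
      (fun p => vscale (-1 * fst p + 1) (f (gam (snd p)))) g); [|exact gc|exact Bg].
    apply cts_vscale; [apply cts_affine, Dp|].
    apply (cts_comp dist2 square01 dist3 dist3 T (fun p => gam (snd p)) f); [|exact fc|].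
    + apply (cts_comp dist2 square01 dist1 dist3 I01 snd gam); [apply Dp| |intros p Hp; apply Hp].
      apply double_path_cts; assumption.
    + intros p Hp. apply gamT, Hp.
  (* For [s > 0] the radius is below 1; for [s = 0] the value is a point of the loop itself, already
     known to be interior. *)
  - intros [s t] [[S0 S1] It]. simpl in S0, S1, It. destruct (Req_dec s 0) as [->|N].
    + rewrite H0 by exact It. apply gamO, It.
    + apply Dom. apply closed_ball_scale; simpl; [lra|apply fB, gamT, It|lra].
  - intros t It. rewrite !H0 by (unfold I01; lra). apply double_path_antipodal; assumption.
  - intros t It. unfold H; simpl. f_equal. generalize (f (gam t)) (f (gam 0)); intros; vec.
  - intros s Is. unfold H; simpl. do 3 f_equal. apply double_path_closed, a1.
Qed.

(** * Lattice coverings *)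

Lemma int3_vadd (p q : R3) : int3 p -> int3 q -> int3 (vadd p q).
Proof.
  intros (a & b & c & ->) (a' & b' & c' & ->). exists (a + a')%Z, (b + b')%Z, (c + c')%Z.
  rewrite !plus_IZR. reflexivity.
Qed.

Lemma int3_vsub (p q : R3) : int3 p -> int3 q -> int3 (vsub p q).
Proof.
  intros (a & b & c & ->) (a' & b' & c' & ->). exists (a - a')%Z, (b - b')%Z, (c - c')%Z.
  rewrite !minus_IZR. reflexivity.
Qed.

Lemma int3_vscale (n : Z) (p : R3) : int3 p -> int3 (vscale (IZR n) p).
Proof.
  intros (a & b & c & ->). exists (n * a)%Z, (n * b)%Z, (n * c)%Z.
  rewrite !mult_IZR. reflexivity.
Qed.

Lemma int3_mv (M : mat3) (p : R3) : int3 p -> int3 (mv M p).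
Proof.
  intros (a & b & c & ->). unfold mv.
  exists (m11 M * a + m12 M * b + m13 M * c)%Z, (m21 M * a + m22 M * b + m23 M * c)%Z,
    (m31 M * a + m32 M * b + m33 M * c)%Z.
  rewrite !plus_IZR, !mult_IZR. reflexivity.
Qed.

Lemma int3_nrm (z : R3) : int3 z -> z <> (0, 0, 0) -> 1 <= nrm z.
Proof.
  intros (a & b & c & ->) N. apply Rnot_lt_le. intros L. apply N.
  apply nrm_lt in L. cbv [c1 c2 c3 fst snd] in L. rewrite <- !abs_IZR in L.
  destruct L as (L1 & L2 & L3). apply lt_IZR in L1, L2, L3.
  replace a with 0%Z by lia. replace b with 0%Z by lia. replace c with 0%Z by lia. reflexivity.
Qed.

Definition zrange (n : nat) : list Z :=
  map (fun i => (Z.of_nat i - Z.of_nat n)%Z) (seq 0 (2 * n + 1)).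

Lemma In_zrange (n : nat) (a : Z) : (Z.abs a <= Z.of_nat n)%Z -> In a (zrange n).
Proof.
  intros H. apply in_map_iff. exists (Z.to_nat (a + Z.of_nat n)). split; [lia|].
  apply in_seq. lia.
Qed.

Lemma int3_finite (K : R) : exists l : list R3, forall z, int3 z -> nrm z <= K -> In z l.
Proof.
  destruct (INR_unbounded K) as (n & Hn).
  exists (map (fun t => (IZR (fst (fst t)), IZR (snd (fst t)), IZR (snd t)) : R3)
    (list_prod (list_prod (zrange n) (zrange n)) (zrange n))).
  intros z (a & b & c & ->) H. apply nrm_le in H. cbv [c1 c2 c3 fst snd] in H.
  rewrite <- !abs_IZR in H. apply in_map_iff. exists (a, b, c). split; [reflexivity|].
  rewrite INR_IZR_INZ in Hn.
  repeat apply in_prod; apply In_zrange; apply le_IZR; lra.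
Qed.

Lemma chain_trans (e : R) (Q : R3 -> Prop) (x y z : R3) :
  chain e Q x y -> chain e Q y z -> chain e Q x z.
Proof.
  intros H1 H2. apply clos_rt_rtn1. apply rt_trans with y; apply clos_rtn1_rt; assumption.
Qed.

Lemma chain_map (e e' : R) (P Q : R3 -> Prop) (f : R3 -> R3) (x y : R3) :
  (forall u v, hstep e P u v -> hstep e' Q (f u) (f v)) ->
  chain e P x y -> chain e' Q (f x) (f y).
Proof.
  intros Hf H. induction H as [|y z Hyz Hxy IH]; [apply rtn1_refl|].
  eapply Relation_Operators.rtn1_trans; [apply Hf, Hyz|exact IH].
Qed.

Definition chain_connected (T : R3 -> Prop) : Prop :=
  forall e x y, 0 < e -> T x -> T y -> chain e T x y.

Definition closed3 (T : R3 -> Prop) : Prop :=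
  forall x, ~ T x -> exists e, 0 < e /\ forall y, nrm (vsub x y) < e -> ~ T y.

Section Covering.
Variables (T : R3 -> Prop) (K : R).
Hypothesis T_closed : closed3 T.
Hypothesis T_bound : forall x, T x -> nrm x <= K.
Hypothesis T_cover : forall x, exists z, int3 z /\ T (vsub x z).
Hypothesis T_disj : forall x z, interior3 T x -> int3 z -> z <> (0, 0, 0) -> ~ T (vsub x z).
Hypothesis T_conn : chain_connected T.

Lemma closed3_list (l : list R3) (x : R3) :
  (forall z, In z l -> ~ T (vsub x z)) ->
  exists e, 0 < e /\ forall z y, In z l -> nrm (vsub x y) < e -> ~ T (vsub y z).
Proof.
  induction l as [|z l IH]; intros H.
  - exists 1. split; [lra|]. intros z y [].
  - destruct IH as (e & He & IH); [intros; apply H; right; assumption|].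
    destruct (T_closed (vsub x z)) as (e' & He' & H'); [apply H; left; reflexivity|].
    exists (Rmin e e'). split; [apply Rmin_pos; assumption|].
    pose proof (Rmin_l e e'). pose proof (Rmin_r e e').
    intros w y [<-|Hw] Hy.
    + apply H'. replace (vsub (vsub x z) (vsub y z)) with (vsub x y); [lra|].
      clear. vec.
    + apply IH; [exact Hw|lra].
Qed.

(** Near [x] only finitely many translates matter and all are closed. If no nonzero one contained
    [x], a whole ball about [x] would be covered by [T] alone. *)
Lemma outside_interior (x : R3) : ~ interior3 T x ->
  exists z, int3 z /\ z <> (0, 0, 0) /\ T (vsub x z).
Proof.
  intros Hx. apply NNPP. intros N. apply Hx.
  (* A translate meeting the unit ball about [x] has [nrm z] at most this. *)
  destruct (int3_finite (nrm x + 1 + K)) as (l & Hl).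
  destruct (closed3_list (filter (fun z => if excluded_middle_informative
    (int3 z /\ z <> (0, 0, 0)) then true else false) l) x) as (e & He & H).
  - intros z Hz. apply filter_In in Hz. destruct Hz as [_ Hz].
    destruct excluded_middle_informative as [[Z1 Z2]|]; [|discriminate].
    intros HT. apply N. exists z. auto.
  - apply interior3_nrm. exists (Rmin 1 e). split; [apply Rmin_pos; lra|].
    pose proof (Rmin_l 1 e). pose proof (Rmin_r 1 e). intros y Hy.
    destruct (T_cover y) as (z & Iz & Tz).
    destruct (excluded_middle_informative (z = (0, 0, 0))) as [->|Nz].
    + replace (vsub y (0, 0, 0)) with y in Tz; [exact Tz|]. clear. vec.
    + exfalso. apply (H z y); [|lra|exact Tz]. apply filter_In. split.
      * apply Hl; [exact Iz|]. specialize (T_bound _ Tz).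
        assert (nrm z <= nrm y + nrm (vsub y z)).
        { replace z with (vsub y (vsub y z)) at 1; [apply nrm_sub|clear; vec]. }
        assert (nrm y <= nrm x + nrm (vsub x y)).
        { replace y with (vsub x (vsub x y)) at 1; [apply nrm_sub|clear; vec]. }
        lra.
      * destruct excluded_middle_informative as [|N']; [reflexivity|]. tauto.
Qed.

(** The last point of [T] on a line in the first coordinate direction: closedness keeps it in [T],
    maximality out of the interior. *)
Lemma has_boundary_point (x0 : R3) : T x0 -> exists x, T x /\ ~ interior3 T x.
Proof.
  intros H0. set (pt := fun t => vadd x0 (t, 0, 0)).
  destruct (completeness (fun t => T (pt t))) as (m & Hub & Hlub).
  - exists (K - c1 x0). intros t Ht. specialize (T_bound _ Ht).
    destruct (nrm_coord (pt t)) as (C & _ & _). unfold pt in *.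
    destruct x0 as [[x y] z]. cbv [vadd c1 fst snd] in *. pose proof (Rle_abs (x + t)). lra.
  - exists 0. unfold pt. replace (vadd x0 (0, 0, 0)) with x0; [exact H0|]. clear. vec.
  - assert (D : forall t t', nrm (vsub (pt t) (pt t')) = Rabs (t - t')).
    { intros t t'. unfold pt. replace (vsub (vadd x0 (t, 0, 0)) (vadd x0 (t', 0, 0)))
        with (vscale (t - t') (1, 0, 0)) by (clear; vec).
      rewrite nrm_scale. replace (nrm (1, 0, 0)) with 1; [ring|].
      unfold nrm, c1, c2, c3; simpl. rewrite Rabs_R1, Rabs_R0, (Rmax_left 0 0), Rmax_left; lra. }
    exists (pt m). split.
    + apply NNPP. intros N. destruct (T_closed _ N) as (e & He & H).
      assert (m <= m - e / 2); [|lra]. apply Hlub. intros t Ht. apply Rnot_lt_le. intros L.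
      apply (H (pt t)); [|exact Ht]. rewrite D. specialize (Hub t Ht).
      apply Rabs_def1; lra.
    + intros I. apply interior3_nrm in I. destruct I as (e & He & H).
      assert (m + e / 2 <= m); [|lra]. apply Hub, H. rewrite D. apply Rabs_def1; lra.
Qed.

(** A boundary point is shared with a neighbour [T + n]. The progressions [z0 + k n] and [z0 - l n]
    cannot both reach 0, since that forces [k + l = 0] and then [z0 = 0]; so one of the signs of [n]
    avoids the tile [T] itself. *)
Lemma neighbour_direction (z0 : R3) : z0 <> (0, 0, 0) -> (exists x, T x) ->
  exists n p, int3 n /\ n <> (0, 0, 0) /\ T p /\ T (vsub p n) /\
    forall k : nat, vadd z0 (vscale (IZR (Z.of_nat k)) n) <> (0, 0, 0).
Proof.
  intros Nz (x0 & H0).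
  destruct (has_boundary_point x0 H0) as (p & Tp & Ip).
  destruct (outside_interior p Ip) as (n & In & Nn & Tn).
  destruct (classic (forall k : nat, vadd z0 (vscale (IZR (Z.of_nat k)) n) <> (0, 0, 0)))
    as [A|A].
  - exists n, p. auto.
  - apply not_all_ex_not in A. destruct A as (k & A). apply NNPP in A.
    exists (vscale (IZR (-1)) n), (vsub p n).
    split; [apply int3_vscale, In|]. split; [|split; [exact Tn|split]].
    + intros E. apply Nn. clear - E. vec_unfold. injection E; intros.
      repeat apply f_equal2; lra.
    + replace (vsub (vsub p n) (vscale (-1) n)) with p; [exact Tp|]. clear. vec.
    + intros l E. apply Nz.
      assert (S : IZR (Z.of_nat k) + IZR (Z.of_nat l) = 0).
      { pose proof (int3_nrm n In Nn) as L.
        assert (V : vscale (IZR (Z.of_nat k) + IZR (Z.of_nat l)) n = (0, 0, 0)).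
        { clear - A E. vec_unfold. injection A; injection E; intros.
          repeat apply f_equal2; lra. }
        assert (V' : nrm (vscale (IZR (Z.of_nat k) + IZR (Z.of_nat l)) n) = 0)
          by (rewrite V; apply nrm_0).
        rewrite nrm_scale in V'. apply Rmult_integral in V'. destruct V' as [V'|V']; [|lra].
        destruct (Req_dec (IZR (Z.of_nat k) + IZR (Z.of_nat l)) 0) as [Q|Q]; [exact Q|].
        apply Rabs_no_R0 in Q. contradiction. }
      rewrite <- plus_IZR in S. apply eq_IZR in S.
      replace (Z.of_nat k) with 0%Z in A by lia. rewrite <- A. clear. vec.
Qed.

(* The translates [T + z0 + k n] form an unbounded connected family outside the
   interior of [T]. *)
Lemma covering_far_chain (c : R3) (B : R) : ~ interior3 T c -> far_chain (interior3 T) c B.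
Proof.
  intros Hc e He.
  destruct (outside_interior c Hc) as (z0 & Iz & Nz & Tz).
  destruct (neighbour_direction z0 Nz (ex_intro _ _ Tz)) as (n & p & In & Nn & Tp & Tpn & Hk).
  set (z := fun k : nat => vadd z0 (vscale (IZR (Z.of_nat k)) n)).
  assert (Tile : forall k x y, T (vsub x (z k)) -> T (vsub y (z k)) ->
    chain e (fun y => ~ interior3 T y) x y).
  { intros k x y Hx Hy.
    assert (E : forall w, w = vadd (vsub w (z k)) (z k)) by (generalize (z k); clear; intros; vec).
    rewrite (E x), (E y). apply chain_map with (e := e) (P := T) (f := fun u => vadd u (z k));
      [|apply T_conn; assumption].
    assert (Out : forall u, T u -> ~ interior3 T (vadd u (z k))).
    { intros u Hu I. apply (T_disj _ (z k) I); [|apply Hk|].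
      - apply int3_vadd; [exact Iz|apply int3_vscale, In].
      - replace (vsub (vadd u (z k)) (z k)) with u; [exact Hu|].
        generalize (z k); clear; intros; vec. }
    intros u v (Hu & Hv & Huv). split; [apply Out, Hu|]. split; [apply Out, Hv|].
    replace (vsub (vadd u (z k)) (vadd v (z k))) with (vsub u v); [exact Huv|].
    generalize (z k); clear; intros; vec. }
  (* The point [p + z k] belongs to two consecutive tiles of the progression and links their
     chains. *)
  assert (Step : forall k, vsub (vadd p (z k)) (z k) = p /\
    vsub (vadd p (z k)) (z (S k)) = vsub p n).
  { intros k. unfold z. rewrite Nat2Z.inj_succ, succ_IZR. generalize (IZR (Z.of_nat k)).
    clear. intros r. split; vec. }
  assert (Reach : forall k y, T (vsub y (z k)) -> chain e (fun y => ~ interior3 T y) c y).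
  { induction k as [|k IH]; intros y Hy.
    - apply (Tile O); [|exact Hy].
      replace (z O) with z0; [exact Tz|]. unfold z. simpl. clear. vec.
    - apply chain_trans with (vadd p (z k)).
      + apply IH. rewrite (proj1 (Step k)). exact Tp.
      + apply (Tile (S k)); [|exact Hy]. rewrite (proj2 (Step k)). exact Tpn. }
  (* Since [nrm n >= 1], the point [p + z0 + k n] has norm at least [k - nrm (p + z0)]. *)
  destruct (INR_unbounded (B + nrm (vadd p z0))) as (k & Hk').
  exists (vadd p (z k)). split.
  - pose proof (int3_nrm n In Nn) as L.
    assert (A : nrm (vscale (IZR (Z.of_nat k)) n) <= nrm (vadd p (z k)) + nrm (vadd p z0)).
    { replace (vscale (IZR (Z.of_nat k)) n) with (vsub (vadd p (z k)) (vadd p z0));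
        [apply nrm_sub|]. unfold z. generalize (IZR (Z.of_nat k)); clear; intros; vec. }
    rewrite nrm_scale, <- INR_IZR_INZ in A. pose proof (pos_INR k).
    rewrite Rabs_right in A by lra.
    assert (INR k * 1 <= INR k * nrm n) by (apply Rmult_le_compat_l; lra). lra.
  - apply (Reach k). rewrite (proj1 (Step k)). exact Tp.
Qed.

End Covering.

(** * Metric consequences of compactness and connectedness *)

Lemma compact_bounded (T : R3 -> Prop) : compact3 T -> exists K, forall x, T x -> nrm x <= K.
Proof.
  intros HT. destruct (HT nat (fun n x => nrm x < INR n)) as (l & Hl).
  - intros n. apply open3_nrm. intros x Hx. exists (INR n - nrm x). split; [lra|].
    intros y Hy. assert (nrm y <= nrm x + nrm (vsub x y)); [|lra].
    replace y with (vsub x (vsub x y)) at 1 by vec. apply nrm_sub.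
  - intros x _. destruct (INR_unbounded (nrm x)) as (n & Hn). exists n. lra.
  - exists (INR (list_max l)). intros x Hx. destruct (Hl x Hx) as (n & Hn & L).
    assert (Q : (n <= list_max l)%nat).
    { pose proof (proj1 (list_max_le l (list_max l)) (le_n _)) as F.
      rewrite Forall_forall in F. apply F, Hn. }
    apply le_INR in Q. lra.
Qed.

Lemma compact_closed (T : R3 -> Prop) : compact3 T -> closed3 T.
Proof.
  intros HT x Nx. destruct (HT nat (fun n y => / INR (S n) < nrm (vsub x y))) as (l & Hl).
  - intros n. apply open3_nrm. intros y Hy. exists (nrm (vsub x y) - / INR (S n)).
    split; [lra|]. intros w Hw. pose proof (nrm_sub_triang x w y) as Q.
    rewrite (nrm_sub_sym w y) in Q. lra.
  - intros y Hy. assert (P : 0 < nrm (vsub x y)).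
    { apply nrm_gt0. intros E. apply vsub_eq0 in E. subst. contradiction. }
    destruct (archimed_cor1 _ P) as (n & Hn & Hn0). exists (pred n).
    rewrite Nat.succ_pred by lia. exact Hn.
  - exists (/ INR (S (list_max l))).
    split; [apply Rinv_0_lt_compat, lt_0_INR; lia|]. intros y Hy HTy.
    destruct (Hl y HTy) as (n & Hn & L).
    assert (Q : (n <= list_max l)%nat).
    { pose proof (proj1 (list_max_le l (list_max l)) (le_n _)) as F.
      rewrite Forall_forall in F. apply F, Hn. }
    assert (/ INR (S (list_max l)) <= / INR (S n)); [|lra].
    apply Rinv_le_contravar; [apply lt_0_INR; lia|]. apply le_INR. lia.
Qed.

(** The points reachable from [x] and the unreachable ones have open [e]-neighbourhoods. A point of
    [T] in both would itself serve as an intermediate link. *)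
Lemma connected_chain_connected (T : R3 -> Prop) : connected3 T -> chain_connected T.
Proof.
  intros HT e x y He Hx Hy. apply NNPP. intros N. apply HT.
  exists (fun w => exists u, chain e T x u /\ T u /\ nrm (vsub u w) < e),
    (fun w => exists u, ~ chain e T x u /\ T u /\ nrm (vsub u w) < e).
  assert (Op : forall P : R3 -> Prop, open3 (fun w => exists u, P u /\ T u /\ nrm (vsub u w) < e)).
  { intros P. apply open3_nrm. intros w (u & Pu & Tu & L). exists (e - nrm (vsub u w)).
    split; [lra|]. intros w' Hw'. exists u. repeat split; auto.
    pose proof (nrm_sub_triang u w w'). lra. }
  split; [apply Op|]. split; [apply (Op (fun u => ~ chain e T x u))|].
  split; [|split; [|split]].
  - intros w Tw. destruct (classic (chain e T x w)); [left|right]; exists w;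
      rewrite nrm_self; auto.
  - exists x. split; [exact Hx|]. exists x. rewrite nrm_self.
    split; [apply rtn1_refl|split; [exact Hx|exact He]].
  - exists y. split; [exact Hy|]. exists y. rewrite nrm_self. auto.
  - intros w Tw (u & Cu & Tu & Lu) (v & Cv & Tv & Lv). apply Cv.
    eapply (Relation_Operators.rtn1_trans _ _ _ w); [split; [exact Tw|split; [exact Tv|]]|].
    + rewrite nrm_sub_sym. exact Lv.
    + eapply (Relation_Operators.rtn1_trans _ _ _ u); [split; [exact Tu|split; [exact Tw|exact Lu]]|exact Cu].
Qed.

(** * Expanding matrices *)

Definition tends0 (x : nat -> R) : Prop :=
  forall e, 0 < e -> exists N, forall n, (N <= n)%nat -> x n < e.

Lemma contraction_tends0 (th : R) (x b : nat -> R) :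
  0 <= th < 1 -> (forall n, 0 <= x n) -> (forall n, x (S n) <= th * (x n + b n)) ->
  tends0 b -> tends0 x.
Proof.
  intros Hth Hx Hs Hb e He.
  (* With this error the bound [e / 2] reproduces itself, because [th (2 - th) <= 1]. *)
  destruct (Hb (e * (1 - th) / 2)) as (N & HN).
  { apply Rdiv_lt_0_compat; [apply Rmult_lt_0_compat; lra|lra]. }
  assert (B : forall k, x (N + k)%nat <= th ^ k * x N + e / 2).
  { induction k as [|k IH].
    - rewrite Nat.add_0_r. simpl. lra.
    - rewrite Nat.add_succ_r. eapply Rle_trans; [apply Hs|].
      specialize (HN (N + k)%nat ltac:(lia)). simpl.
      assert (th * (x (N + k)%nat + b (N + k)%nat) <=
              th * (th ^ k * x N + e / 2 + e * (1 - th) / 2))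
        by (apply Rmult_le_compat_l; lra).
      assert (0 <= e * ((1 - th) * (1 - th)))
        by (apply Rmult_le_pos; [lra|apply Rle_0_sqr]).
      lra. }
  destruct (pow_lt_1_zero th) with (y := e / (2 * (x N + 1))) as (k0 & Hk0).
  - rewrite Rabs_right; lra.
  - pose proof (Hx N). apply Rdiv_lt_0_compat; lra.
  - exists (N + k0)%nat. intros n Hn. replace n with (N + (n - N))%nat by lia.
    eapply Rle_lt_trans; [apply B|].
    specialize (Hk0 (n - N)%nat ltac:(lia)). apply Rabs_def2 in Hk0. pose proof (Hx N).
    assert (P : 0 <= th ^ (n - N)) by (apply pow_le; lra).
    assert (Q : th ^ (n - N) * (x N + 1) < e / (2 * (x N + 1)) * (x N + 1))
      by (apply Rmult_lt_compat_r; lra).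
    replace (e / (2 * (x N + 1)) * (x N + 1)) with (e / 2) in Q by (field; lra).
    lra.
Qed.

(** Solving for [c (S n)] gives a contraction by the inverse of [|l|]. Each use removes one linear
    factor of a recurrence. *)
Lemma expanding_step (l : C) (c b : nat -> C) :
  1 < Complex.Cmod l -> (forall n, c n = (l * c (S n) + b n)%C) ->
  tends0 (fun n => Complex.Cmod (b n)) -> tends0 (fun n => Complex.Cmod (c n)).
Proof.
  intros Hl Hc Hb.
  apply contraction_tends0 with (th := / Complex.Cmod l) (b := fun n => Complex.Cmod (b n)).
  - split; [apply Rlt_le, Rinv_0_lt_compat; lra|]. rewrite <- Rinv_1.
    apply Rinv_lt_contravar; lra.
  - intros n. apply Cmod_ge_0.
  - intros n. apply Rmult_le_reg_l with (Complex.Cmod l); [lra|].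
    rewrite <- Rmult_assoc, Rinv_r, Rmult_1_l by lra. rewrite <- Cmod_mult.
    replace (l * c (S n))%C with (c n + - b n)%C by (rewrite (Hc n); ring).
    eapply Rle_trans; [apply Cmod_triangle|]. rewrite Cmod_opp. lra.
  - exact Hb.
Qed.

Lemma cubic_real_root (a2 a1 a0 : R) : exists r, r * r * r - a2 * (r * r) + a1 * r - a0 = 0.
Proof.
  set (f := fun r => r * r * r - a2 * (r * r) + a1 * r - a0).
  set (B := 1 + Rabs a2 + Rabs a1 + Rabs a0).
  pose proof (Rabs_pos a2). pose proof (Rabs_pos a1). pose proof (Rabs_pos a0).
  assert (HB : 1 <= B) by (unfold B; lra).
  assert (L : forall x, - Rabs x <= x <= Rabs x).
  { intros x. pose proof (Rle_abs x). pose proof (Rle_abs (- x)) as Q.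
    rewrite Rabs_Ropp in Q. lra. }
  pose proof (L a2). pose proof (L a1). pose proof (L a0).
  assert (B2 : B <= B * B) by nra.
  assert (E : B * B * B = B * B + Rabs a2 * (B * B) + Rabs a1 * (B * B) + Rabs a0 * (B * B))
    by (unfold B; ring).
  assert (Q2 : - (Rabs a2 * (B * B)) <= a2 * (B * B) <= Rabs a2 * (B * B)) by (split; nra).
  assert (Q1 : - (Rabs a1 * (B * B)) <= a1 * B <= Rabs a1 * (B * B)) by (split; nra).
  assert (Q0 : - (Rabs a0 * (B * B)) <= a0 <= Rabs a0 * (B * B)) by (split; nra).
  destruct (IVT f (- B) B) as (r & _ & Hr).
  - unfold f. reg.
  - lra.
  - unfold f. nra.
  - unfold f. nra.
  - exists r. exact Hr.
Qed.

(** A real root comes from the intermediate value theorem, the other two from the quadratic formula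
    applied to the cofactor [x^2 + u x + w]. *)
Lemma cubic_roots (a2 a1 a0 : R) : exists l1 l2 l3 : C,
  RtoC a2 = (l1 + l2 + l3)%C /\ RtoC a1 = (l1 * l2 + l1 * l3 + l2 * l3)%C /\
  RtoC a0 = (l1 * l2 * l3)%C.
Proof.
  destruct (cubic_real_root a2 a1 a0) as (r & Hr).
  set (u := r - a2). set (w := a1 + r * u).
  assert (E0 : a0 = r * w) by (unfold w, u; lra).
  assert (Q : exists x y x' y', x + x' = - u /\ y + y' = 0 /\
    x * x' - y * y' = w /\ x * y' + y * x' = 0).
  { destruct (Rle_lt_dec 0 (u * u - 4 * w)) as [D|D].
    - exists ((- u + sqrt (u * u - 4 * w)) / 2), 0, ((- u - sqrt (u * u - 4 * w)) / 2), 0.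
      pose proof (sqrt_sqrt _ D). repeat split; lra.
    - exists (- u / 2), (sqrt (4 * w - u * u) / 2), (- u / 2), (- (sqrt (4 * w - u * u) / 2)).
      pose proof (sqrt_sqrt (4 * w - u * u) ltac:(lra)). repeat split; lra. }
  destruct Q as (x & y & x' & y' & Q1 & Q2 & Q3 & Q4).
  exists (r, 0), (x, y), (x', y'). unfold RtoC, Cplus, Cmult; simpl.
  unfold w, u in *.
  assert (A2 : a2 = r + x + x') by lra.
  repeat split; apply f_equal2; try lra.
  - replace a1 with (w - r * u) by (unfold w, u; ring). unfold w, u.
    rewrite <- Q3. replace (r - a2) with (- (x + x')) by lra. ring.
  - replace (r * y + 0 * x + (r * y' + 0 * x') + (x * y' + y * x')) with
      (r * (y + y') + (x * y' + y * x')) by ring. rewrite Q2, Q4. ring.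
  - rewrite E0, <- Q3. ring.
  - replace ((r * x - 0 * y) * y' + (r * y + 0 * x) * x') with (r * (x * y' + y * x')) by ring.
    rewrite Q4. ring.
Qed.

Definition trZ (M : mat3) : Z := (m11 M + m22 M + m33 M)%Z.
Definition minorsZ (M : mat3) : Z :=
  (m11 M * m22 M - m12 M * m21 M + (m11 M * m33 M - m13 M * m31 M)
   + (m22 M * m33 M - m23 M * m32 M))%Z.

Lemma detZ_IZR (M : mat3) : IZR (detZ M) =
  IZR (m11 M) * (IZR (m22 M) * IZR (m33 M) - IZR (m23 M) * IZR (m32 M))
  + IZR (m13 M) * (IZR (m21 M) * IZR (m32 M) - IZR (m22 M) * IZR (m31 M))
  - IZR (m12 M) * (IZR (m21 M) * IZR (m33 M) - IZR (m23 M) * IZR (m31 M)).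
Proof.
  unfold detZ, det3.
  rewrite minus_IZR, plus_IZR, !mult_IZR, !minus_IZR, !mult_IZR. reflexivity.
Qed.

Lemma eigenvalue_charpoly (M : mat3) (l : Cx) :
  eigenvalue M l <->
  (l * l * l - RtoC (IZR (trZ M)) * (l * l) + RtoC (IZR (minorsZ M)) * l
   - RtoC (IZR (detZ M)) = RtoC 0)%C.
Proof.
  rewrite detZ_IZR. unfold trZ, minorsZ.
  rewrite !plus_IZR, !minus_IZR, !mult_IZR.
  destruct l as [x y].
  unfold eigenvalue, det3, Cadd, Csub, Cmul, Cz, Cminus, Cplus, Cmult, Copp, RtoC; simpl.
  split; intros E; injection E; intros E2 E1; apply f_equal2.
  all: first [etransitivity; [|exact E1]; ring | etransitivity; [|exact E2]; ring].
Qed.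

Lemma cayley_hamilton (M : mat3) (p : R3) :
  mv M (mv M (mv M p)) =
  vadd (vsub (vscale (IZR (trZ M)) (mv M (mv M p))) (vscale (IZR (minorsZ M)) (mv M p)))
    (vscale (IZR (detZ M)) p).
Proof.
  rewrite detZ_IZR. unfold trZ, minorsZ. rewrite !plus_IZR, !minus_IZR, !mult_IZR. vec.
Qed.

Definition minv (M : mat3) (p : R3) : R3 :=
  let d := IZR (detZ M) in
  let a := IZR (m11 M) in let b := IZR (m12 M) in let c := IZR (m13 M) in
  let e := IZR (m21 M) in let f := IZR (m22 M) in let g := IZR (m23 M) in
  let h := IZR (m31 M) in let i := IZR (m32 M) in let j := IZR (m33 M) in
  let '(x, y, z) := p in
  (((f * j - g * i) * x + (c * i - b * j) * y + (b * g - c * f) * z) / d,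
   ((g * h - e * j) * x + (a * j - c * h) * y + (c * e - a * g) * z) / d,
   ((e * i - f * h) * x + (b * h - a * i) * y + (a * f - b * e) * z) / d).

Section Inverse.
Variable M : mat3.
Hypothesis det_nz : detZ M <> 0%Z.

Lemma mv_minv (p : R3) : mv M (minv M p) = p.
Proof.
  assert (D : IZR (detZ M) <> 0) by (intros E; apply det_nz, eq_IZR, E).
  unfold minv. destruct p as [[x y] z]. cbv [mv]. rewrite detZ_IZR in *.
  repeat apply f_equal2; field; exact D.
Qed.

Lemma minv_mv (p : R3) : minv M (mv M p) = p.
Proof.
  assert (D : IZR (detZ M) <> 0) by (intros E; apply det_nz, eq_IZR, E).
  unfold minv. destruct p as [[x y] z]. cbv [mv]. rewrite detZ_IZR in *.
  repeat apply f_equal2; field; exact D.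
Qed.

End Inverse.

Lemma minv_lin (M : mat3) (x y z : R) (p q r : R3) :
  minv M (vadd (vscale x p) (vadd (vscale y q) (vscale z r))) =
  vadd (vscale x (minv M p)) (vadd (vscale y (minv M q)) (vscale z (minv M r))).
Proof. unfold minv. vec_unfold. unfold Rdiv. repeat apply f_equal2; ring. Qed.

Lemma expanding_det (M : mat3) : expanding M -> detZ M <> 0%Z.
Proof.
  intros HM E. specialize (HM (0, 0)).
  assert (L : 1 < Cmod (0, 0)).
  { apply HM, eigenvalue_charpoly. rewrite E. unfold RtoC, Cminus, Cplus, Cmult, Copp; simpl.
    apply f_equal2; ring. }
  unfold Cmod in L; simpl in L. replace (0 * (0 * 1) + 0 * (0 * 1)) with 0 in L by ring.
  rewrite sqrt_0 in L. lra.
Qed.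

(** By Cayley-Hamilton each coordinate of the backward orbit satisfies a scalar recurrence that
    factors through the three eigenvalues. Peeling off the factors with [expanding_step] requires no
    diagonalisation, so multiple eigenvalues are harmless. *)
Lemma minv_iter_tends0 (M : mat3) (v : R3) : expanding M ->
  tends0 (fun n => nrm (Nat.iter n (minv M) v)).
Proof.
  intros HM. pose proof (expanding_det M HM) as Hd.
  set (a := fun n => Nat.iter n (minv M) v).
  assert (Rec : forall n, a n = vadd (vsub (vscale (IZR (trZ M)) (a (S n)))
      (vscale (IZR (minorsZ M)) (a (S (S n))))) (vscale (IZR (detZ M)) (a (S (S (S n)))))).
  { intros n. pose proof (cayley_hamilton M (a (S (S (S n))))) as CH.
    assert (I : forall k, mv M (a (S k)) = a k) by (intros k; apply mv_minv, Hd).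
    rewrite !I in CH. exact CH. }
  destruct (cubic_roots (IZR (trZ M)) (IZR (minorsZ M)) (IZR (detZ M)))
    as (l1 & l2 & l3 & E2 & E1 & E0).
  assert (Eig : forall l, (l = l1 \/ l = l2 \/ l = l3) -> 1 < Complex.Cmod l).
  { intros l Hl. apply HM, eigenvalue_charpoly. rewrite E2, E1, E0.
    destruct Hl as [->|[->| ->]]; ring. }
  assert (Seq : forall z : nat -> C,
    (forall n, z n = (RtoC (IZR (trZ M)) * z (S n) - RtoC (IZR (minorsZ M)) * z (S (S n))
       + RtoC (IZR (detZ M)) * z (S (S (S n))))%C) -> tends0 (fun n => Complex.Cmod (z n))).
  { intros z Hz. rewrite E2, E1, E0 in Hz.
    apply (expanding_step l1 z (fun n => z n - l1 * z (S n))%C); [apply Eig; auto|intros; ring|].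
    apply (expanding_step l2 (fun n => z n - l1 * z (S n))%C
      (fun n => z n - l1 * z (S n) - l2 * (z (S n) - l1 * z (S (S n))))%C);
      [apply Eig; auto|intros; ring|].
    apply (expanding_step l3 (fun n => z n - l1 * z (S n) - l2 * (z (S n) - l1 * z (S (S n))))%C
      (fun _ => RtoC 0)).
    - apply Eig; auto.
    - intros n. rewrite (Hz n). ring.
    - intros e He. exists O. intros n _. rewrite Cmod_0. exact He. }
  assert (Coord : forall c : R3 -> R, (forall p q, c (vadd p q) = c p + c q) ->
    (forall p q, c (vsub p q) = c p - c q) -> (forall r p, c (vscale r p) = r * c p) ->
    tends0 (fun n => Rabs (c (a n)))).
  { intros c H1 H2 H3 e He.
    destruct (Seq (fun n => RtoC (c (a n)))) with (e := e) as (N & HN); [|exact He|].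
    - intros n. rewrite (Rec n) at 1. rewrite H1, H2, !H3.
      rewrite RtoC_plus, RtoC_minus, !RtoC_mult. reflexivity.
    - exists N. intros n Hn. specialize (HN n Hn). rewrite Cmod_R in HN. exact HN. }
  intros e He.
  destruct (Coord c1) with (e := e) as (N1' & HN1); [intros; vec..|exact He|].
  destruct (Coord c2) with (e := e) as (N2' & HN2); [intros; vec..|exact He|].
  destruct (Coord c3) with (e := e) as (N3' & HN3); [intros; vec..|exact He|].
  exists (N1' + N2' + N3')%nat. intros n Hn. apply nrm_lt.
  repeat split; [apply HN1|apply HN2|apply HN3]; lia.
Qed.

Definition mvn (M : mat3) (n : nat) (v : R3) : R3 := Nat.iter n (mv M) v.

Lemma mvn_minvn (M : mat3) (n : nat) (v : R3) : detZ M <> 0%Z ->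
  mvn M n (Nat.iter n (minv M) v) = v /\ Nat.iter n (minv M) (mvn M n v) = v.
Proof.
  intros Hd. unfold mvn. revert v. induction n as [|n IH]; intros v; [split; reflexivity|].
  split.
  - rewrite (Nat.iter_succ_r n R3 (minv M)). simpl. rewrite (proj1 (IH (minv M v))).
    apply mv_minv, Hd.
  - rewrite (Nat.iter_succ_r n R3 (mv M)). simpl. rewrite (proj2 (IH (mv M v))).
    apply minv_mv, Hd.
Qed.

Lemma mvn_expands (M : mat3) (K e : R) : expanding M -> 0 < e ->
  exists n, forall v, nrm (mvn M n v) <= K -> nrm v < e.
Proof.
  intros HM He. pose proof (expanding_det M HM) as Hd.
  (* [K] carries no sign, so a positive majorant is used; the 3 in the denominators below
     distributes [e] over the three basis vectors. *)
  set (K' := Rabs K + 1). assert (HK' : 0 < K') by (unfold K'; pose proof (Rabs_pos K); lra).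
  assert (He' : 0 < e / (3 * K')) by (apply Rdiv_lt_0_compat; lra).
  destruct (minv_iter_tends0 M (1, 0, 0) HM _ He') as (A & HA).
  destruct (minv_iter_tends0 M (0, 1, 0) HM _ He') as (B & HB).
  destruct (minv_iter_tends0 M (0, 0, 1) HM _ He') as (D & HD).
  set (n := (A + B + D)%nat). exists n. intros v Hv.
  specialize (HA n ltac:(unfold n; lia)). specialize (HB n ltac:(unfold n; lia)).
  specialize (HD n ltac:(unfold n; lia)).
  rewrite <- (proj2 (mvn_minvn M n v Hd)). set (w := mvn M n v) in *.
  assert (Lin : Nat.iter n (minv M) w =
    vadd (vscale (c1 w) (Nat.iter n (minv M) (1, 0, 0)))
      (vadd (vscale (c2 w) (Nat.iter n (minv M) (0, 1, 0)))
            (vscale (c3 w) (Nat.iter n (minv M) (0, 0, 1))))).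
  { generalize n. intros k. induction k as [|k IH].
    - simpl. clearbody w. clear. vec.
    - simpl. rewrite IH, minv_lin. reflexivity. }
  rewrite Lin. destruct (nrm_coord w) as (C1 & C2 & C3).
  assert (Kw : K < K') by (unfold K'; pose proof (Rle_abs K); lra).
  assert (P : forall x u, Rabs x <= nrm w -> nrm u < e / (3 * K') -> nrm (vscale x u) < e / 3).
  { intros x u Hx Hu. rewrite nrm_scale. pose proof (nrm_pos u). pose proof (Rabs_pos x).
    assert (Rabs x * nrm u <= K' * nrm u) by (apply Rmult_le_compat_r; lra).
    assert (Q : K' * nrm u < K' * (e / (3 * K'))) by (apply Rmult_lt_compat_l; lra).
    replace (K' * (e / (3 * K'))) with (e / 3) in Q by (field; lra). lra. }
  eapply Rle_lt_trans; [apply nrm_add|].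
  eapply Rle_lt_trans; [apply Rplus_le_compat_l, nrm_add|].
  pose proof (P _ _ C1 HA). pose proof (P _ _ C2 HB). pose proof (P _ _ C3 HD). lra.
Qed.

Lemma mv_vadd (M : mat3) (p q : R3) : mv M (vadd p q) = vadd (mv M p) (mv M q).
Proof. vec. Qed.

Lemma mv_vsub (M : mat3) (p q : R3) : mv M (vsub p q) = vsub (mv M p) (mv M q).
Proof. vec. Qed.

Lemma mvn_vsub (M : mat3) (n : nat) (p q : R3) :
  mvn M n (vsub p q) = vsub (mvn M n p) (mvn M n q).
Proof. unfold mvn. induction n as [|n IH]; simpl; [reflexivity|]. rewrite IH. apply mv_vsub. Qed.

Lemma mvn_int3 (M : mat3) (n : nat) (p : R3) : int3 p -> int3 (mvn M n p).
Proof. intros H. unfold mvn. induction n as [|n IH]; simpl; [exact H|]. apply int3_mv, IH. Qed.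

(** * Self-affine tiles *)

Lemma vsub_vadd_l (p q : R3) : vsub (vadd p q) q = p.
Proof. vec. Qed.

Lemma int3_approx (q : R3) : exists z, int3 z /\ nrm (vsub q z) <= 1.
Proof.
  destruct q as [[x y] w].
  exists (IZR (Int_part x), IZR (Int_part y), IZR (Int_part w)). split; [eexists _, _, _; reflexivity|].
  apply nrm_le. cbv [vsub c1 c2 c3 fst snd].
  pose proof (base_Int_part x). pose proof (base_Int_part y). pose proof (base_Int_part w).
  repeat split; apply Rabs_le; lra.
Qed.

Section SelfAffine.
Variables (M : mat3) (k : nat -> R3) (T : R3 -> Prop) (K : R) (t0 : R3).
Let m : nat := Z.to_nat (Z.abs (detZ M)).
Hypothesis M_exp : expanding M.
Hypothesis k_digits : digit_system M k.
Hypothesis T_closed : closed3 T.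
Hypothesis T_bound : forall x, T x -> nrm x <= K.
Hypothesis T_t0 : T t0.
Hypothesis T_eq : forall y, T y <-> exists j, (j < m)%nat /\ T (vsub (mv M y) (k j)).

(* The radix sums [k_{j_{n-1}} + M k_{j_{n-2}} + ... + M^(n-1) k_{j_0}]. *)
Fixpoint radix (n : nat) (w : R3) : Prop :=
  match n with
  | O => w = (0, 0, 0)
  | S n => exists w0 j, radix n w0 /\ (j < m)%nat /\ w = vadd (mv M w0) (k j)
  end.

Lemma digit_count_pos : (0 < m)%nat.
Proof. pose proof (expanding_det M M_exp). unfold m. lia. Qed.

Lemma radix_int (n : nat) (w w' : R3) : radix n w -> radix n w' -> int3 (vsub w w').
Proof.
  revert w w'. induction n as [|n IH]; intros w w' H H'.
  - simpl in *. subst. exists 0%Z, 0%Z, 0%Z. clear. vec.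
  - destruct H as (v & j & Hv & Hj & ->), H' as (v' & j' & Hv' & Hj' & ->).
    destruct k_digits as (D1 & _ & _).
    replace (vsub (vadd (mv M v) (k j)) (vadd (mv M v') (k j'))) with
      (vadd (mv M (vsub v v')) (vsub (vsub (k j) (k O)) (vsub (k j') (k O)))).
    + apply int3_vadd; [apply int3_mv, IH; assumption|].
      apply int3_vsub; apply D1; assumption.
    + rewrite mv_vsub. generalize (mv M v) (mv M v') (k j) (k j') (k O). clear. intros. vec.
Qed.

(** Modulo [M] the last digits must agree; they cancel, and injectivity of [M] shortens both sums by
    one digit. *)
Lemma radix_distinct (n : nat) (w w' z : R3) :
  radix n w -> radix n w' -> int3 z -> vsub w w' = mvn M n z -> z = (0, 0, 0).
Proof.
  revert w w'. induction n as [|n IH]; intros w w' H H' Hz E.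
  - simpl in H, H'. rewrite H, H', vsub_diag in E. symmetry. exact E.
  - destruct H as (v & j & Hv & Hj & ->), H' as (v' & j' & Hv' & Hj' & ->).
    destruct k_digits as (_ & D2 & _).
    change (mvn M (S n) z) with (mv M (mvn M n z)) in E.
    assert (J : j = j').
    { apply D2; [exact Hj|exact Hj'|]. exists (vsub (mvn M n z) (vsub v v')).
      split; [apply int3_vsub; [apply mvn_int3, Hz|apply (radix_int n); assumption]|].
      rewrite !mv_vsub, <- E. generalize (mv M v) (mv M v') (k j) (k j'). clear. intros. vec. }
    subst j'. apply (IH v v' Hv Hv' Hz).
    pose proof (minv_mv M (expanding_det M M_exp)) as I.
    rewrite <- (I (vsub v v')), <- (I (mvn M n z)), <- E, mv_vsub. f_equal.
    generalize (mv M v) (mv M v') (k j). clear. intros. vec.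
Qed.

(** Stated for any [S] covered by its own contracted copies, so that it applies to [T] and to the
    test sets of [attractor_contains]. *)
Lemma orbit_radix (S : R3 -> Prop) (y : R3) (n : nat) :
  (forall y, S y -> exists j, (j < m)%nat /\ S (vsub (mv M y) (k j))) -> S y ->
  exists w, radix n w /\ S (vsub (mvn M n y) w).
Proof.
  intros HS Hy. induction n as [|n (w & Hw & Sw)].
  - exists (0, 0, 0). split; [reflexivity|].
    change (mvn M 0 y) with y. replace (vsub y (0, 0, 0)) with y; [exact Hy|]. clear. vec.
  - destruct (HS _ Sw) as (j & Hj & Sj). exists (vadd (mv M w) (k j)).
    split; [exists w, j; auto|].
    change (mvn M (Datatypes.S n) y) with (mv M (mvn M n y)).
    rewrite mv_vsub in Sj.
    replace (vsub (mv M (mvn M n y)) (vadd (mv M w) (k j))) with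
      (vsub (vsub (mv M (mvn M n y)) (mv M w)) (k j)); [exact Sj|].
    generalize (mv M (mvn M n y)) (mv M w) (k j). clear. intros. vec.
Qed.

Lemma T_radix (y : R3) (n : nat) : T y -> exists w, radix n w /\ T (vsub (mvn M n y) w).
Proof. apply orbit_radix. intros; apply T_eq; assumption. Qed.

Lemma radix_T (y w : R3) (n : nat) : radix n w -> T (vsub (mvn M n y) w) -> T y.
Proof.
  revert w. induction n as [|n IH]; intros w Hw Tw.
  - simpl in *. subst w. replace y with (vsub y (0, 0, 0)); [exact Tw|]. clear. vec.
  - destruct Hw as (w0 & j & Hw0 & Hj & ->). apply (IH w0 Hw0). apply T_eq. exists j.
    split; [exact Hj|]. change (mvn M (S n) y) with (mv M (mvn M n y)) in Tw.
    rewrite mv_vsub.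
    replace (vsub (vsub (mv M (mvn M n y)) (mv M w0)) (k j)) with
      (vsub (mv M (mvn M n y)) (vadd (mv M w0) (k j))); [exact Tw|].
    generalize (mv M (mvn M n y)) (mv M w0) (k j). clear. intros. vec.
Qed.

Lemma mvn_preimage (n : nat) (q : R3) : exists x, mvn M n x = q.
Proof. exists (Nat.iter n (minv M) q). apply mvn_minvn, expanding_det, M_exp. Qed.

(* A translate of [T] meeting the interior of [T] would, after magnification by [M^n],
   be covered by translates [T + w] with [w] in another residue class; but its copy of
   [x0] lies in no other translate. *)
Lemma unique_point_disjoint (x0 : R3) :
  T x0 -> (forall z, int3 z -> z <> (0, 0, 0) -> ~ T (vsub x0 z)) ->
  forall x z, interior3 T x -> int3 z -> z <> (0, 0, 0) -> ~ T (vsub x z).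
Proof.
  intros Tx0 Hx0 x z Ix Iz Nz Txz.
  apply interior3_nrm in Ix. destruct Ix as (e & He & Hb).
  destruct (mvn_expands M (K + K) e M_exp He) as (n & Hn).
  destruct (T_radix _ n Txz) as (w' & Hw' & Tw').
  destruct (mvn_preimage n (vadd x0 (vadd w' (mvn M n z)))) as (x1 & Hx1).
  assert (Tx1 : T x1).
  { apply Hb. apply Hn. rewrite mvn_vsub, Hx1.
    replace (vsub (mvn M n x) (vadd x0 (vadd w' (mvn M n z)))) with
      (vsub (vsub (mvn M n (vsub x z)) w') x0).
    - eapply Rle_trans; [apply nrm_sub|]. pose proof (T_bound _ Tw').
      pose proof (T_bound _ Tx0). lra.
    - rewrite mvn_vsub. generalize (mvn M n x) (mvn M n z). clear. intros. vec. }
  destruct (T_radix _ n Tx1) as (w & Hw & Tw). rewrite Hx1 in Tw.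
  replace (vsub (vadd x0 (vadd w' (mvn M n z))) w) with
    (vsub x0 (vsub (vsub w w') (mvn M n z))) in Tw
    by (generalize (mvn M n z); clear; intros; vec).
  apply NNPP. intros _. apply Nz. apply (radix_distinct n w w' z Hw Hw' Iz).
  apply NNPP. intros N. apply (Hx0 (vsub (vsub w w') (mvn M n z))); [| |exact Tw].
  - apply int3_vsub; [apply (radix_int n); assumption|apply mvn_int3, Iz].
  - intros E. apply N, vsub_eq0, E.
Qed.

(** After [n] expansions [y] differs from a radix sum by a bounded vector. The point of [T] with the
    same radix sum and tail [t0] is then as close to [y] as desired, and [T] is closed. *)
Lemma attractor_contains (S : R3 -> Prop) (B : R) :
  (forall x, S x -> nrm x <= B) ->
  (forall y, S y -> exists j, (j < m)%nat /\ S (vsub (mv M y) (k j))) ->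
  forall y, S y -> T y.
Proof.
  intros SB HS y Sy. apply NNPP. intros N.
  destruct (T_closed y N) as (e & He & H).
  destruct (mvn_expands M (B + K) e M_exp He) as (n & Hn).
  destruct (orbit_radix S y n HS Sy) as (w & Hw & Sw).
  destruct (mvn_preimage n (vadd t0 w)) as (x & Hx).
  apply (H x).
  - apply Hn. rewrite mvn_vsub, Hx.
    replace (vsub (mvn M n y) (vadd t0 w)) with (vsub (vsub (mvn M n y) w) t0).
    + eapply Rle_trans; [apply nrm_sub|]. pose proof (SB _ Sw). pose proof (T_bound _ T_t0). lra.
    + generalize (mvn M n y) t0. clear. intros. vec.
  - apply (radix_T x w n Hw). rewrite Hx, vsub_vadd_l. exact T_t0.
Qed.

(** Radix sums of length [n] represent all residues modulo [M^n]. Digits need not be integral, so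
    everything is measured from the sum [w0] with all digits [k 0]. *)
Lemma radix_complete (n : nat) : exists w0, radix n w0 /\
  forall z, int3 z -> exists z' w, int3 z' /\ radix n w /\ vadd z w0 = vadd (mvn M n z') w.
Proof.
  induction n as [|n (w0 & Hw0 & IH)].
  - exists (0, 0, 0). split; [reflexivity|]. intros z Iz. exists z, (0, 0, 0).
    split; [exact Iz|]. split; reflexivity.
  - exists (vadd (mv M w0) (k O)). split; [exists w0, O; auto using digit_count_pos|].
    intros z Iz. destruct k_digits as (_ & _ & D3).
    destruct (D3 z Iz) as (j & Hj & z1 & Iz1 & Ez1).
    destruct (IH z1 Iz1) as (z' & w & Iz' & Hw & E).
    exists z', (vadd (mv M w) (k j)). split; [exact Iz'|]. split; [exists w, j; auto|].
    change (mvn M (S n) z') with (mv M (mvn M n z')).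
    replace (vadd (mv M (mvn M n z')) (vadd (mv M w) (k j))) with
      (vadd (vadd (mv M (mvn M n z')) (mv M w)) (k j))
      by (generalize (mv M (mvn M n z')) (mv M w) (k j); clear; intros; vec).
    rewrite <- mv_vadd, <- E, mv_vadd, <- Ez1.
    generalize (mv M w0) (k j) (k O). clear. intros. vec.
Qed.

(** The preimages under [M^n] of the points [z + w0 + t0] lie in translates of [T] and become
    arbitrarily dense; local finiteness and closedness then catch [x] itself. *)
Lemma self_affine_cover (x : R3) : exists z, int3 z /\ T (vsub x z).
Proof.
  apply NNPP. intros N.
  destruct (int3_finite (nrm x + 1 + K)) as (l & Hl).
  destruct (closed3_list T T_closed (filter (fun z => if excluded_middle_informative
    (int3 z) then true else false) l) x) as (e & He & H).
  { intros z Hz. apply filter_In in Hz. destruct Hz as [_ Hz].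
    destruct excluded_middle_informative as [Iz|]; [|discriminate].
    intros HT. apply N. exists z. auto. }
  destruct (mvn_expands M 1 (Rmin 1 e) M_exp) as (n & Hn); [apply Rmin_pos; lra|].
  destruct (radix_complete n) as (w0 & Hw0 & C).
  destruct (int3_approx (vsub (vsub (mvn M n x) w0) t0)) as (z & Iz & Lz).
  destruct (C z Iz) as (z' & w & Iz' & Hw & E).
  destruct (mvn_preimage n (vadd (vadd z w0) t0)) as (y & Hy).
  assert (Ty : T (vsub y z')).
  { apply (radix_T _ w n Hw). rewrite mvn_vsub, Hy, E.
    replace (vsub (vsub (vadd (vadd (mvn M n z') w) t0) (mvn M n z')) w) with t0; [exact T_t0|].
    generalize (mvn M n z') t0; clear; intros; vec. }
  assert (Ly : nrm (vsub x y) < Rmin 1 e).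
  { apply Hn. rewrite mvn_vsub, Hy.
    replace (vsub (mvn M n x) (vadd (vadd z w0) t0)) with
      (vsub (vsub (vsub (mvn M n x) w0) t0) z); [exact Lz|].
    generalize (mvn M n x) t0; clear; intros; vec. }
  pose proof (Rmin_l 1 e). pose proof (Rmin_r 1 e).
  apply (H z' y); [|lra|exact Ty]. apply filter_In. split.
  - apply Hl; [exact Iz'|]. pose proof (T_bound _ Ty).
    assert (nrm z' <= nrm y + nrm (vsub y z')).
    { replace z' with (vsub y (vsub y z')) at 1; [apply nrm_sub|clear; vec]. }
    assert (nrm y <= nrm x + nrm (vsub x y)).
    { replace y with (vsub x (vsub x y)) at 1; [apply nrm_sub|clear; vec]. }
    lra.
  - destruct excluded_middle_informative; [reflexivity|contradiction].
Qed.

(* Chains are refined by pulling them back along the maps [M^-1 (x + k_j)], whose images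
   of [T] share the point [p]. *)
Lemma common_point_chain_connected (p : R3) :
  (forall j, (j < m)%nat -> T (vsub (mv M p) (k j))) -> chain_connected T.
Proof.
  intros Hp e x y He.
  destruct (mvn_expands M (K + K) e M_exp He) as (n & Hn).
  (* Steps are measured after [n] magnifications, so the contractions carry steps of level [n] to
     steps of level [n + 1]. *)
  set (st := fun n u v => T u /\ T v /\ nrm (mvn M n (vsub u v)) <= K + K).
  assert (Ch : forall n x y, T x -> T y -> clos_refl_trans R3 (st n) x y).
  { clear x y n Hn. induction n as [|n IH]; intros x y Hx Hy.
    - apply rt_step. repeat split; auto. simpl. eapply Rle_trans; [apply nrm_sub|].
      pose proof (T_bound _ Hx). pose proof (T_bound _ Hy). lra.
    - assert (P : forall j u, (j < m)%nat -> T (vsub (mv M u) (k j)) ->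
        clos_refl_trans R3 (st (S n)) u p /\ clos_refl_trans R3 (st (S n)) p u).
      { intros j u Hj Hu.
        pose proof (minv_mv M (expanding_det M M_exp)) as I.
        pose proof (mv_minv M (expanding_det M M_exp)) as I'.
        set (f := fun v => minv M (vadd v (k j))).
        assert (F : forall v, f (vsub (mv M v) (k j)) = v).
        { intros v. unfold f. replace (vadd (vsub (mv M v) (k j)) (k j)) with (mv M v);
            [apply I|]. generalize (mv M v) (k j); clear; intros; vec. }
        assert (L : forall a b, clos_refl_trans R3 (st n) a b ->
          clos_refl_trans R3 (st (S n)) (f a) (f b)).
        { intros a b H. induction H as [a b (Ha & Hb & Hab)|a|a b c _ IH1 _ IH2].
          - assert (FT : forall v, T v -> T (f v)).
            { intros v Hv. apply T_eq. exists j. split; [exact Hj|]. unfold f.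
              rewrite I', vsub_vadd_l. exact Hv. }
            apply rt_step. repeat split; [apply FT, Ha|apply FT, Hb|].
            unfold mvn. rewrite Nat.iter_succ_r. unfold f. rewrite mv_vsub, !I'.
            replace (vsub (vadd a (k j)) (vadd b (k j))) with (vsub a b); [exact Hab|].
            generalize (k j); clear; intros; vec.
          - apply rt_refl.
          - eapply rt_trans; eassumption. }
        rewrite <- (F u), <- (F p). split; apply L, IH; auto. }
      apply T_eq in Hx. destruct Hx as (i & Hi & Hx).
      apply T_eq in Hy. destruct Hy as (j & Hj & Hy).
      apply rt_trans with p; [apply (P i x Hi Hx)|apply (P j y Hj Hy)]. }
  intros Hx Hy. apply clos_rt_rtn1.
  assert (Sub : forall u v, clos_refl_trans R3 (st n) u v -> clos_refl_trans R3 (hstep e T) u v).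
  { intros u v H. induction H as [u v (Hu & Hv & Huv)|u|u w v _ IH1 _ IH2].
    - apply rt_step. repeat split; auto.
    - apply rt_refl.
    - eapply rt_trans; eassumption. }
  apply Sub, Ch; assumption.
Qed.

End SelfAffine.

(** * Symmetric tiles of a lattice tiling *)

Lemma avoid_translates (T : R3 -> Prop) (l : list R3) (x : R3) :
  closed3 T -> interior3 T x ->
  (forall z, In z l -> forall y, interior3 T y -> ~ interior3 (translate T z) y) ->
  exists x' e, 0 < e /\
    forall y, nrm (vsub x' y) < e -> T y /\ forall z, In z l -> ~ T (vsub y z).
Proof.
  intros Tc Ix. induction l as [|z l IH]; intros Hd.
  - apply interior3_nrm in Ix. destruct Ix as (e & He & Hb).
    exists x, e. split; [exact He|]. intros y Hy. split; [apply Hb, Hy|]. intros z [].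
  - destruct IH as (x1 & e & He & Hb); [intros; apply Hd; [right|]; assumption|].
    (* If [T + z] filled the current ball, the ball would be interior to both tiles. *)
    assert (Ey : exists y, nrm (vsub x1 y) < e /\ ~ T (vsub y z)).
    { apply NNPP. intros N. apply (Hd z (or_introl eq_refl) x1).
      - apply interior3_nrm. exists e. split; [exact He|]. intros y Hy. apply Hb, Hy.
      - apply interior3_nrm. exists e. split; [exact He|]. intros y Hy. apply NNPP. intros N'.
        apply N. exists y. auto. }
    destruct Ey as (y & Hy & Ny). destruct (Tc _ Ny) as (e' & He' & H').
    exists y, (Rmin e' (e - nrm (vsub x1 y))). split; [apply Rmin_pos; lra|].
    pose proof (Rmin_l e' (e - nrm (vsub x1 y))). pose proof (Rmin_r e' (e - nrm (vsub x1 y))).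
    intros w Hw. pose proof (nrm_sub_triang x1 y w).
    destruct (Hb w) as [Tw Nw]; [lra|]. split; [exact Tw|].
    intros z' [<-|Hz']; [|apply Nw, Hz']. apply H'.
    replace (vsub (vsub y z) (vsub w z)) with (vsub y w) by vec. lra.
Qed.

(** Only translates with [nrm z <= K + K] can meet [T], so a finite shrinking of balls suffices.
    This yields the seed that [unique_point_disjoint] spreads to the whole interior. *)
Lemma tiling_unique_point (T : R3 -> Prop) (K : R) (x : R3) :
  closed3 T -> (forall x, T x -> nrm x <= K) -> lattice_tiling T -> interior3 T x ->
  exists x0, T x0 /\ forall z, int3 z -> z <> (0, 0, 0) -> ~ T (vsub x0 z).
Proof.
  intros Tc Tb (_ & Td) Ix.
  destruct (int3_finite (K + K)) as (l & Hl).
  destruct (avoid_translates T (filter (fun z => if excluded_middle_informative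
    (int3 z /\ z <> (0, 0, 0)) then true else false) l) x Tc Ix) as (x0 & e & He & H).
  - intros z Hz y I1 I2. apply filter_In in Hz. destruct Hz as [_ Hz].
    destruct excluded_middle_informative as [[Iz Nz]|]; [|discriminate].
    apply (Td (0, 0, 0) z) with (x := y); auto.
    + exists 0%Z, 0%Z, 0%Z. reflexivity.
    + apply (interior3_incl T); [|exact I1]. intros w Hw. unfold translate.
      replace (vsub w (0, 0, 0)) with w by vec. exact Hw.
  - destruct (H x0) as [T0 N0]; [rewrite nrm_self; exact He|].
    exists x0. split; [exact T0|]. intros z Iz Nz Tz. apply (N0 z); [|exact Tz].
    apply filter_In. split.
    + apply Hl; [exact Iz|]. pose proof (Tb _ T0). pose proof (Tb _ Tz).
      replace z with (vsub x0 (vsub x0 z)) by vec.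
      eapply Rle_trans; [apply nrm_sub|]. lra.
    + destruct excluded_middle_informative as [|N]; [reflexivity|tauto].
Qed.

Theorem symmetric_tile_not_simply_connected (T : R3 -> Prop) (c : R3) :
  self_affine_lattice_tile T -> connected3 T -> lattice_tiling T ->
  (forall x, T x <-> T (vsub (vscale 2 c) x)) ->
  ~ interior3 T c -> ~ simply_connected (interior3 T).
Proof.
  intros (M & k & HM & Hk & Tcomp & (t0 & Tt0) & Teq) Tconn Ttil Tsym Tc SC.
  destruct (compact_bounded T Tcomp) as (K & TK).
  pose proof (compact_closed T Tcomp) as Tcl.
  pose proof (connected_chain_connected T Tconn) as Tcc.
  (* The interior point comes from the supposed simple connectedness, which includes
     nonemptiness. *)
  pose proof SC as [[x Ix] _].
  destruct (tiling_unique_point T K x Tcl TK Ttil Ix) as (x0 & Tx0 & Hx0).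
  assert (Tdisj := unique_point_disjoint M k T K HM Hk TK Teq x0 Tx0 Hx0).
  apply (not_simply_connected (interior3 T) c K); auto.
  - apply interior3_open.
  - intros y. apply interior3_refl. intros w. apply (Tsym w).
  - intros y Hy. apply TK, interior3_sub, Hy.
  - apply (covering_far_chain T K); auto. apply Ttil.
Qed.

(** * Twindragons *)

Definition kd (j : nat) : R3 := match j with O => vscale (-1) half_e1 | _ => half_e1 end.

Lemma detZ_M_ab (a b : Z) : detZ (M_ab a b) = 2%Z.
Proof. unfold detZ, det3, M_ab; simpl. lia. Qed.

(** The imaginary part of the characteristic equation factors as [y] times a quadratic: either the
    root is real or [y^2] is explicit in [x], and the real part becomes a polynomial condition on
    [x] alone. *)
Lemma M_ab_expanding (a b : Z) :
  (a, b) = (0%Z, 1%Z) \/ (a, b) = (2%Z, (-2)%Z) -> expanding (M_ab a b).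
Proof.
  intros Hab [x y] H. apply eigenvalue_charpoly in H. rewrite detZ_M_ab in H.
  replace (trZ (M_ab a b)) with a in H by (unfold trZ, M_ab; simpl; lia).
  replace (minorsZ (M_ab a b)) with (- b)%Z in H by (unfold minorsZ, M_ab; simpl; lia).
  apply Rnot_le_lt. intros L.
  assert (N : x * x + y * y <= 1).
  { unfold Cmod in L; simpl in L. rewrite !Rmult_1_r in L.
    apply sqrt_le_0; [nra|lra|]. rewrite sqrt_1. exact L. }
  unfold RtoC, Cminus, Cplus, Cmult, Copp in H; simpl in H.
  injection H; intros E2 E1; clear H L.
  destruct Hab as [E|E]; injection E; intros -> ->; simpl in E1, E2.
  - assert (I : y * (3 * (x * x) - y * y - 1) = 0) by lra.
    assert (Re : x * (x * x - 3 * (y * y) - 1) = 2) by lra. clear E1 E2.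
    apply Rmult_integral in I. destruct I as [->|I].
    + assert (-1 <= x <= 1) by (split; nra).
      assert (0 <= (1 + x) * (1 - x * x)) by (apply Rmult_le_pos; lra).
      pose proof (Rle_0_sqr x) as S. unfold Rsqr in S. lra.
    + assert (Y : y * y = 3 * (x * x) - 1) by lra. rewrite Y in *.
      assert (X : -1 < x < 1) by (split; nra). pose proof (Rle_0_sqr y) as S. unfold Rsqr in S.
      destruct (Rle_lt_dec 0 x).
      * assert (0 <= x * (x * x)) by (apply Rmult_le_pos; [lra|apply Rle_0_sqr]). lra.
      * assert (0 <= - x * (/ 2 - x * x)) by (apply Rmult_le_pos; lra). lra.
  - assert (I : y * (3 * (x * x) - y * y - 4 * x + 2) = 0) by lra.
    assert (Re : x * (x * x - 3 * (y * y)) - 2 * (x * x - y * y) + 2 * x - 2 = 0) by lra.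
    clear E1 E2. apply Rmult_integral in I. destruct I as [->|I].
    + assert (x <= 1) by nra.
      assert (0 <= (1 - x) * (x * x - x + 1)) by (apply Rmult_le_pos; nra). lra.
    + assert (Y : y * y = 3 * (x * x) - 4 * x + 2) by lra. rewrite Y in *.
      (* This is [x^2 + y^2 <= 1] after substituting [y^2]; it pins [x] to [1/2]. *)
      assert (S : (2 * x - 1) * (2 * x - 1) <= 0) by lra.
      assert (X : 2 * x - 1 = 0).
      { apply Rsqr_0_uniq. apply Rle_antisym; [exact S|apply Rle_0_sqr]. }
      assert (X' : x = / 2) by lra. rewrite X' in Re. lra.
Qed.

(** The image of Z^3 consists of the vectors with even first coordinate, so the residue is the
    parity of that coordinate. *)
Lemma kd_digit_system (a b : Z) : digit_system (M_ab a b) kd.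
Proof.
  unfold digit_system. rewrite detZ_M_ab. simpl (Z.to_nat _).
  assert (Par : forall w, int3 w -> forall s, c1 (mv (M_ab a b) w) = s -> s = 1 \/ s = -1 -> False).
  { intros w (p & q & r & ->) s Hs Hs'. unfold c1, mv, M_ab in Hs; simpl in Hs.
    assert (E : 2 * IZR r = s) by lra.
    destruct Hs' as [-> | ->]; rewrite <- mult_IZR in E; apply eq_IZR in E; lia. }
  split; [|split].
  - intros [|[|j]] Hj; [| |lia].
    + exists 0%Z, 0%Z, 0%Z. unfold kd, half_e1. vec.
    + exists 1%Z, 0%Z, 0%Z. unfold kd, half_e1. vec.
  - intros [|[|i]] [|[|j]] Hi Hj; try lia; intros (w & Iw & E); exfalso.
    + apply (Par w Iw (-1)); [|right; reflexivity]. rewrite <- E. unfold kd, half_e1. vec.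
    + apply (Par w Iw 1); [|left; reflexivity]. rewrite <- E. unfold kd, half_e1. vec.
  - intros z (p & q & r & ->).
    exists (if Z.odd p then 1%nat else 0%nat). split; [destruct (Z.odd p); lia|].
    set (h := Z.div2 p).
    exists (IZR (q - b * h), IZR (r - a * h), IZR h). split; [eexists _, _, _; reflexivity|].
    pose proof (Z.div2_odd p) as Ep. fold h in Ep.
    rewrite !minus_IZR, !mult_IZR.
    assert (Ep' : IZR p = 2 * IZR h + (if Z.odd p then 1 else 0)).
    { rewrite Ep at 1. rewrite plus_IZR, mult_IZR. destruct (Z.odd p); simpl; lra. }
    destruct (Z.odd p); unfold kd, half_e1, M_ab; vec; simpl; lra.
Qed.

(** * Integer certificates for twindragons *)

Definition Z3 : Type := (Z * Z * Z)%type.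

Definition toR3 (t : Z3) : R3 := let '(x, y, z) := t in (IZR x, IZR y, IZR z).

(** One map serves two dynamics: with [s = 1] or [-1] it expands the point [t / 2], and with [s] in
    [{-1, 0, 1}] the difference of two orbits, [s] being the difference of their digits. *)
Definition child (a b : Z) (t : Z3) (s : Z) : Z3 :=
  let '(x, y, z) := t in (2 * z + s, x + b * z, y + a * z)%Z.

Lemma toR3_child (a b : Z) (t : Z3) (s : Z) :
  toR3 (child a b t s) = vadd (mv (M_ab a b) (toR3 t)) (IZR s, 0, 0).
Proof.
  destruct t as [[x y] z]. unfold toR3, child, mv, M_ab, vadd.
  cbn [m11 m12 m13 m21 m22 m23 m31 m32 m33].
  rewrite !plus_IZR, !mult_IZR. vec.
Qed.

Definition eqb3 (t u : Z3) : bool :=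
  let '(x, y, z) := t in let '(x', y', z') := u in
  ((x =? x') && (y =? y') && (z =? z'))%Z.

Lemma eqb3_eq (t u : Z3) : eqb3 t u = true -> t = u.
Proof.
  destruct t as [[x y] z], u as [[x' y'] z']. unfold eqb3. intros H.
  apply andb_prop in H. destruct H as [H H3]. apply andb_prop in H. destruct H as [H1 H2].
  apply Z.eqb_eq in H1, H2, H3. congruence.
Qed.

(** The bounds leave room above 13, 39/5 and 13/5, which the bound 13/5 on third coordinates and
    [|a|, |b| <= 2] give for differences in [T - T]. *)
Definition inbox (t : Z3) : bool :=
  let '(x, y, z) := t in ((Z.abs x <=? 15) && (Z.abs y <=? 9) && (Z.abs z <=? 3))%Z.

Definition box : list Z3 := list_prod (list_prod (zrange 15) (zrange 9)) (zrange 3).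

Lemma inbox_In (t : Z3) : inbox t = true -> In t box.
Proof.
  destruct t as [[x y] z]. unfold inbox. intros H.
  apply andb_prop in H. destruct H as [H H3]. apply andb_prop in H. destruct H as [H1 H2].
  apply Z.leb_le in H1, H2, H3. repeat apply in_prod; apply In_zrange; simpl; lia.
Qed.

Lemma toR3_inbox (t : Z3) : Rabs (c1 (toR3 t)) <= 15 -> Rabs (c2 (toR3 t)) <= 9 ->
  Rabs (c3 (toR3 t)) <= 3 -> inbox t = true.
Proof.
  destruct t as [[x y] z]. unfold toR3, c1, c2, c3; simpl. rewrite <- !abs_IZR.
  intros H1 H2 H3. apply le_IZR in H1, H2, H3.
  unfold inbox. repeat (apply andb_true_intro; split); apply Z.leb_le; assumption.
Qed.

(* [closed_list a b l] certifies that half of [l] lies in the twindragon. *)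
Definition closed_list (a b : Z) (l : list Z3) : bool :=
  forallb (fun t => inbox t && (existsb (eqb3 (child a b t 1)) l
                                || existsb (eqb3 (child a b t (-1))) l)) l.

(* [dies a b w t]: if the orbit of [x] has digits [w], then [x - t] has no orbit staying
   at a difference from it in the box. *)
Fixpoint dies (a b : Z) (w : list bool) (t : Z3) : bool :=
  match w with
  | nil => false
  | j :: w' =>
      let ok u := if inbox u then dies a b w' u else true in
      ok (child a b t 0) && ok (child a b t (if j then (-1)%Z else 1%Z))
  end.

Definition kills (a b : Z) (w : list bool) : bool :=
  forallb (fun t => eqb3 t (0, 0, 0)%Z || dies a b w t) box.

Section Twindragon.
Variables (a b : Z) (T : R3 -> Prop) (K : R) (t0 : R3).
Let M := M_ab a b.
Hypothesis M_exp : expanding M.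
Hypothesis T_closed : closed3 T.
Hypothesis T_bound : forall x, T x -> nrm x <= K.
Hypothesis T_t0 : T t0.
Hypothesis T_twin : twindragon_eq a b T.

Lemma vsub_kd0 (p : R3) : vsub p (kd 0) = vadd p half_e1.
Proof. unfold kd, half_e1. vec. Qed.

Lemma twin_eq (y : R3) : T y <->
  exists j, (j < Z.to_nat (Z.abs (detZ M)))%nat /\ T (vsub (mv M y) (kd j)).
Proof.
  unfold M. rewrite detZ_M_ab. simpl (Z.to_nat _). rewrite (T_twin y). split.
  - intros [H|H]; [exists O|exists 1%nat]; (split; [lia|]); [rewrite vsub_kd0|]; exact H.
  - intros ([|[|j]] & Hj & H); [left|right|lia]; [rewrite vsub_kd0 in H|]; exact H.
Qed.

Lemma twin_contains (S : R3 -> Prop) (B : R) :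
  (forall x, S x -> nrm x <= B) ->
  (forall y, S y -> S (vadd (mv M y) half_e1) \/ S (vsub (mv M y) half_e1)) ->
  forall y, S y -> T y.
Proof.
  intros SB HS. apply (attractor_contains M kd T K t0 M_exp T_closed T_bound T_t0 twin_eq S B SB).
  intros y Hy. unfold M at 1. rewrite detZ_M_ab. simpl (Z.to_nat _).
  destruct (HS y Hy) as [H|H]; [exists O|exists 1%nat]; (split; [lia|]); [rewrite vsub_kd0|]; exact H.
Qed.

(** Reflection exchanges the two digits, so the reflected set obeys the same equation and lies in
    the attractor. *)
Lemma twin_refl (x : R3) : T x -> T (refl (0, 0, 0) x).
Proof.
  intros Hx. apply (twin_contains (fun y => T (refl (0, 0, 0) y)) K).
  - intros y Hy. apply T_bound in Hy.
    replace (refl (0, 0, 0) y) with (vscale (-1) y) in Hy by (unfold refl; clear; vec).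
    rewrite nrm_scale, Rabs_left in Hy by lra. lra.
  - intros y Hy. apply T_twin in Hy. fold M in Hy. destruct Hy as [Hy|Hy]; [right|left].
    + replace (refl (0, 0, 0) (vsub (mv M y) half_e1)) with
        (vadd (mv M (refl (0, 0, 0) y)) half_e1); [exact Hy|].
      unfold refl, half_e1. clear. vec.
    + replace (refl (0, 0, 0) (vadd (mv M y) half_e1)) with
        (vsub (mv M (refl (0, 0, 0) y)) half_e1); [exact Hy|].
      unfold refl, half_e1. clear. vec.
  - rewrite refl_refl. exact Hx.
Qed.

Lemma twin_half (l : list Z3) (t : Z3) :
  closed_list a b l = true -> In t l -> T (vscale (/ 2) (toR3 t)).
Proof.
  intros Hl Ht. unfold closed_list in Hl. rewrite forallb_forall in Hl.
  apply (twin_contains (fun y => exists t, In t l /\ y = vscale (/ 2) (toR3 t)) 15).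
  - intros x (u & Hu & ->). specialize (Hl u Hu). apply andb_prop in Hl. destruct Hl as [Hb _].
    rewrite nrm_scale, Rabs_right by lra.
    enough (nrm (toR3 u) <= 15) by lra. destruct u as [[x y] z]. unfold inbox in Hb.
    apply andb_prop in Hb. destruct Hb as [Hb H3]. apply andb_prop in Hb. destruct Hb as [H1 H2].
    apply Z.leb_le in H1, H2, H3. apply nrm_le. unfold toR3, c1, c2, c3; simpl.
    rewrite <- !abs_IZR. repeat split; apply IZR_le; lia.
  - intros y (u & Hu & ->). specialize (Hl u Hu). apply andb_prop in Hl. destruct Hl as [_ Hc].
    apply orb_prop in Hc. destruct Hc as [Hc|Hc]; [left|right];
      apply existsb_exists in Hc; destruct Hc as (v & Hv & E); apply eqb3_eq in E; subst v;
      eexists; (split; [exact Hv|]); rewrite toR3_child; fold M; unfold half_e1;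
      generalize (toR3 u); clear; intros; vec.
  - exists t. auto.
Qed.

Definition shift (y : R3) : R3 :=
  if excluded_middle_informative (T (vadd (mv M y) half_e1))
  then vadd (mv M y) half_e1 else vsub (mv M y) half_e1.

Lemma shift_T (y : R3) : T y -> T (shift y).
Proof.
  intros H. apply T_twin in H. unfold shift. destruct excluded_middle_informative as [|N]; tauto.
Qed.

Lemma shift_diff (x y : R3) : exists e, Rabs e <= 1 /\
  vsub (shift x) (shift y) = vadd (mv M (vsub x y)) (e, 0, 0).
Proof.
  unfold shift, half_e1. rewrite mv_vsub.
  generalize (mv M x) (mv M y). intros p q.
  destruct excluded_middle_informative, excluded_middle_informative;
    [exists 0|exists 1|exists (-1)|exists 0]; (split; [apply Rabs_le; lra|]); clear; vec.
Qed.

(* The third coordinates of the successive differences of two orbits satisfy the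
   recurrence of the characteristic polynomial up to errors of modulus at most 1. *)
Lemma difference_orbit (x y : R3) : T x -> T y ->
  exists z e : nat -> R, c3 (vsub x y) = z 0%nat /\ c2 (vsub x y) = z 1%nat - IZR a * z 0%nat /\
    c1 (vsub x y) = z 2%nat - IZR a * z 1%nat - IZR b * z 0%nat /\
    (forall i, Rabs (e i) <= 1) /\
    (forall i, exists x' y', T x' /\ T y' /\ z i = c3 (vsub x' y')) /\
    (forall i, z (S (S (S i))) = 2 * z i + e i + IZR b * z (S i) + IZR a * z (S (S i))).
Proof.
  intros Hx Hy.
  set (d := fun i => vsub (Nat.iter i shift x) (Nat.iter i shift y)).
  assert (Hd : forall i, exists e, Rabs e <= 1 /\ d (S i) = vadd (mv M (d i)) (e, 0, 0))
    by (intros i; apply shift_diff).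
  set (e := fun i => proj1_sig (constructive_indefinite_description _ (Hd i))).
  assert (He : forall i, Rabs (e i) <= 1 /\ d (S i) = vadd (mv M (d i)) (e i, 0, 0))
    by (intros i; unfold e; destruct constructive_indefinite_description; assumption).
  assert (Co : forall i, c1 (d (S i)) = 2 * c3 (d i) + e i /\
    c2 (d (S i)) = c1 (d i) + IZR b * c3 (d i) /\ c3 (d (S i)) = c2 (d i) + IZR a * c3 (d i)).
  { intros i. rewrite (proj2 (He i)). generalize (d i). clear. intros. unfold M, M_ab.
    repeat split; vec; simpl; ring. }
  exists (fun i => c3 (d i)), e.
  change (vsub x y) with (d O).
  split; [reflexivity|]. split; [|split; [|split; [|split]]].
  - pose proof (Co O). lra.
  - pose proof (Co O). pose proof (Co 1%nat). lra.
  - apply He.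
  - intros i. exists (Nat.iter i shift x), (Nat.iter i shift y).
    split; [|split; [|reflexivity]]; apply Nat.iter_invariant; auto using shift_T.
  - intros i. destruct (Co i) as (A1 & A2 & A3), (Co (S i)) as (B1 & B2 & B3),
      (Co (S (S i))) as (C1 & C2 & C3). rewrite C3, B2, A1. rewrite B3. lra.
Qed.

(** A bootstrap: boundedness of [T] gives a finite supremum [B], the recurrence improves it to
    [B <= th B + C], and this solves to an explicit bound. *)
Lemma difference_c3_bound (th C : R) : th < 1 ->
  (forall (z e : nat -> R) (B : R), (forall i, Rabs (e i) <= 1) ->
    (forall i, z (S (S (S i))) = 2 * z i + e i + IZR b * z (S i) + IZR a * z (S (S i))) ->
    (forall i, Rabs (z i) <= B) -> Rabs (z 0%nat) <= th * B + C) ->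
  forall x y, T x -> T y -> Rabs (c3 (vsub x y)) <= C / (1 - th).
Proof.
  intros Hth Hrec.
  destruct (completeness (fun r => exists x y, T x /\ T y /\ r = Rabs (c3 (vsub x y))))
    as (B & HB & HB').
  - exists (K + K). intros r (x & y & Hx & Hy & ->).
    pose proof (nrm_coord (vsub x y)) as (_ & _ & L). pose proof (nrm_sub x y).
    pose proof (T_bound _ Hx). pose proof (T_bound _ Hy). lra.
  - exists (Rabs (c3 (vsub t0 t0))), t0, t0. auto.
  - assert (L : B <= th * B + C).
    { apply HB'. intros r (x & y & Hx & Hy & ->).
      destruct (difference_orbit x y Hx Hy) as (z & e & E0 & _ & _ & He & Hz & Hr).
      rewrite E0. apply (Hrec z e B He Hr). intros i.
      destruct (Hz i) as (x' & y' & Hx' & Hy' & ->). apply HB. exists x', y'. auto. }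
    intros x y Hx Hy. apply Rle_trans with B.
    + apply HB. exists x, y. auto.
    + apply Rcomplements.Rle_div_r; lra.
Qed.

Hypothesis T_c3 : forall x y, T x -> T y -> Rabs (c3 (vsub x y)) <= 13 / 5.
Hypothesis ab_small : Rabs (IZR a) <= 2 /\ Rabs (IZR b) <= 2.

Lemma difference_inbox (x y : R3) (t : Z3) : T x -> T y -> vsub x y = toR3 t -> inbox t = true.
Proof.
  intros Hx Hy E. destruct (difference_orbit x y Hx Hy) as (z & e & E0 & E1 & E2 & _ & Hz & _).
  assert (B : forall i, Rabs (z i) <= 13 / 5).
  { intros i. destruct (Hz i) as (x' & y' & Hx' & Hy' & ->). apply T_c3; assumption. }
  assert (P : forall r s, Rabs r <= 2 -> Rabs (r * z s) <= 26 / 5).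
  { intros r s Hr. rewrite Rabs_mult. replace (26 / 5) with (2 * (13 / 5)) by lra.
    apply Rmult_le_compat; auto using Rabs_pos. }
  destruct ab_small as [A1 A2].
  pose proof (P _ 0%nat A1) as P1. pose proof (P _ 1%nat A1) as P2. pose proof (P _ 0%nat A2) as P3.
  pose proof (B 0%nat) as B0. pose proof (B 1%nat) as B1. pose proof (B 2%nat) as B2.
  apply Rabs_le_between in P1, P2, P3, B0, B1, B2.
  apply toR3_inbox; rewrite <- E.
  - rewrite E2. apply Rabs_le. lra.
  - rewrite E1. apply Rabs_le. lra.
  - rewrite E0. apply Rabs_le. lra.
Qed.

Definition kb (j : bool) : R3 := if j then half_e1 else vscale (-1) half_e1.

Fixpoint follows (w : list bool) (x : R3) : Prop :=
  T x /\ match w with nil => True | j :: w' => follows w' (vsub (mv M x) (kb j)) end.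

Lemma follows_T (w : list bool) (x : R3) : follows w x -> T x.
Proof. destruct w; intros H; apply H. Qed.

Lemma twin_kb (y : R3) : T y <-> exists j, T (vsub (mv M y) (kb j)).
Proof.
  rewrite twin_eq. unfold M at 1. rewrite detZ_M_ab. simpl (Z.to_nat _). split.
  - intros ([|[|j]] & Hj & H); [exists false; exact H|exists true; exact H|lia].
  - intros ([|] & H); [exists 1%nat|exists O]; (split; [lia|exact H]).
Qed.

(** Prescribed digits are realised from last to first by contracting [t0]. *)
Lemma follows_exists (w : list bool) : exists x, follows w x.
Proof.
  induction w as [|j w (x & Hx)]; [exists t0; simpl; auto|].
  exists (minv M (vadd x (kb j))).
  assert (E : vsub (mv M (minv M (vadd x (kb j)))) (kb j) = x).
  { rewrite mv_minv by (apply expanding_det, M_exp). apply vsub_vadd_l. }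
  split; [|rewrite E; exact Hx]. apply twin_kb. exists j. rewrite E. apply (follows_T w), Hx.
Qed.

(** If [x - t] were in [T], one of its digit choices would keep it there along the orbit of [x]. The
    difference would then stay in the box, where every branch is eventually expelled. *)
Lemma dies_spec (w : list bool) (x : R3) (t : Z3) :
  follows w x -> dies a b w t = true -> ~ T (vsub x (toR3 t)).
Proof.
  revert x t. induction w as [|j w IH]; intros x t Hx Hd HT; [discriminate|].
  destruct Hx as [Tx Hx]. simpl in Hd.
  apply twin_kb in HT. destruct HT as (j' & HT).
  set (x' := vsub (mv M x) (kb j)) in *.
  assert (Go : forall s, (if inbox (child a b t s) then dies a b w (child a b t s) else true) = true ->
    vsub (mv M (vsub x (toR3 t))) (kb j') = vsub x' (toR3 (child a b t s)) -> False).
  { intros s Hs E. rewrite E in HT.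
    assert (I : inbox (child a b t s) = true).
    { apply (difference_inbox x' (vsub x' (toR3 (child a b t s)))).
      - apply (follows_T w), Hx.
      - exact HT.
      - generalize x' (toR3 (child a b t s)). clear. intros. vec. }
    rewrite I in Hs. apply (IH x' (child a b t s) Hx Hs HT). }
  apply andb_prop in Hd. destruct Hd as [Hd1 Hd2].
  destruct (Bool.bool_dec j j') as [<-|N].
  - apply (Go 0%Z Hd1). unfold x'. rewrite toR3_child, mv_vsub. fold M.
    generalize (mv M x) (mv M (toR3 t)) (kb j). clear. intros. vec.
  - apply (Go (if j then (-1)%Z else 1%Z) Hd2). unfold x'. rewrite toR3_child, mv_vsub. fold M.
    generalize (mv M x) (mv M (toR3 t)). intros p q. clear - N. unfold kb, half_e1.
    destruct j, j'; try congruence; vec.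
Qed.

Lemma twin_unique_point (w : list bool) : kills a b w = true ->
  exists x0, T x0 /\ forall z, int3 z -> z <> (0, 0, 0) -> ~ T (vsub x0 z).
Proof.
  intros Hw. destruct (follows_exists w) as (x & Hx). pose proof (follows_T w x Hx) as Tx.
  exists x. split; [exact Tx|]. intros z (p & q & r & ->) Nz HT.
  change (IZR p, IZR q, IZR r) with (toR3 (p, q, r)) in *.
  unfold kills in Hw. rewrite forallb_forall in Hw.
  assert (I : inbox (p, q, r) = true).
  { apply (difference_inbox x (vsub x (toR3 (p, q, r)))); auto.
    generalize (toR3 (p, q, r)). clear. intros. vec. }
  specialize (Hw _ (inbox_In _ I)). apply orb_prop in Hw. destruct Hw as [Hw|Hw].
  - apply eqb3_eq in Hw. apply Nz. rewrite Hw. reflexivity.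
  - apply (dies_spec w x _ Hx Hw HT).
Qed.

(** The entries [(1, 0, 0)] and [(-1, 0, 0)] certify that 0 belongs to both pieces of [T], which
    yields the chains. The entry twice [u] certifies [u] in [T], so 0 lies in the translate by [- u]
    and is not interior. *)
Theorem twindragon_not_simply_connected (w : list bool) (l : list Z3) (u : Z3) :
  kills a b w = true -> closed_list a b l = true ->
  In (1, 0, 0)%Z l -> In (-1, 0, 0)%Z l ->
  toR3 u <> (0, 0, 0) -> In (let '(x, y, z) := u in (2 * x, 2 * y, 2 * z)%Z) l ->
  ~ simply_connected (interior3 T) /\ ~ homeomorphic T closed_ball.
Proof.
  intros Hw Hl Hp Hn Nu Hu.
  pose proof (kd_digit_system a b) as Dig. fold M in Dig.
  destruct (twin_unique_point w Hw) as (x0 & Tx0 & Hx0).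
  assert (Disj := unique_point_disjoint M kd T K M_exp Dig T_bound twin_eq x0 Tx0 Hx0).
  assert (Cover := self_affine_cover M kd T K t0 M_exp Dig T_closed T_bound T_t0 twin_eq).
  assert (Conn : chain_connected T).
  { apply (common_point_chain_connected M kd T K M_exp T_bound twin_eq (0, 0, 0)).
    intros j _. destruct j as [|j].
    - replace (vsub (mv M (0, 0, 0)) (kd 0)) with (vscale (/ 2) (toR3 (1, 0, 0)%Z));
        [apply (twin_half l); assumption|]. unfold kd, half_e1, toR3. vec.
    - replace (vsub (mv M (0, 0, 0)) (kd (S j))) with (vscale (/ 2) (toR3 (-1, 0, 0)%Z));
        [apply (twin_half l); assumption|]. unfold kd, half_e1, toR3. vec. }
  assert (Out : ~ interior3 T (0, 0, 0)).
  { intros I. apply (Disj _ (vscale (IZR (-1)) (toR3 u)) I).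
    - apply int3_vscale. destruct u as [[x y] z]. eexists _, _, _. reflexivity.
    - intros E. apply Nu. revert E. generalize (toR3 u). clear. intros p E. vec_unfold.
      injection E; intros. repeat apply f_equal2; lra.
    - pose proof (twin_half l _ Hl Hu) as H. destruct u as [[x y] z]. unfold toR3 in *.
      rewrite !mult_IZR in H.
      replace (vsub (0, 0, 0) (vscale (-1) (IZR x, IZR y, IZR z))) with
        (vscale (/ 2) (2 * IZR x, 2 * IZR y, 2 * IZR z)); [exact H|]. clear. vec. }
  assert (Far := covering_far_chain T K T_closed T_bound Cover Disj Conn (0, 0, 0) K Out).
  split.
  - apply (not_simply_connected (interior3 T) (0, 0, 0) K); auto.
    + apply interior3_open.
    + intros x. apply interior3_refl, twin_refl.
    + intros x Hx. apply T_bound, interior3_sub, Hx.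
  - apply (not_homeomorphic_ball T (0, 0, 0) K); auto. apply twin_refl.
Qed.

End Twindragon.

Theorem theorem12p2 :
  (forall (T : R3 -> Prop) (c : R3),
      self_affine_lattice_tile T -> connected3 T -> lattice_tiling T ->
      (forall x, T x <-> T (vsub (vscale 2 c) x)) ->
      ~ interior3 T c ->
      ~ simply_connected (interior3 T))
  /\
  (forall (a b : Z), ((a, b) = (0%Z, 1%Z) \/ (a, b) = (2%Z, (-2)%Z)) ->
     forall T : R3 -> Prop,
       compact3 T -> nonempty T -> twindragon_eq a b T ->
       ~ simply_connected (interior3 T) /\ ~ homeomorphic T closed_ball).
Proof.
  split; [exact symmetric_tile_not_simply_connected|].
  intros a b Hab T Tcomp (t0 & Tt0) Teq.
  destruct (compact_bounded T Tcomp) as (K & TK).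
  pose proof (compact_closed T Tcomp) as Tcl.
  pose proof (M_ab_expanding a b Hab) as HM.
  destruct Hab as [E|E]; injection E; intros -> ->; clear E.
  (* Six steps of the recurrence express [z 0] through [z 6], [z 7], [z 8] with coefficients
     [1/64, -14/64, 11/64], those of the inverse sixth power of the eigenvalue; their moduli sum to
     13/32. The errors enter with total weight 93/64, and the bound is [93/38 < 13/5]. *)
  - assert (C3 : forall x y, T x -> T y -> Rabs (c3 (vsub x y)) <= 13 / 5).
    { intros x y Hx Hy. eapply Rle_trans;
        [apply (difference_c3_bound 0 1 T K t0 TK Tt0 Teq (13 / 32) (93 / 64))|]; auto; try lra.
      intros z e B He Hr Hz.
      assert (He' : forall i, -1 <= e i <= 1) by (intros i; apply Rabs_le_between, He).
      assert (Hz' : forall i, - B <= z i <= B) by (intros i; apply Rabs_le_between, Hz).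
      pose proof (Hr 0%nat). pose proof (Hr 1%nat). pose proof (Hr 2%nat).
      pose proof (Hr 3%nat). pose proof (Hr 4%nat). pose proof (Hr 5%nat).
      pose proof (He' 0%nat). pose proof (He' 1%nat). pose proof (He' 2%nat).
      pose proof (He' 3%nat). pose proof (He' 4%nat). pose proof (He' 5%nat).
      pose proof (Hz' 6%nat). pose proof (Hz' 7%nat). pose proof (Hz' 8%nat).
      apply Rabs_le. lra. }
    (* The digits 0 and 1 of the word stand for [-e1/2] and [e1/2]. The list is a finite set of
       doubled points, each with a child in it. *)
    apply (twindragon_not_simply_connected 0 1 T K t0 HM Tcl TK Tt0 Teq C3) with
      (w := map (Nat.eqb 1) (0 :: 1 :: 0 :: 1 :: 0 :: 1 :: 0 :: 1 :: 1 :: 0 :: 1 :: 0 :: 0 :: 0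
             :: 1 :: 0 :: 0 :: 0 :: nil)%nat)
      (l := ((-3, -1, 2) :: (-3, 1, 1) :: (-1, -2, 2) :: (-1, -1, 1) :: (-1, 0, 0)
             :: (-1, 0, 1) :: (-1, 1, 0) :: (-1, 2, -1) :: (1, -2, 1) :: (1, -1, 0)
             :: (1, 0, -1) :: (1, 0, 0) :: (1, 1, -1) :: (1, 2, -2) :: (2, -2, 0)
             :: (3, -1, -1) :: (3, 1, -2) :: nil)%Z)
      (u := (1, -1, 0)%Z).
    + split; apply Rabs_le; lra.
    + vm_compute. reflexivity.
    + vm_compute. reflexivity.
    + simpl. tauto.
    + simpl. tauto.
    + unfold toR3. intros E. injection E; intros. lra.
    + simpl. tauto.
  (* Seven steps are taken here: [z 7], [z 8], [z 9] have coefficients [-1/4, 0, 1/8] and the errors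
     total weight 13/8. The resulting bound is exactly 13/5, the constant required of both
     twindragons. *)
  - assert (C3 : forall x y, T x -> T y -> Rabs (c3 (vsub x y)) <= 13 / 5).
    { intros x y Hx Hy. eapply Rle_trans;
        [apply (difference_c3_bound 2 (-2) T K t0 TK Tt0 Teq (3 / 8) (13 / 8))|]; auto; try lra.
      intros z e B He Hr Hz.
      assert (He' : forall i, -1 <= e i <= 1) by (intros i; apply Rabs_le_between, He).
      assert (Hz' : forall i, - B <= z i <= B) by (intros i; apply Rabs_le_between, Hz).
      pose proof (Hr 0%nat). pose proof (Hr 1%nat). pose proof (Hr 2%nat).
      pose proof (Hr 3%nat). pose proof (Hr 4%nat). pose proof (Hr 5%nat).
      pose proof (Hr 6%nat). pose proof (He' 0%nat). pose proof (He' 1%nat).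
      pose proof (He' 2%nat). pose proof (He' 3%nat). pose proof (He' 4%nat).
      pose proof (He' 5%nat). pose proof (He' 6%nat). pose proof (Hz' 7%nat).
      pose proof (Hz' 8%nat). pose proof (Hz' 9%nat).
      apply Rabs_le. lra. }
    apply (twindragon_not_simply_connected 2 (-2) T K t0 HM Tcl TK Tt0 Teq C3) with
      (w := map (Nat.eqb 1) (0 :: 1 :: 0 :: 1 :: 1 :: 0 :: 0 :: 0 :: 0 :: 0 :: 1 :: 1 :: 0 :: 0
             :: 1 :: 1 :: 1 :: 1 :: 0 :: 0 :: 0 :: nil)%nat)
      (l := ((-3, 3, -1) :: (-1, -1, 1) :: (-1, 0, 0) :: (-1, 1, 0) :: (-1, 3, -2)
             :: (1, -1, 0) :: (1, 0, 0) :: (1, 1, -1) :: (2, -4, 2) :: (3, -3, 1)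
             :: (3, -2, 0) :: nil)%Z)
      (u := (1, -2, 1)%Z).
    + split; apply Rabs_le; lra.
    + vm_compute. reflexivity.
    + vm_compute. reflexivity.
    + simpl. tauto.
    + simpl. tauto.
    + unfold toR3. intros E. injection E; intros. lra.
    + simpl. tauto.
Qed.
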